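(* Let $\mathcal{H}$ be a finite-dimensional complex Hilbert space, $H_0,H_1,\dots,H_{n_c}$ Hermitian operators on $\mathcal{H}$, $D$ a real symmetric positive $n_c\times n_c$ matrix, $R$ a real symmetric positive $n_c\times n_c$ matrix, $Q>0$, $T>0$, $\phi\in\mathcal{H}$ a unit vector (target state) and $\psi_0\in\mathcal{H}$ a unit vector (initial state). Put $C_a:=-iH_a$ for $a=1,\dots,n_c$. Let $\mathcal{C}'=\{C'_a\}_{a=1}^{n_c}$ be operators on $\mathcal{H}$ and $D'$ a real symmetric $n_c\times n_c$ matrix such that, for some invertible $G\in\mathbb{C}^{n_c\times n_c}$, $$C_b=\sum_{a=1}^{n_c} C'_a\,G_{ab}\quad (b=1,\dots,n_c),\qquad D'=G D G^\dagger .$$ Let $\mathcal{U}_o$ be the set of open-loop controls. For $u\in\mathcal{U}_o$ let $\rho$ be the solution on $[0,T]$ of the Lindblad equation $$\dot\rho=-i\Big[H_0+\sum_a u_a(t)H_a,\ \rho\Big]+\sum_{a,b}D'_{ab}\Big(C'_a\rho {C'_b}^\dagger-\tfrac12\{{C'_b}^\dagger C'_a,\rho\}\Big),\qquad \rho(0)=\psi_0\psi_0^\dagger,$$ and set $$C_{\det}[u]=-\frac{Q}{2}\operatorname{Tr}\big(\rho(T)\,\phi\phi^\dagger\big)+\frac12\int_0^T u(t)^TRu(t)\,dt .$$ Let $\psi_t$ be the solution of the Itô stochastic Schrödinger equation $$d\psi_t=-iH_0\psi_t\,dt-\frac12\sum_{a,b}D_{ab}H_aH_b\psi_t\,dt-i\sum_aH_a\psi_t\,(u_a(t)\,dt+dW^a_t)$$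 with initial state $\psi_0$ at $t=0$, and set $$C[u]=\Big\langle -\frac{Q}{2}\operatorname{Tr}\big(\psi_T\psi_T^\dagger\,\phi\phi^\dagger\big)+\frac12\int_0^Tu(t)^TRu(t)\,dt+\int_0^Tu(t)^TR\,dW_t\Big\rangle .$$ Then $C_{\det}[u]=C[u]$ for every $u\in\mathcal{U}_o$; that is, the deterministic control problem of minimizing $C_{\det}$ over $\mathcal{U}_o$ and the stochastic control problem of minimizing $C$ over $\mathcal{U}_o$ are equivalent.
   Context: An open-loop control is a deterministic, state-independent function $u=(u_1,\dots,u_{n_c}):[0,T]\to\mathbb{R}^{n_c}$, regular enough (e.g. bounded and measurable) that the equations and integrals in the claim are well defined; $\mathcal{U}_o$ is a set of such functions. $W_t=(W^1_t,\dots,W^{n_c}_t)$ is a real $n_c$-dimensional Brownian motion started at $0$ with $\langle dW_t\rangle=0$ and $\langle dW_t\,dW_t^T\rangle=D\,dt$. Stochastic integrals are in the Itô sense and $\langle\cdot\rangle$ denotes expectation over all noise realizations. $\psi^\dagger$ and $A^\dagger$ denote the adjoint (conjugate transpose), so $\psi\psi^\dagger$ is the rank-one operator associated with $\psi$; $\{A,B\}=AB+BA$ and $[A,B]=AB-BA$. *)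

(* Defs.v *)
From HB Require Import structures.
From mathcomp Require Import all_boot all_order all_algebra.
From mathcomp Require Import all_classical all_reals all_analysis.
From mathcomp Require Import complex.

Set Implicit Arguments.
Unset Strict Implicit.
Unset Printing Implicit Defensive.

Import Order.TTheory GRing.Theory Num.Theory.
Import numFieldNormedType.Exports.

Local Open Scope classical_set_scope.
Local Open Scope ring_scope.
Local Open Scope sesquilinear_scope.

(* The Hilbert space is C^N, C = R[i], with vectors 'cV[R[i]]_N, operators
   'M[R[i]]_N and adjoint A^t* (conjugate transpose). *)

(* "Positive" is rendered by x^T A x >= 0, so that the positive definite and the
   positive semidefinite case are both covered. *)
Definition posmx (R : realType) (n : nat) (A : 'M[R]_n) : Prop :=
  A \is symmetricmx /\ forall x : 'cV[R]_n, 0 <= (x^T *m A *m x) 0 0.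

Section ComplexMatrixFunctions.
Context {R : realType}.

Definition mx_measurable_fun d (X : measurableType d) (m n : nat) (S : set X)
    (f : X -> 'M[R[i]]_(m, n)) : Prop :=
  forall i j, measurable_fun S (fun x => complex.Re (f x i j)) /\
              measurable_fun S (fun x => complex.Im (f x i j)).

Definition mx_continuous_on (m n : nat) (S : set R)
    (f : R -> 'M[R[i]]_(m, n)) : Prop :=
  forall i j, {within S, continuous (fun t => complex.Re (f t i j))} /\
              {within S, continuous (fun t => complex.Im (f t i j))}.

(* Entrywise Lebesgue integral over [0, t]. *)
Definition mx_integral (m n : nat) (f : R -> 'M[R[i]]_(m, n)) (t : R) :
    'M[R[i]]_(m, n) :=
  \matrix_(i, j)
    Complex (\int[lebesgue_measure]_(s in `[0, t]) complex.Re (f s i j))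
            (\int[lebesgue_measure]_(s in `[0, t]) complex.Im (f s i j)).

Definition sqnorm (m n : nat) (A : 'M[R[i]]_(m, n)) : R :=
  \sum_i \sum_j (complex.Re (A i j) ^+ 2 + complex.Im (A i j) ^+ 2).

End ComplexMatrixFunctions.

Section Filtration.
Context {R : realType} d (Omega : measurableType d).

Record filtration (F : R -> set (set Omega)) : Prop := {
  filtration_sigma : forall t, 0 <= t -> sigma_algebra setT (F t) ;
  filtration_measurable : forall t, 0 <= t -> F t `<=` measurable ;
  filtration_mono : forall s t, 0 <= s -> s <= t -> F s `<=` F t }.

Definition measurable_wrt (G : set (set Omega)) (X : Omega -> R) : Prop :=
  preimage_set_system setT X measurable `<=` G.

Definition mx_adapted (m n : nat) (F : R -> set (set Omega)) (T : R)
    (f : R -> Omega -> 'M[R[i]]_(m, n)) : Prop :=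
  forall t i j, 0 <= t <= T ->
    measurable_wrt (F t) (fun w => complex.Re (f t w i j)) /\
    measurable_wrt (F t) (fun w => complex.Im (f t w i j)).

End Filtration.

(* N(0, v). [normal_prob] is a uniform law when its deviation is 0, hence the
   separate degenerate case. *)
Definition centered_gaussian (R : realType) (v : R) (B : set R) : \bar R :=
  if v == 0 then \d_(0 : R) B else normal_prob 0 (Num.sqrt v) B.

(* The law N(0, (t - s) D) of an increment is expressed through its
   one-dimensional projections. *)
Record brownian_motion (R : realType) d (Omega : measurableType d)
    (P : probability Omega R) (F : R -> set (set Omega)) (n : nat)
    (D : 'M[R]_n) (W : R -> Omega -> 'cV[R]_n) : Prop := {
  bm_adapted : forall t a, 0 <= t ->
    measurable_wrt (F t) (fun w => W t w a 0) ;
  bm_start : {ae P, forall w, W 0 w = 0} ;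
  bm_continuous : {ae P, forall w, forall a,
    {within `[0, +oo[, continuous (fun t => W t w a 0)}} ;
  bm_gaussian : forall s t (x : 'cV[R]_n) (B : set R),
    0 <= s -> s <= t -> measurable B ->
    P ((fun w => (x^T *m (W t w - W s w)) 0 0) @^-1` B) =
    centered_gaussian ((t - s) * (x^T *m D *m x) 0 0) B ;
  bm_independent : forall s t (A B : set Omega), 0 <= s -> s <= t ->
    F s A ->
    <<s \bigcup_a preimage_set_system setT
          (fun w => W t w a 0 - W s w a 0) measurable >> B ->
    P (A `&` B) = (P A * P B)%E }.

Section Ito.
Context {R : realType} d (Omega : measurableType d) (P : probability Omega R)
        (F : R -> set (set Omega)).

(* The process  sum_i coef_i 1_]time_i, time_(i+1)]  on [0, t]. *)
Record simple_process (t : R) := SimpleProcess {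
  sp_size : nat ;
  sp_time : nat -> R ;
  sp_coef : nat -> Omega -> R ;
  sp_time_ge0 : 0 <= sp_time 0%N ;
  sp_time_le : sp_time sp_size <= t ;
  sp_time_mono : forall i, (i < sp_size)%N -> sp_time i <= sp_time i.+1 ;
  sp_coef_adapted : forall i, (i < sp_size)%N ->
    measurable_wrt (F (sp_time i)) (sp_coef i) ;
  sp_coef_bounded : forall i, (i < sp_size)%N ->
    exists M, forall w, `|sp_coef i w| <= M }.

Definition sp_value t (g : simple_process t) (s : R) (w : Omega) : R :=
  \sum_(i < sp_size g)
    sp_coef g i w * \1_(`]sp_time g i, sp_time g i.+1]) s.

Definition sp_ito t (g : simple_process t) (B : R -> Omega -> R)
    (w : Omega) : R :=
  \sum_(i < sp_size g)
    sp_coef g i w * (B (sp_time g i.+1) w - B (sp_time g i) w).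

Definition sq_mass (t : R) (f : R -> Omega -> R) : \bar R :=
  (\int[P]_w \int[lebesgue_measure]_(s in `[0%R, t]) ((f s w) ^+ 2)%:E)%E.

(* I is (a version of) the Ito integral of f dB over [0, t]: f is a measurable
   adapted process with finite E int_0^t f^2 ds, and I is the L^2(P)-limit of
   the integrals of simple processes converging to f in L^2(P x ds). *)
Definition is_ito_integral (B : R -> Omega -> R) (t : R)
    (f : R -> Omega -> R) (I : Omega -> R) : Prop :=
  [/\ forall s, 0 <= s <= t -> measurable_wrt (F s) (f s),
      measurable_fun (`[0, t] `*` [set: Omega])
        (fun p : R * Omega => f p.1 p.2),
      (sq_mass t f < +oo)%E,
      measurable_fun [set: Omega] I &
      exists g : nat -> simple_process t,
        ((fun k => sq_mass t (fun s w => f s w - sp_value (g k) s w))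
           @ \oo --> 0%E) /\
        ((fun k => 'E_P[fun w => ((I w - sp_ito (g k) B w) ^+ 2)%R]%E)
           @ \oo --> 0%E) ].

Definition is_ito_integral_mx (m n : nat) (B : R -> Omega -> R) (t : R)
    (f : R -> Omega -> 'M[R[i]]_(m, n)) (I : Omega -> 'M[R[i]]_(m, n)) : Prop :=
  forall i j,
    is_ito_integral B t (fun s w => complex.Re (f s w i j))
      (fun w => complex.Re (I w i j)) /\
    is_ito_integral B t (fun s w => complex.Im (f s w i j))
      (fun w => complex.Im (I w i j)).

(* I = int_0^t h(s)^T dW_s, the sum of the scalar integrals of h_a dW^a. *)
Definition is_ito_integral_dot (n : nat) (W : R -> Omega -> 'cV[R]_n) (t : R)
    (h : R -> 'cV[R]_n) (I : Omega -> R) : Prop :=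
  exists J : 'I_n -> Omega -> R,
    (forall a, is_ito_integral (fun s w => W s w a 0) t
                 (fun s _ => h s a 0) (J a)) /\
    I = (fun w => \sum_a J a w).

End Ito.

Definition open_loop_control (R : realType) (n : nat) (T : R)
    (u : R -> 'cV[R]_n) : Prop :=
  (forall a, measurable_fun `[0, T] (fun t => u t a 0)) /\
  exists M, forall t a, 0 <= t <= T -> `|u t a 0| <= M.

Section Dynamics.
Context {R : realType} (N n : nat).
Variables (H0 : 'M[R[i]]_N) (H : 'I_n -> 'M[R[i]]_N).

Definition commutator (A B : 'M[R[i]]_N) := A *m B - B *m A.
Definition anticommutator (A B : 'M[R[i]]_N) := A *m B + B *m A.

Definition lindblad_rhs (D' : 'M[R]_n) (C' : 'I_n -> 'M[R[i]]_N)
    (u : 'cV[R]_n) (rho : 'M[R[i]]_N) : 'M[R[i]]_N :=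
  - 'i%C *: commutator (H0 + \sum_a (u a 0)%:C%C *: H a) rho +
  \sum_a \sum_b (D' a b)%:C%C *:
    (C' a *m rho *m (C' b)^t* -
     2^-1 *: anticommutator ((C' b)^t* *m C' a) rho).

(* Since u is merely measurable in time, the equation is understood in the
   sense of Caratheodory, i.e. in integrated form. *)
Definition lindblad_solution (D' : 'M[R]_n) (C' : 'I_n -> 'M[R[i]]_N)
    (T : R) (u : R -> 'cV[R]_n) (rho0 : 'M[R[i]]_N)
    (rho : R -> 'M[R[i]]_N) : Prop :=
  mx_continuous_on `[0, T] rho /\
  forall t, 0 <= t <= T ->
    rho t = rho0 + mx_integral (fun s => lindblad_rhs D' C' (u s) (rho s)) t.

Definition sse_drift (D : 'M[R]_n) (u : 'cV[R]_n) (psi : 'cV[R[i]]_N) :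
    'cV[R[i]]_N :=
  - 'i%C *: (H0 *m psi)
  - 2^-1 *: \sum_a \sum_b (D a b)%:C%C *: (H a *m H b *m psi)
  - 'i%C *: \sum_a (u a 0)%:C%C *: (H a *m psi).

Definition sse_solution d (Omega : measurableType d) (P : probability Omega R)
    (F : R -> set (set Omega)) (W : R -> Omega -> 'cV[R]_n)
    (D : 'M[R]_n) (T : R) (u : R -> 'cV[R]_n) (psi0 : 'cV[R[i]]_N)
    (psi : R -> Omega -> 'cV[R[i]]_N) : Prop :=
  [/\ mx_adapted F T psi,
      mx_measurable_fun (`[0, T] `*` [set: Omega])
        (fun p : R * Omega => psi p.1 p.2),
      (\int[P]_w \int[lebesgue_measure]_(s in `[0%R, T]) (sqnorm (psi s w))%:E
         < +oo)%E,
      {ae P, forall w, mx_continuous_on `[0, T] (fun t => psi t w)} &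
      forall t, 0 <= t <= T ->
        exists M : 'I_n -> Omega -> 'cV[R[i]]_N,
          (forall a, is_ito_integral_mx P F (fun s w => W s w a 0) t
                       (fun s w => - 'i%C *: (H a *m psi s w)) (M a)) /\
          {ae P, forall w,
             psi t w = psi0 + mx_integral (fun s => sse_drift D (u s) (psi s w)) t
                       + \sum_a M a w} ].

End Dynamics.

Section Costs.
Context {R : realType} (N n : nat).
Variables (Q T : R) (Rm : 'M[R]_n) (phi : 'cV[R[i]]_N).

Definition control_energy (u : R -> 'cV[R]_n) : R :=
  2^-1 * \int[lebesgue_measure]_(t in `[0, T]) ((u t)^T *m Rm *m u t) 0 0.

(* The traces are real, being traces of products of two Hermitian matrices;
   [complex.Re] only changes their type from R[i] to R. *)
Definition cost_det (u : R -> 'cV[R]_n) (rho : R -> 'M[R[i]]_N) : R :=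
  - (Q / 2) * complex.Re (\tr (rho T *m (phi *m phi^t*))) + control_energy u.

(* Z stands for the Ito integral of u^T R dW over [0, T]. *)
Definition cost_stoch d (Omega : measurableType d) (P : probability Omega R)
    (u : R -> 'cV[R]_n) (psi : R -> Omega -> 'cV[R[i]]_N) (Z : Omega -> R) :
    \bar R :=
  'E_P[fun w =>
    (- (Q / 2) * complex.Re (\tr (psi T w *m (psi T w)^t* *m (phi *m phi^t*)))
     + control_energy u + Z w)%R]%E.

End Costs.

Definition minimizer (R : realType) (X : Type) (U : set X) (J : X -> \bar R)
    (u : X) : Prop :=
  U u /\ forall v, U v -> (J u <= J v)%E.

(* Main.v *)
(* The covariance sigma(t) = E[psi_t psi_t^*] solves the Lindblad equation, so it
   equals rho by Gronwall; the fidelity is linear in psi psi^*, and the Ito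
   integral of u^T R dW has mean zero, so the two costs agree.

   The equation for sigma needs E[X_t Y_t] for two real Ito processes only, and
   no pathwise Ito formula: the drift-drift term is Fubini, the noise-noise term
   is the Ito isometry (with the cross terms D_ab), and in the mixed term
   E[(int_0^t alpha_s ds) N_t] = int_0^t E[alpha_s N_s] ds by the martingale
   property, with N_s then read off the equation of Y.

   With C_a = -i H_a and A = -i(H_0 + sum u_a H_a) - (1/2) sum D_ab H_a H_b, both
   generators take the form A X + X A^* + sum D_ab C_a X C_b^*. The change of frame
   (C', D') -> (C, D) leaves every sum of D'_ab f(C'_a, C'_b^* ) with f bilinear
   unchanged. *)
Require Import Defs.
From HB Require Import structures.
From mathcomp Require Import all_boot all_order all_algebra.
From mathcomp Require Import all_classical all_reals all_analysis.
From mathcomp Require Import complex measurable_realfun ring lra.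

Set Implicit Arguments.
Unset Strict Implicit.
Unset Printing Implicit Defensive.

Import Order.TTheory GRing.Theory Num.Theory.
Import numFieldNormedType.Exports.

Local Open Scope classical_set_scope.
Local Open Scope ring_scope.
Local Open Scope sesquilinear_scope.

(** * Square-integrable functions *)

(** An Ito integral is given only at each fixed time, up to a null set, as an L^2 limit of simple
    integrals. The argument therefore works with inner products: they are continuous under L^2
    limits and insensitive to null sets that depend on t. Integrands are extended by 0 to the single
    space L^2(leb x P), so that integrals up to different times and against different components of
    W are compared by one polarized isometry.

    The mixed term asks for square integrability at every time: the martingale property is applied
    to alpha_s for each s, while finite mass over [0, T] controls only almost every s. For psi the
    remaining times are supplied by its own equation.

    What the moment formula yields for the covariance is integrability in time, whereas rho is
    continuous; uniqueness is therefore proved among integrable solutions. Complex quantities are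
    split into real and imaginary parts, on which the real matrix D acts separately. *)

Section SquareIntegrable.
Context d (X : measurableType d) (R : realType).
Variable mu : {measure set X -> \bar R}.
Implicit Types f g h : X -> R.

Definition sqint f : Prop :=
  measurable_fun setT f /\ mu.-integrable setT (EFin \o (fun x => f x ^+ 2)).

Definition dotL2 f g : R := \int[mu]_x (f x * g x).

(** Domination by [f^2 + g^2], whose integrability is that of the two squares. *)
Lemma sqintM f g : sqint f -> sqint g ->
  mu.-integrable setT (EFin \o (fun x => f x * g x)).
Proof.
move=> [mf f2] [mg g2].
apply: (le_integrable (f := EFin \o (fun x => f x * g x)) _ _ _
  (integrableD measurableT f2 g2)) => //.
  by apply/measurable_EFinP; exact: measurable_funM.
move=> x _ /=; rewrite lee_fin [leRHS]ger0_norm ?addr_ge0 ?sqr_ge0//.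
rewrite normrM -(real_normK (num_real (f x))) -(real_normK (num_real (g x))).
have := sqr_ge0 (`|f x| - `|g x|); have := normr_ge0 (f x).
have := normr_ge0 (g x); nra.
Qed.

Lemma le_sqint f g : measurable_fun setT f -> sqint g ->
  (forall x, `|f x| <= `|g x|) -> sqint f.
Proof.
move=> mf [mg g2] fg; split => //.
apply: (le_integrable (f := EFin \o (fun x => f x ^+ 2)) _ _ _ g2) => //.
  by apply/measurable_EFinP; exact: measurable_funX.
move=> x _ /=; rewrite lee_fin !ger0_norm ?sqr_ge0//.
rewrite -(real_normK (num_real (f x))) -(real_normK (num_real (g x))).
by rewrite ler_sqr ?nnegrE.
Qed.

Lemma sqintZ a f : sqint f -> sqint (fun x => a * f x).
Proof.
move=> [mf f2]; split; first exact: measurable_funM.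
rewrite (_ : _ \o _ = (fun x => (a ^+ 2)%:E * (f x ^+ 2)%:E)%E); last first.
  by apply/funext => x /=; rewrite exprMn EFinM.
exact: integrableZl.
Qed.

Lemma sqintD f g : sqint f -> sqint g -> sqint (fun x => f x + g x).
Proof.
move=> hf hg; split; first by apply: measurable_funD; [case: hf|case: hg].
have fg : mu.-integrable setT (EFin \o (fun x => 2 * (f x * g x))).
  rewrite (_ : _ \o _ = (fun x => 2%:E * (f x * g x)%:E)%E)//.
  by apply: integrableZl => //; exact: sqintM.
have := integrableD measurableT (integrableD measurableT hf.2 hg.2) fg.
apply: eq_integrable => // x _ /=; rewrite -!EFinD; congr (_%:E); ring.
Qed.

Lemma sqintN f : sqint f -> sqint (fun x => - f x).
Proof.
by move=> /(sqintZ (-1)); congr sqint; apply/funext => x; rewrite mulN1r.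
Qed.

Lemma sqintB f g : sqint f -> sqint g -> sqint (fun x => f x - g x).
Proof. by move=> hf /sqintN; exact: sqintD. Qed.

Lemma sqint0 : sqint (fun=> 0).
Proof.
split=> //; rewrite (_ : _ \o _ = cst 0%E); first exact: integrable0.
by apply/funext => x /=; rewrite expr0n.
Qed.

Lemma sqint_sum (I : Type) (r : seq I) (p : pred I) (F : I -> X -> R) :
  (forall i, p i -> sqint (F i)) -> sqint (fun x => \sum_(i <- r | p i) F i x).
Proof.
move=> hF; elim: r => [|i r IH].
  by under eq_fun do rewrite big_nil; exact: sqint0.
under eq_fun do rewrite big_cons.
by case: (boolP (p i)) => pi //; apply: sqintD => //; exact: hF.
Qed.

Lemma dotC f g : dotL2 f g = dotL2 g f.
Proof. by congr fine; apply: eq_integral => x _; rewrite mulrC. Qed.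

Lemma dotDl f g h : sqint f -> sqint g -> sqint h ->
  dotL2 (fun x => f x + g x) h = dotL2 f h + dotL2 g h.
Proof.
move=> hf hg hh; rewrite /dotL2 -RintegralD//; try exact: sqintM.
by congr fine; apply: eq_integral => x _; rewrite mulrDl.
Qed.

Lemma dotZl a f h : sqint f -> sqint h ->
  dotL2 (fun x => a * f x) h = a * dotL2 f h.
Proof.
move=> hf hh; rewrite /dotL2 -RintegralZl//; last exact: sqintM.
by congr fine; apply: eq_integral => x _; rewrite mulrA.
Qed.

Lemma dotNl f h : sqint f -> sqint h -> dotL2 (fun x => - f x) h = - dotL2 f h.
Proof.
move=> hf hh; rewrite -mulN1r -dotZl//.
by congr dotL2; apply/funext => x; rewrite mulN1r.
Qed.

Lemma dotBl f g h : sqint f -> sqint g -> sqint h ->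
  dotL2 (fun x => f x - g x) h = dotL2 f h - dotL2 g h.
Proof. by move=> hf hg hh; rewrite dotDl ?dotNl//; exact: sqintN. Qed.

Lemma dot_suml (I : Type) (r : seq I) (p : pred I) (F : I -> X -> R) h :
  (forall i, p i -> sqint (F i)) -> sqint h ->
  dotL2 (fun x => \sum_(i <- r | p i) F i x) h =
  \sum_(i <- r | p i) dotL2 (F i) h.
Proof.
move=> hF hh; elim: r => [|i r IH].
  rewrite big_nil /dotL2; under eq_Rintegral do rewrite big_nil mul0r.
  by rewrite Rintegral_cst// mul0r.
rewrite big_cons -IH; under eq_fun do rewrite big_cons.
case: (boolP (p i)) => pi //; rewrite dotDl//; first exact: hF.
exact: sqint_sum.
Qed.

Lemma dotDr f g h : sqint f -> sqint g -> sqint h ->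
  dotL2 h (fun x => f x + g x) = dotL2 h f + dotL2 h g.
Proof. by move=> *; rewrite dotC dotDl// !(dotC h). Qed.

Lemma dotZr a f h : sqint f -> sqint h ->
  dotL2 h (fun x => a * f x) = a * dotL2 h f.
Proof. by move=> *; rewrite dotC dotZl// !(dotC h). Qed.

Lemma dotBr f g h : sqint f -> sqint g -> sqint h ->
  dotL2 h (fun x => f x - g x) = dotL2 h f - dotL2 h g.
Proof. by move=> *; rewrite dotC dotBl// !(dotC h). Qed.

Lemma dot_sumr (I : Type) (r : seq I) (p : pred I) (F : I -> X -> R) h :
  (forall i, p i -> sqint (F i)) -> sqint h ->
  dotL2 h (fun x => \sum_(i <- r | p i) F i x) =
  \sum_(i <- r | p i) dotL2 h (F i).
Proof.
by move=> *; rewrite dotC dot_suml//; apply: eq_bigr => i _; rewrite dotC.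
Qed.

Lemma dot_ge0 f : 0 <= dotL2 f f.
Proof. by apply: Rintegral_ge0 => x _; rewrite -expr2 sqr_ge0. Qed.

Lemma dotL2_sqr f : dotL2 f f = \int[mu]_x (f x ^+ 2).
Proof. by congr fine; apply: eq_integral => x _; rewrite expr2. Qed.

(** The quadratic form of [r f + s g] is nonnegative for all r and s; the inequality is read off at
    well-chosen coefficients. *)
Lemma CauchySchwarzL2 f g : sqint f -> sqint g ->
  (dotL2 f g) ^+ 2 <= dotL2 f f * dotL2 g g.
Proof.
move=> hf hg; set a := dotL2 f f; set b := dotL2 f g; set c := dotL2 g g.
have key r s : 0 <= r ^+ 2 * a + 2 * r * s * b + s ^+ 2 * c.
  have := dot_ge0 (fun x => r * f x + s * g x).
  have hrf := sqintZ r hf; have hsg := sqintZ s hg.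
  rewrite dotDl ?dotDr ?dotZl ?dotZr//; try exact: sqintD.
  rewrite (dotC g f) -/a -/b -/c.
  suff -> : r ^+ 2 * a + 2 * r * s * b + s ^+ 2 * c =
    r * (r * a) + r * (s * b) + (s * (r * b) + s * (s * c)) by [].
  ring.
have a0 : 0 <= a by exact: dot_ge0.
have c0 : 0 <= c by exact: dot_ge0.
(* For c > 0 the pair (c, -b) gives c (a c - b^2) >= 0. For c = 0 the pair (b, -(a + 1)) gives -(a +
   2) b^2 >= 0, hence b = 0. *)
have [c1|c1] := ltP 0 c; first by have := key c (- b); nra.
have c00 : c = 0 by apply/eqP; rewrite eq_le c1 c0.
have := key 1 (- b); have := key b (- (a + 1)); rewrite c00; nra.
Qed.

(** The squared distance is a real number, and [dotL2] sends an infinite integral to 0; this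
    expresses L^2 convergence only together with the square integrability that [cvg_dotL2] assumes
    separately. *)
Definition cvgL2 (fk : nat -> X -> R) f : Prop :=
  (fun k => dotL2 (fun x => f x - fk k x) (fun x => f x - fk k x)) @ \oo --> 0.

Lemma cvgL2_cst f : cvgL2 (fun=> f) f.
Proof.
have f0 : dotL2 (fun x => f x - f x) (fun x => f x - f x) = 0.
  rewrite /dotL2; under eq_Rintegral do rewrite subrr mul0r.
  by rewrite Rintegral_cst// mul0r.
by rewrite /cvgL2 f0; exact: cvg_cst.
Qed.

Lemma cvg_dotL2 (fk gk : nat -> X -> R) f g :
  (forall k, sqint (fk k)) -> (forall k, sqint (gk k)) ->
  sqint f -> sqint g -> cvgL2 fk f -> cvgL2 gk g ->
  (fun k => dotL2 (fk k) (gk k)) @ \oo --> dotL2 f g.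
Proof.
move=> qfk qgk hf hg cf cg; move: cf cg; rewrite /cvgL2.
set a := fun k => dotL2 _ _; set b := fun k => dotL2 _ _ => cf cg.
have c1 : (fun k => Num.sqrt (a k * dotL2 g g) + Num.sqrt (dotL2 f f * b k)
            + Num.sqrt (a k * b k)) @ \oo --> 0.
  have s0 (u : nat -> R) : u @ \oo --> 0 -> (fun k => Num.sqrt (u k)) @ \oo --> 0.
    move=> cu; rewrite -[X in _ --> X]sqrtr0.
    by apply: continuous_cvg => //; exact: sqrt_continuous.
  rewrite -[X in _ --> X]addr0 -[X in _ --> X + _]addr0.
  apply: cvgD; first apply: cvgD; apply: s0.
  - by rewrite -[X in _ --> X](mul0r (dotL2 g g)); apply: cvgMl.
  - by rewrite -[X in _ --> X](mulr0 (dotL2 f f)); apply: cvgMr.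
  - by rewrite -[X in _ --> X](mulr0 0); apply: cvgM.
apply/cvgrPdist_lt => e e0.
move/cvgrPdist_lt : c1 => /(_ _ e0); rewrite -/a -/b.
apply: filterS => k; rewrite sub0r normrN; apply: le_lt_trans.
have hfk := qfk k; have hgk := qgk k.
have hdf := sqintB hf hfk; have hdg := sqintB hg hgk.
(* Expanded around the limits: the bound then contains only the fixed norms of f and g and the two
   errors. *)
have -> : dotL2 f g - dotL2 (fk k) (gk k) =
   dotL2 (fun x => f x - fk k x) g + dotL2 f (fun x => g x - gk k x)
   - dotL2 (fun x => f x - fk k x) (fun x => g x - gk k x).
  by rewrite !dotBl ?dotBr//; ring.
have cs u v : sqint u -> sqint v ->
    `|dotL2 u v| <= Num.sqrt (dotL2 u u * dotL2 v v).
  by move=> hu hv; rewrite -sqrtr_sqr ler_wsqrtr// CauchySchwarzL2.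
rewrite [leRHS]ger0_norm ?addr_ge0 ?sqrtr_ge0//.
apply: (le_trans (ler_normD _ _)); rewrite normrN lerD ?cs//.
by apply: (le_trans (ler_normD _ _)); rewrite lerD ?cs.
Qed.

Lemma ae_eq_sqint f g : measurable_fun setT g ->
  {ae mu, forall x, f x = g x} -> sqint f -> sqint g.
Proof.
move=> mg fg [mf f2]; split => //.
have mg2 : measurable_fun setT (EFin \o (fun x => g x ^+ 2)).
  by apply/measurable_EFinP; exact: measurable_funX.
apply/integrableP; split => //; move/integrableP : f2 => [mf2].
apply: le_lt_trans; rewrite le_eqVlt; apply/orP; left; apply/eqP.
apply: ae_eq_integral => //; try exact: measurableT_comp.
by apply: filterS fg => x fgx _ /=; rewrite fgx.
Qed.

Lemma ae_eq_dotL2 f g h : measurable_fun setT f -> measurable_fun setT g ->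
  measurable_fun setT h -> {ae mu, forall x, f x = g x} ->
  dotL2 f h = dotL2 g h.
Proof.
move=> mf mg mh fg; congr fine; apply: ae_eq_integral => //.
- by apply/measurable_EFinP; exact: measurable_funM.
- by apply/measurable_EFinP; exact: measurable_funM.
- by apply: filterS fg => x fgx _ /=; rewrite fgx.
Qed.

Lemma fin_sqint f : measurable_fun setT f ->
  (\int[mu]_x (f x ^+ 2)%:E < +oo)%E -> sqint f.
Proof.
move=> mf foo; split=> //; apply/integrableP; split.
  by apply/measurable_EFinP; exact: measurable_funX.
by under eq_integral do rewrite /= ger0_norm ?sqr_ge0//.
Qed.

Lemma sqint_fin f : sqint f ->
  (\int[mu]_x (f x ^+ 2)%:E = (dotL2 f f)%:E)%E.
Proof.
move=> [mf f2]; rewrite dotL2_sqr fineK//.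
exact: (integrable_fin_num _ f2).
Qed.

End SquareIntegrable.

Section FiniteMeasureSquareIntegrable.
Context d (X : measurableType d) (R : realType).
Variable mu : {finite_measure set X -> \bar R}.
Implicit Types f g : X -> R.

Lemma bounded_sqint f M : measurable_fun setT f -> (forall x, `|f x| <= M) ->
  sqint mu f.
Proof.
move=> mf fM; apply: (@le_sqint _ _ _ _ _ (fun=> M)) => //; last first.
  by move=> x; rewrite (le_trans (fM x))// ler_norm.
split => //; exact: finite_measure_integrable_cst.
Qed.

Lemma sqint_cst a : sqint mu (fun=> a).
Proof. exact: (@bounded_sqint _ `|a|). Qed.

Lemma sqint_integrable f : sqint mu f -> mu.-integrable setT (EFin \o f).
Proof.
move=> /sqintM /(_ (sqint_cst 1)).
by apply: eq_integrable => // x _ /=; rewrite mulr1.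
Qed.

End FiniteMeasureSquareIntegrable.

(** * Fubini's theorem for real-valued integrals *)

Section RealFubini.
Context d1 d2 (T1 : measurableType d1) (T2 : measurableType d2) (R : realType).
Variables (m1 : {sigma_finite_measure set T1 -> \bar R})
          (m2 : {sigma_finite_measure set T2 -> \bar R}).
Variable f : T1 * T2 -> R.
Hypothesis imf : (m1 \x m2)%E.-integrable setT (EFin \o f).

(** The inner integral of an integrable function is finite only almost everywhere. Passing to its
    finite part changes it on a null set, which carries Fubini over from the extended reals to
    [Rintegral]. *)
Let integrable_fine d (T : measurableType d) (mu : {measure set T -> \bar R})
    (F : T -> \bar R) : mu.-integrable setT F ->
  mu.-integrable setT (EFin \o (fun x => fine (F x))) /\
  fine (\int[mu]_x F x)%E = \int[mu]_x fine (F x).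
Proof.
move=> iF.
have mF : measurable_fun setT (EFin \o (fun x => fine (F x))).
  apply/measurable_EFinP; apply: measurableT_comp => //.
  exact: measurable_int iF.
have aeF : ae_eq mu setT F (EFin \o (fun x => fine (F x))).
  apply: filterS (integrable_ae measurableT iF) => x xF xT.
  by rewrite /= fineK// xF.
split; last first.
  congr fine; apply: ae_eq_integral => //; exact: measurable_int iF.
apply/integrableP; split => //; move/integrableP : iF => [mF' Foo].
apply: le_lt_trans Foo; rewrite le_eqVlt; apply/orP; left; apply/eqP.
apply: ae_eq_integral => //; try exact: measurableT_comp.
by apply: filterS aeF => x xF xT; rewrite -xF.
Qed.

Lemma Rintegrable_fubini_F :
  m1.-integrable setT (EFin \o (fun x => \int[m2]_y f (x, y))).
Proof. by have [] := integrable_fine (integrable_fubini_F imf). Qed.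

Lemma Rintegral12_prod :
  \int[m1]_x \int[m2]_y f (x, y) = \int[(m1 \x m2)%E]_p f p.
Proof.
have [_ <-] := integrable_fine (integrable_fubini_F imf).
by congr fine; exact: integral12_prod_meas1 imf.
Qed.

(** Domination by the inner integral of the absolute value, which has a finite integral by Tonelli
    in the same order. *)
Let integrable_fubini_G : m2.-integrable setT (fubini_G m1 (EFin \o f)).
Proof.
have mf := measurable_int _ imf; have mG := measurable_fubini_G imf.
have mA : measurable_fun setT (fun y => \int[m1]_x `|(f (x, y))%:E|)%E.
  apply: (measurable_fun_fubini_tonelli_G (abse \o (EFin \o f))) => //=.
  exact: measurableT_comp.
apply/integrableP; split => //; apply: le_lt_trans ((integrable21ltyP _ _ mf).1 imf).
apply: ge0_le_integral => //; first exact: measurableT_comp.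
move=> y _; apply: le_abse_integral => //.
exact: measurableT_comp.
Qed.

Lemma Rintegrable_fubini_G :
  m2.-integrable setT (EFin \o (fun y => \int[m1]_x f (x, y))).
Proof. by have [] := integrable_fine integrable_fubini_G. Qed.

Lemma Rintegral21_prod :
  \int[m2]_y \int[m1]_x f (x, y) = \int[(m1 \x m2)%E]_p f p.
Proof.
have [_ <-] := integrable_fine integrable_fubini_G.
by congr fine; exact: integral21_prod_meas1 imf.
Qed.

End RealFubini.

(** * Sub-sigma-algebras and independence *)

Section SubSigmaAlgebra.
Context {R : realType} d (Omega : measurableType d).
Implicit Types (G : set (set Omega)) (X Y : Omega -> R).

(** Turns adaptedness into ordinary measurability on another measurable type, so that the closure
    properties of measurable functions apply to it. *)
Lemma measurable_wrtP G X : sigma_algebra setT G ->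
  measurable_wrt G X <->
  measurable_fun setT (X : g_sigma_algebraType G -> R).
Proof.
move=> sG; split=> [GX _ B mB|mX A [B mB <-]].
  by apply: sub_sigma_algebra; apply: GX; exists B.
by rewrite -(sigma_algebra_id sG); apply: mX.
Qed.

Lemma measurable_wrt_sub G1 G2 X : G1 `<=` G2 ->
  measurable_wrt G1 X -> measurable_wrt G2 X.
Proof. by move=> G12 GX; apply: subset_trans G12. Qed.

Lemma measurable_wrt_measurable G X : G `<=` measurable ->
  measurable_wrt G X -> measurable_fun setT X.
Proof. by move=> Gm GX _ B mB; apply: Gm; apply: GX; exists B. Qed.

Lemma measurable_wrt_cst G c : sigma_algebra setT G ->
  measurable_wrt G (fun=> c : R).
Proof. by move=> sG; apply/measurable_wrtP. Qed.

Lemma measurable_wrtM G X Y : sigma_algebra setT G -> measurable_wrt G X ->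
  measurable_wrt G Y -> measurable_wrt G (fun w => X w * Y w).
Proof.
move=> sG /(measurable_wrtP _ sG) mX /(measurable_wrtP _ sG) mY.
by apply/measurable_wrtP => //; exact: measurable_funM.
Qed.

Lemma measurable_wrtD G X Y : sigma_algebra setT G -> measurable_wrt G X ->
  measurable_wrt G Y -> measurable_wrt G (fun w => X w + Y w).
Proof.
move=> sG /(measurable_wrtP _ sG) mX /(measurable_wrtP _ sG) mY.
by apply/measurable_wrtP => //; exact: measurable_funD.
Qed.

Lemma measurable_wrtB G X Y : sigma_algebra setT G -> measurable_wrt G X ->
  measurable_wrt G Y -> measurable_wrt G (fun w => X w - Y w).
Proof.
move=> sG /(measurable_wrtP _ sG) mX /(measurable_wrtP _ sG) mY.
by apply/measurable_wrtP => //; exact: measurable_funB.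
Qed.

End SubSigmaAlgebra.

Section Independence.
Context {R : realType} d (Omega : measurableType d) (P : probability Omega R).

(* The joint law of (X, Y) is the product of the laws, by uniqueness of the
   product measure, so Fubini factors the integral of xy. *)
Lemma integral_indepM (G1 G2 : set (set Omega)) (X Y : Omega -> R) :
  (forall A B, G1 A -> G2 B -> P (A `&` B) = (P A * P B)%E) ->
  measurable_wrt G1 X -> measurable_wrt G2 Y ->
  P.-integrable setT (EFin \o X) -> P.-integrable setT (EFin \o Y) ->
  P.-integrable setT (EFin \o (fun w => X w * Y w)) ->
  \int[P]_w (X w * Y w) = (\int[P]_w X w) * (\int[P]_w Y w).
Proof.
move=> ind GX GY iX iY iXY.
have mX : measurable_fun setT X by apply/measurable_EFinP; case/integrableP: iX.
have mY : measurable_fun setT Y by apply/measurable_EFinP; case/integrableP: iY.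
pose X' : {mfun Omega >-> R} := HB.pack X (isMeasurableFun.Build _ _ _ _ X mX).
pose Y' : {mfun Omega >-> R} := HB.pack Y (isMeasurableFun.Build _ _ _ _ Y mY).
have mXY : measurable_fun setT (fun w => (X w, Y w)).
  by apply/measurable_fun_pairP; split.
pose XY' : {mfun Omega >-> (R * R)%type} :=
  HB.pack (fun w => (X w, Y w)) (isMeasurableFun.Build _ _ _ _ _ mXY).
have law A : measurable A ->
    (distribution P X' \x distribution P Y')%E A = distribution P XY' A.
  move=> mA; apply: product_measure_unique => // B C mB mC.
  apply: (ind (X @^-1` B) (Y @^-1` C)).
  - by apply: GX; exists B => //; rewrite setTI.
  - by apply: GY; exists C => //; rewrite setTI.
have mp : measurable_fun setT (fun p : R * R => (p.1 * p.2)%:E).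
  by apply/measurable_EFinP; exact: measurable_funM.
pose PX : probability R R := distribution P X'.
pose PY : probability R R := distribution P Y'.
have ip : (PX \x PY)%E.-integrable setT (fun p : R * R => (p.1 * p.2)%:E).
  apply/integrableP; split => //.
  rewrite (eq_measure_integral (distribution P XY')); last first.
    by move=> A mA _; exact: law.
  rewrite ge0_integral_distribution//; last by apply: measurableT_comp.
  by move/integrableP : iXY => [].
have i1 : PX.-integrable setT (EFin \o (fun x : R => x)).
  apply/integrableP; split; first exact/measurable_EFinP.
  rewrite ge0_integral_distribution//; last by apply: measurableT_comp => //; exact/measurable_EFinP.
  by move/integrableP : iX => [].
have i2 : PY.-integrable setT (EFin \o (fun x : R => x)).
  apply/integrableP; split; first exact/measurable_EFinP.
  rewrite ge0_integral_distribution//; last by apply: measurableT_comp => //; exact/measurable_EFinP.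
  by move/integrableP : iY => [].
transitivity (fine (\int[(PX \x PY)%E]_p (p.1 * p.2)%:E)%E).
  congr fine; rewrite (eq_measure_integral (distribution P XY')); last first.
    by move=> A mA _; exact: law.
  by rewrite integral_distribution.
rewrite -integral12_prod_meas1//.
transitivity (fine (\int[PX]_x ((\int[PY]_y y) * x)%:E)%E).
  congr fine; apply: eq_integral => x _.
  rewrite /fubini_F /=; under eq_integral do rewrite EFinM.
  rewrite integralZl// mulrC EFinM; congr (_ * _)%E.
  by rewrite /Rintegral fineK//; exact: integrable_fin_num.
transitivity ((\int[PY]_y y) * (\int[PX]_x x)).
  by rewrite -RintegralZl.
rewrite mulrC; congr (_ * _); congr fine.
  by rewrite integral_distribution//; exact/measurable_EFinP.
by rewrite integral_distribution//; exact/measurable_EFinP.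
Qed.

End Independence.

(** * Gaussian increments *)

Section GaussianMoments.
Context {R : realType}.
Local Notation mu := (@lebesgue_measure R).

(** The change of variables produces a Radon-Nikodym derivative; it agrees almost everywhere with
    [normal_pdf] because both have the same integral over every measurable set. *)
Lemma ge0_integral_normal_prob (m s : R) (f : R -> \bar R) :
  measurable_fun setT f -> (forall x, 0 <= f x)%E ->
  (\int[normal_prob m s]_x f x = \int[mu]_x (f x * (normal_pdf m s x)%:E))%E.
Proof.
move=> mf f0.
rewrite -(Radon_Nikodym_SigmaFinite.change_of_variables
  (normal_prob_dominates m s) f0 measurableT mf).
have dom := normal_prob_dominates m s.
have mp : measurable_fun setT (fun x => (normal_pdf m s x)%:E).
  by apply/measurable_EFinP; exact: measurable_normal_pdf.
apply: ae_eq_integral => //.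
- apply: emeasurable_funM => //.
  exact: measurable_int (Radon_Nikodym_SigmaFinite.f_integrable dom).
- exact: emeasurable_funM.
- apply: ae_eqe_mul2l; apply: integral_ae_eq => //.
    exact: Radon_Nikodym_SigmaFinite.f_integrable.
  by move=> E _ mE; rewrite -Radon_Nikodym_SigmaFinite.f_integral.
Qed.

(** With p the density, this makes [- s^2 p] a primitive of [x p(x)], the input of the integration
    by parts for the second moment. *)
Lemma is_derive_normal_pdf (s x : R) : s != 0 ->
  is_derive x 1 (normal_pdf 0 s) (- (x / s ^+ 2) * normal_pdf 0 s x).
Proof.
move=> s0; rewrite normal_pdfE//.
pose g (y : R) : R := - (y - 0) ^+ 2 / (s ^+ 2 *+ 2).
have dg : is_derive x 1 g (- (x / s ^+ 2)).
  have -> : g = (- (s ^+ 2 *+ 2)^-1) \*: (@idfun R ^+ 2).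
    by apply/funext => y; rewrite /g subr0 /= fctE mulNr mulrC /GRing.scale/= mulNr.
  apply: is_derive_eq; rewrite /GRing.scale /= expr1 mulr1.
  by rewrite -mulr_natr invfM; field.
have de : is_derive x 1 (expR \o g) (- (x / s ^+ 2) * expR (g x)).
  by rewrite mulrC; apply: is_derive1_comp.
have -> : (fun y => normal_peak s * normal_fun 0 s y) =
  normal_peak s \*: (expR \o g) by [].
by apply: is_derive_eq; rewrite /GRing.scale /= mulrCA.
Qed.

Lemma normal_pdf_even (s x : R) : s != 0 ->
  normal_pdf 0 s (- x) = normal_pdf 0 s x.
Proof. by move=> s0; rewrite normal_pdfE// /normal_fun !subr0 sqrrN. Qed.

(** The boundary term of that integration by parts. Since exp y >= y at y = n^2 / (2 s^2), the
    product n p(n) is at most the peak times 2 s^2 / n. *)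
Lemma cvg_natrM_normal_pdf (s : R) : s != 0 ->
  (fun n : nat => n%:R * normal_pdf 0 s n%:R) @ \oo --> (0 : R).
Proof.
move=> s0.
have s2 : 0 < s ^+ 2 by rewrite exprn_even_gt0.
have c0 : (fun n : nat => (normal_peak s * (s ^+ 2 *+ 2)) * n.+1%:R^-1) @ \oo
            --> (0 : R).
  rewrite -[X in _ --> X](mulr0 (normal_peak s * (s ^+ 2 *+ 2))).
  by apply: cvgMr; exact: cvg_harmonic.
rewrite -(cvg_shiftS (fun n : nat => n%:R * normal_pdf 0 s n%:R)).
apply: squeeze_cvgr c0; last exact: cvg_cst.
apply: nearW => n; rewrite mulr_ge0 ?normal_pdf_ge0//=.
rewrite normal_pdfE// /normal_fun subr0 mulrCA -mulrA ler_wpM2l ?normal_peak_ge0//.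
set a : R := n.+1%:R; have a0 : 0 < a by rewrite ltr0n.
rewrite mulNr expRN ler_pdivrMr ?expR_gt0//.
set c := s ^+ 2 *+ 2; have c1 : 0 < c by rewrite mulrn_wgt0.
apply: (@le_trans _ _ (c / a * (a ^+ 2 / c))).
  by rewrite (_ : c / a * _ = a)//; field; rewrite !gt_eqF.
rewrite ler_wpM2l ?divr_ge0 ?ltW//.
by apply: lt_le_trans (expR_ge1Dx _); rewrite ltrDr.
Qed.

Lemma second_moment_normal (s : R) : s != 0 ->
  (\int[normal_prob 0 s]_x (x ^+ 2)%:E = (s ^+ 2)%:E)%E.
Proof.
move=> s0; have s2 : 0 < s ^+ 2 by rewrite exprn_even_gt0.
set p := normal_pdf 0 s.
have p0 x : 0 <= p x by exact: normal_pdf_ge0.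
have cp : continuous p by exact: continuous_normal_pdf.
rewrite ge0_integral_normal_prob//; last 2 first.
- by apply/measurable_EFinP; exact: measurable_funX.
- by move=> x; rewrite lee_fin sqr_ge0.
pose q x := x ^+ 2 * p x.
have q0 x : 0 <= q x by rewrite mulr_ge0 ?sqr_ge0.
have cq : continuous q.
  by move=> x; apply: cvgM; [exact: sqr_continuous|exact: cp].
(* Integration by parts is carried out on bounded intervals; evenness and monotone convergence
   recover the integral over the whole line. *)
have half (f : R -> R) : (forall x, 0 <= f x) -> continuous f ->
    (forall x, f (- x) = f x) ->
    (fun n : nat => 2%:E * \int[mu]_(x in `[0%R, n%:R]) (f x)%:E)%E @ \oo -->
    (\int[mu]_x (f x)%:E)%E.
  move=> f0 cf fe; rewrite ge0_symfun_integralT//; last by move=> x /=; rewrite fe.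
  apply: cvgeZl => //; rewrite -set_itvcy; apply: ge0_cvgn_integral => //.
  exact: continuous_measurable_fun.
(* The integrand is split as x times x p(x), the second factor having the primitive [- s^2 p]. In
   the limit the middle term tends to s^2 and the last one to 0. *)
have parts (n : nat) : (2%:E * \int[mu]_(x in `[0%R, n.+1%:R]) (q x)%:E =
   (s ^+ 2)%:E * (2%:E * \int[mu]_(x in `[0%R, n.+1%:R]) (p x)%:E) -
   (2 * s ^+ 2 * (n.+1%:R * p n.+1%:R))%:E)%E.
  have dp (x : R) : is_derive x (1 : R) (- s ^+ 2 \*: p) (x * p x).
    have := is_derive_normal_pdf x s0 => hd.
    apply: is_derive_eq; rewrite /GRing.scale /= -/p mulNr.
    by rewrite mulrA mulrN mulNr opprK; congr (_ * _); field.
  have cdp : continuous (- s ^+ 2 \*: p).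
    move=> x; apply: differentiable_continuous; apply/derivable1_diffP.
    by have [] := dp x.
  have := @integration_by_parts R id (- s ^+ 2 \*: p) (cst 1) (fun x => x * p x)
            0 n.+1%:R.
  have np : (0 : R) < n.+1%:R by rewrite ltr0n.
  move=> /(_ np) H.
  have -> : (\int[mu]_(x in `[0%R, n.+1%:R]) (q x)%:E =
     \int[mu]_(x in `[0%R, n.+1%:R]) (x * (x * p x))%:E)%E.
    by apply: eq_integral => x _; rewrite mulrA.
  rewrite H; last 6 first.
  - by apply: continuous_subspaceT => x; exact: cvg_cst.
  - split => //=.
    + by apply: cvg_at_right_filter; exact: cvg_id.
    + by apply: cvg_at_left_filter; exact: cvg_id.
  - by move=> x _; rewrite derive1E derive_id.
  - by apply: continuous_subspaceT => x; apply: cvgM => //; exact: cp.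
  - split.
    + by move=> x _; have [] := dp x.
    + by apply: cvg_at_right_filter; exact: cdp.
    + by apply: cvg_at_left_filter; exact: cdp.
  - by move=> x _; rewrite derive1E; have [_ ->] := dp x.
  have ip : mu.-integrable `[0%R, n.+1%:R] (EFin \o p).
    apply: integrableS (integrable_normal_pdf 0 s) => //.
  have -> : (\int[mu]_(x in `[0%R, n.+1%:R]) (cst 1 x * (- s ^+ 2 \*: p) x)%:E
     = (- s ^+ 2)%:E * \int[mu]_(x in `[0%R, n.+1%:R]) (p x)%:E)%E.
    rewrite -integralZl//; apply: eq_integral => x _.
    by rewrite /= mul1r.
  have /fineK <- : (\int[mu]_(x in `[0%R, n.+1%:R]) (p x)%:E)%E \is a fin_num.
    exact: integrable_fin_num.
  set I := fine _; rewrite /GRing.scale /= -!(EFinM, EFinB, EFinN).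
  have sc (a b : R) : a *: (b : R^o) = a * b by [].
  by congr (_%:E); rewrite !sc; ring.
have cq2 := half q q0 cq.
have cp2 := half p p0 cp.
have c1 : (fun n : nat => (2%:E * \int[mu]_(x in `[0%R, n.+1%:R]) (q x)%:E)%E)
    @ \oo --> (s ^+ 2)%:E.
  under eq_fun do rewrite parts.
  have -> : nbhs (s ^+ 2)%:E = nbhs ((s ^+ 2)%:E * 1 - 0)%E.
    by rewrite mule1 sube0.
  apply: cvgeB => //.
  - apply: cvgeZl => //.
    rewrite (cvg_shiftS (fun n : nat =>
      2%:E * \int[mu]_(x in `[0%R, n%:R]) (p x)%:E)%E).
    have := cp2 (fun x => normal_pdf_even x s0).
    by rewrite integral_normal_pdf.
  - apply: cvg_EFin; first exact: nearW.
    rewrite -[X in _ --> X](mulr0 (2 * s ^+ 2)); apply: cvgMr.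
    rewrite (cvg_shiftS (fun n : nat => n%:R * p n%:R)).
    exact: cvg_natrM_normal_pdf.
have c2 : (fun n : nat => 2%:E * \int[mu]_(x in `[0%R, n%:R]) (q x)%:E)%E
    @ \oo --> (s ^+ 2)%:E.
  by rewrite -(cvg_shiftS (fun n : nat =>
    2%:E * \int[mu]_(x in `[0%R, n%:R]) (q x)%:E)%E).
have qe x : q (- x) = q x by rewrite /q sqrrN /p normal_pdf_even.
by apply: (cvg_unique _ (cq2 qe) c2); exact: ereal_hausdorff.
Qed.

End GaussianMoments.

Section GaussianVariables.
Context {R : realType} d (Omega : measurableType d) (P : probability Omega R).
Implicit Types X Y : Omega -> R.

Lemma second_moment_centered_gaussian X (v : R) : 0 <= v ->
  measurable_fun setT X ->
  (forall B, measurable B -> P (X @^-1` B) = centered_gaussian v B) ->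
  sqint P X /\ \int[P]_w (X w ^+ 2) = v.
Proof.
move=> v0 mX law.
have mX' : measurable_fun setT (X : Omega -> measurableTypeR R) by exact: mX.
pose X' : {mfun Omega >-> measurableTypeR R} :=
  HB.pack (X : Omega -> measurableTypeR R) (isMeasurableFun.Build _ _ _ _ _ mX').
have m2 : measurable_fun setT (fun x : R => (x ^+ 2)%:E).
  by apply/measurable_EFinP; exact: measurable_funX.
suff H : (\int[P]_w (X w ^+ 2)%:E = v%:E)%E.
  by split; [apply: fin_sqint => //; rewrite H ltry|rewrite /Rintegral H].
transitivity (\int[distribution P X']_x (x ^+ 2)%:E)%E.
  by rewrite ge0_integral_distribution// => y; rewrite lee_fin sqr_ge0.
(* The variance vanishes when s = t or when D annihilates the direction of projection; the law is
   then a Dirac mass. *)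
have [v1|v1] := eqVneq v 0.
  rewrite (eq_measure_integral (\d_(0 : measurableTypeR R))); last first.
    by move=> A mA _; apply: etrans (law A mA) _; rewrite /centered_gaussian v1 eqxx.
  by rewrite integral_dirac// diracT mul1e expr0n v1.
rewrite (eq_measure_integral (normal_prob 0 (Num.sqrt v))); last first.
  by move=> A mA _; apply: etrans (law A mA) _; rewrite /centered_gaussian (negbTE v1).
have vp : 0 < v by rewrite lt_def v1.
by rewrite second_moment_normal ?sqr_sqrtr// gt_eqF// sqrtr_gt0.
Qed.

Lemma symmetric_mean0 X : measurable_fun setT X ->
  P.-integrable setT (EFin \o X) ->
  (forall B, measurable B -> P (X @^-1` B) = P ((fun w => - X w) @^-1` B)) ->
  \int[P]_w X w = 0.
Proof.
move=> mX iX sym.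
have mN : measurable_fun setT (fun w => - X w) by exact: measurableT_comp.
pose X' : {mfun Omega >-> R} := HB.pack X (isMeasurableFun.Build _ _ _ _ X mX).
pose N' : {mfun Omega >-> R} :=
  HB.pack (fun w => - X w) (isMeasurableFun.Build _ _ _ _ _ mN).
have iN : P.-integrable setT (EFin \o (fun w => - X w)).
  by have := integrableN iX; apply: eq_integrable.
have mE : measurable_fun setT (EFin : R -> \bar R) by exact/measurable_EFinP.
have e : \int[P]_w X w = \int[P]_w (- X w).
  rewrite /Rintegral; congr fine.
  rewrite -(integral_distribution (X := X') mE iX).
  rewrite -(integral_distribution (X := N') mE iN).
  by apply: eq_measure_integral => A mA _; exact: sym.
have e2 : \int[P]_w (- X w) = - \int[P]_w X w.
  rewrite -mulN1r -RintegralZl//.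
  by apply: eq_Rintegral => w _; rewrite mulN1r.
lra.
Qed.

End GaussianVariables.

Section BrownianIncrements.
Context {R : realType} d (Omega : measurableType d) (P : probability Omega R)
        (F : R -> set (set Omega)) (n : nat) (D : 'M[R]_n)
        (W : R -> Omega -> 'cV[R]_n).
Hypotheses (hF : filtration F) (hD : posmx D) (hW : brownian_motion P F D W).
Implicit Types (s t : R) (a b : 'I_n) (c e : Omega -> R).

Lemma filtration_wrt s t c : 0 <= s -> s <= t ->
  measurable_wrt (F s) c -> measurable_wrt (F t) c.
Proof. by move=> s0 st; apply: measurable_wrt_sub; exact: filtration_mono. Qed.

Lemma adapted_measurable s c : 0 <= s -> measurable_wrt (F s) c ->
  measurable_fun setT c.
Proof.
by move=> s0; apply: measurable_wrt_measurable; exact: filtration_measurable.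
Qed.

Lemma measurable_bm t a : 0 <= t -> measurable_fun setT (fun w => W t w a 0).
Proof. by move=> t0; apply: (adapted_measurable t0); exact: bm_adapted hW _ _ t0. Qed.

Definition incr s t a w : R := W t w a 0 - W s w a 0.

Lemma measurable_incr s t a : 0 <= s -> 0 <= t -> measurable_fun setT (incr s t a).
Proof. by move=> s0 t0; apply: measurable_funB; exact: measurable_bm. Qed.

Lemma incr_adapted s t a : 0 <= s -> s <= t -> measurable_wrt (F t) (incr s t a).
Proof.
move=> s0 st; have t0 := le_trans s0 st.
apply: measurable_wrtB; first exact: (filtration_sigma hF).
  exact: bm_adapted hW _ _ t0.
by apply: (filtration_wrt s0 st); exact: bm_adapted hW _ _ s0.
Qed.

Lemma incr_split s r t a w : incr s t a w = incr s r a w + incr r t a w.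
Proof. by rewrite /incr; ring. Qed.

Let bilin s t (x : 'cV[R]_n) w : R := (x^T *m (W t w - W s w)) 0 0.

Let bilin_delta s t a w : bilin s t (delta_mx a 0) w = incr s t a w.
Proof. by rewrite /bilin trmx_delta -rowE !mxE. Qed.

Let trD (x y : 'cV[R]_n) : (x + y)^T = x^T + y^T. Proof. by rewrite linearD. Qed.

Let bilinD s t x y w : bilin s t (x + y) w = bilin s t x w + bilin s t y w.
Proof. by rewrite /bilin trD mulmxDl mxE. Qed.

Let measurable_bilin s t x : 0 <= s -> 0 <= t -> measurable_fun setT (bilin s t x).
Proof.
move=> s0 t0; rewrite (_ : bilin s t x = fun w => \sum_j x j 0 * incr s t j w).
  apply: measurable_sum => j; apply: measurable_funM => //.
  exact: measurable_incr.
by apply/funext => w; rewrite /bilin !mxE; apply: eq_bigr => j _; rewrite !mxE.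
Qed.

Let bilin2 s t x : 0 <= s -> s <= t -> sqint P (bilin s t x) /\
  \int[P]_w (bilin s t x w ^+ 2) = (t - s) * (x^T *m D *m x) 0 0.
Proof.
move=> s0 st; apply: second_moment_centered_gaussian.
- by rewrite mulr_ge0 ?subr_ge0//; exact: hD.2.
- by apply: measurable_bilin => //; exact: le_trans st.
- by move=> B mB; exact: (bm_gaussian hW).
Qed.

Lemma incr_sqint s t a : 0 <= s -> s <= t -> sqint P (incr s t a).
Proof.
move=> s0 st; have [+ _] := bilin2 (delta_mx a 0) s0 st.
by congr sqint; apply/funext => w; rewrite bilin_delta.
Qed.

(** The variance of the projection on x is even in x, so the projections on x and -x have the same
    law and the increment is symmetric. This stands in for the computation of a Gaussian first
    moment. *)
Lemma incr_mean s t a : 0 <= s -> s <= t -> \int[P]_w incr s t a w = 0.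
Proof.
move=> s0 st; apply: symmetric_mean0.
- by apply: measurable_incr => //; exact: le_trans st.
- by apply: sqint_integrable; exact: incr_sqint.
- move=> B mB.
  have law x : P (bilin s t x @^-1` B) =
    centered_gaussian ((t - s) * (x^T *m D *m x) 0 0) B.
    exact: (bm_gaussian hW).
  pose x : 'cV[R]_n := delta_mx a 0.
  have NT : (- x)^T = - x^T by rewrite linearN.
  have -> : incr s t a = bilin s t x.
    by apply/funext => w; rewrite bilin_delta.
  have -> : (fun w => - bilin s t x w) = bilin s t (- x).
    by apply/funext => w; rewrite /bilin NT mulNmx [RHS]mxE.
  by rewrite !law NT !mulNmx mulmxN opprK.
Qed.

(** Polarization: the law is given through one-dimensional projections, so the covariance is
    extracted from the variances along e_a, e_b and e_a + e_b. The symmetry of D merges the two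
    cross terms. *)
Lemma incr_cov s t a b : 0 <= s -> s <= t ->
  \int[P]_w (incr s t a w * incr s t b w) = (t - s) * D a b.
Proof.
move=> s0 st.
pose x : 'cV[R]_n := delta_mx a 0; pose y : 'cV[R]_n := delta_mx b 0.
have [qx ix] := bilin2 x s0 st; have [qy iy] := bilin2 y s0 st.
have [qxy ixy] := bilin2 (x + y) s0 st.
have D_ (i j : 'I_n) : ((delta_mx i 0 : 'cV_n)^T *m D *m (delta_mx j 0 : 'cV_n)) 0 0
    = D i j by rewrite trmx_delta -rowE -colE !mxE.
have Dsym : D b a = D a b.
  have := hD.1; rewrite is_hermitianmxE expr0 scale1r => /eqP DT.
  by rewrite [in LHS]DT !mxE.
move: ixy; rewrite -!dotL2_sqr in ix iy *.
rewrite (_ : bilin s t (x + y) = fun w => bilin s t x w + bilin s t y w); last first.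
  by apply/funext => w; rewrite bilinD.
rewrite dotDl ?dotDr//; [|exact: sqintD..].
rewrite (dotC _ (bilin s t y)) ix iy.
have addE (A B : 'M[R]_1) : (A + B) 0 0 = A 0 0 + B 0 0 by rewrite mxE.
rewrite trD !mulmxDl !mulmxDr !addE !D_ Dsym.
have -> : dotL2 P (bilin s t x) (bilin s t y) =
   \int[P]_w (incr s t a w * incr s t b w).
  by apply: eq_Rintegral => w _; rewrite /x /y !bilin_delta.
lra.
Qed.

(** Generated by all components at once, because [incr_cond_cov] needs the product of two different
    components to be independent of F_s. *)
Definition incr_sigma s t : set (set Omega) := <<s \bigcup_a
  preimage_set_system setT (incr s t a) measurable >>.

Lemma incr_sigma_wrt s t a : measurable_wrt (incr_sigma s t) (incr s t a).
Proof. by apply: subset_trans (@sub_gen_smallest _ _ _) => A hA; exists a. Qed.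

Lemma incr_indep s t A B : 0 <= s -> s <= t ->
  F s A -> incr_sigma s t B -> P (A `&` B) = (P A * P B)%E.
Proof. by move=> s0 st; exact: (bm_independent hW s0 st). Qed.

(** Independence of the past, and mean zero. Asking c to be square integrable rather than bounded is
    what lets the martingale property be tested against unbounded variables such as a drift
    coefficient. *)
Lemma incr_orth s t a c : 0 <= s -> s <= t -> measurable_wrt (F s) c ->
  sqint P c -> dotL2 P c (incr s t a) = 0.
Proof.
move=> s0 st Fc qc; have qi := incr_sqint a s0 st.
rewrite /dotL2 (integral_indepM (fun A B => @incr_indep s t A B s0 st) Fc).
- by rewrite incr_mean// mulr0.
- exact: incr_sigma_wrt.
- exact: sqint_integrable.
- exact: sqint_integrable.
- exact: sqintM.
Qed.

Lemma bounded_mul_sqint c (f : Omega -> R) (M : R) : measurable_fun setT c ->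
  (forall w, `|c w| <= M) -> sqint P f -> sqint P (fun w => c w * f w).
Proof.
move=> mc cM qf; apply: (@le_sqint _ _ _ _ _ (fun w => M * f w)).
- by apply: measurable_funM => //; case: qf.
- exact: sqintZ.
- move=> w; rewrite !normrM ler_wpM2r// (le_trans (cM w))// ler_norm//.
Qed.

Lemma incr_cond_cov s t a b c (M : R) : 0 <= s -> s <= t ->
  measurable_wrt (F s) c -> (forall w, `|c w| <= M) ->
  dotL2 P (fun w => c w * incr s t a w) (incr s t b) =
  (t - s) * D a b * \int[P]_w c w.
Proof.
move=> s0 st Fc cM; have mc := adapted_measurable s0 Fc.
have qa := incr_sqint a s0 st; have qb := incr_sqint b s0 st.
rewrite /dotL2; under eq_Rintegral do rewrite -mulrA.
rewrite (integral_indepM (fun A B => @incr_indep s t A B s0 st) Fc).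
- by rewrite incr_cov// mulrC.
- apply: measurable_wrtM; try exact: incr_sigma_wrt.
  exact: smallest_sigma_algebra.
- by apply: sqint_integrable; apply: (@bounded_sqint _ _ _ _ _ M).
- exact: sqintM.
- have := sqintM (bounded_mul_sqint mc cM qa) qb.
  by apply: eq_integrable => // w _ /=; rewrite mulrA.
Qed.

End BrownianIncrements.

(** * Ito integrals *)

Section SimpleIsometry.
Context {R : realType} d (Omega : measurableType d) (P : probability Omega R)
        (F : R -> set (set Omega)) (n : nat) (D : 'M[R]_n)
        (W : R -> Omega -> 'cV[R]_n).
Hypotheses (hF : filtration F) (hD : posmx D) (hW : brownian_motion P F D W).
Implicit Types (s t : R) (a b : 'I_n) (c e : Omega -> R).
Local Notation leb := (@lebesgue_measure R).
Local Notation pi := (leb \x P)%E.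
Local Notation incr := (incr W).

(** One step c 1_]s, s'] of a simple process. By bilinearity the isometry is checked on pairs of
    steps, whose intervals may come from two different partitions; this takes the place of a common
    refinement. *)
Record elementary s s' c : Prop := Elementary {
  elem_ge0 : 0 <= s ;
  elem_le : s <= s' ;
  elem_adapted : measurable_wrt (F s) c ;
  elem_bounded : exists M, forall w, `|c w| <= M }.

(** The length of the intersection of ]s, s'] and ]t, t']; the maximum with 0 covers disjoint
    intervals. *)
Definition overlap s s' t t' : R :=
  Num.max 0 (Num.min s' t' - Num.max s t).

Lemma overlapC s s' t t' : overlap s s' t t' = overlap t t' s s'.
Proof. by rewrite /overlap minC maxC [X in _ - X]maxC maxC. Qed.

Lemma posmx_sym a b : D b a = D a b.
Proof.
have := hD.1; rewrite is_hermitianmxE expr0 scale1r => /eqP DT.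
by rewrite [in LHS]DT !mxE.
Qed.

Lemma elem_measurable s s' c : elementary s s' c -> measurable_fun setT c.
Proof. by case=> s0 _ Fc _; exact: (adapted_measurable hF s0 Fc). Qed.

Lemma elem_sqint s s' c a : elementary s s' c ->
  sqint P (fun w => c w * incr s s' a w).
Proof.
move=> ec; have [s0 ss' Fc [M cM]] := ec.
exact: (bounded_mul_sqint (elem_measurable ec) cM (incr_sqint hF hD hW a s0 ss')).
Qed.

(* Only the part of the two increments over the common subinterval
   contributes: every other product has a factor that is centered and
   independent of the past. *)
Lemma elem_dot_le s s' t t' a b c e :
  elementary s s' c -> elementary t t' e -> s <= t ->
  dotL2 P (fun w => c w * incr s s' a w) (fun w => e w * incr t t' b w) =
  D a b * (overlap s s' t t' * \int[P]_w (c w * e w)).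
Proof.
move=> ec ee st.
have [s0 ss' Fc [M1 cM1]] := ec; have [t0 tt' Fe [M2 eM2]] := ee.
have Fct : measurable_wrt (F t) c by exact: (filtration_wrt hF s0 st).
pose k w := c w * e w.
have Fk : measurable_wrt (F t) k.
  by apply: measurable_wrtM => //; exact: (filtration_sigma hF).
have kM w : `|k w| <= M1 * M2 by rewrite normrM ler_pM.
have mk := adapted_measurable hF t0 Fk.
rewrite /overlap (max_r st).
have [s't|ts'] := leP s' t.
  rewrite (min_l (le_trans s't tt')) max_l ?subr_le0// mul0r mulr0.
  pose f w := k w * incr s s' a w.
  have qf : sqint P f.
    exact: (bounded_mul_sqint mk kM (incr_sqint hF hD hW a s0 ss')).
  rewrite -(incr_orth hF hD hW b t0 tt' _ qf).
    by apply: eq_Rintegral => w _; rewrite /f /k; ring.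
  apply: measurable_wrtM => //; first exact: (filtration_sigma hF).
  apply: (filtration_wrt hF _ s't); first exact: le_trans ss'.
  exact: (incr_adapted hF hW).
set m := Num.min s' t'.
have tm : t <= m by rewrite le_min tt' ltW.
have ms' : m <= s' by rewrite ge_min lexx.
have mt' : m <= t' by rewrite ge_min lexx orbT.
have m0 := le_trans t0 tm.
rewrite max_r ?subr_ge0//.
have qa r r' : 0 <= r -> r <= r' -> sqint P (fun w => k w * incr r r' a w).
  by move=> r0 rr'; exact: (bounded_mul_sqint mk kM (incr_sqint hF hD hW a r0 rr')).
have qb r r' : 0 <= r -> r <= r' -> sqint P (incr r r' b).
  by move=> r0 rr'; exact: (incr_sqint hF hD hW b r0 rr').
have qkb : sqint P (fun w => k w * incr t m b w).
  exact: (bounded_mul_sqint mk kM (incr_sqint hF hD hW b t0 tm)).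
have Fkm : measurable_wrt (F m) k by exact: (filtration_wrt hF t0 tm).
have sGt := filtration_sigma hF t0; have sGm := filtration_sigma hF m0.
have Fa : measurable_wrt (F t) (incr s t a) by exact: (incr_adapted hF hW).
have Fam : measurable_wrt (F m) (incr t m a) by exact: (incr_adapted hF hW).
have Fbm : measurable_wrt (F m) (incr t m b) by exact: (incr_adapted hF hW).
have -> : dotL2 P (fun w => c w * incr s s' a w) (fun w => e w * incr t t' b w) =
  dotL2 P (fun w => (k w * incr s t a w + k w * incr t m a w)
                    + k w * incr m s' a w)
          (fun w => incr t m b w + incr m t' b w).
  apply: eq_Rintegral => w _.
  rewrite (incr_split W s t s') (incr_split W t m s') (incr_split W t m t') /k.
  ring.
have q1 := qa _ _ s0 st; have q2 := qa _ _ t0 tm; have q3 := qa _ _ m0 ms'.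
have r2 := qb _ _ t0 tm; have r3 := qb _ _ m0 mt'.
rewrite dotDr//; last by apply: sqintD => //; exact: sqintD.
do 4! (rewrite dotDl//; try by apply: sqintD).
have z1 : dotL2 P (fun w => k w * incr s t a w) (incr t m b) = 0.
  by apply: (incr_orth hF hD hW b t0 tm) => //; exact: measurable_wrtM.
have z2 : dotL2 P (fun w => k w * incr s t a w) (incr m t' b) = 0.
  apply: (incr_orth hF hD hW b m0 mt') => //; apply: measurable_wrtM => //.
  exact: (filtration_wrt hF t0 tm).
have z3 : dotL2 P (fun w => k w * incr t m a w) (incr m t' b) = 0.
  by apply: (incr_orth hF hD hW b m0 mt') => //; exact: measurable_wrtM.
have z4 : dotL2 P (fun w => k w * incr m s' a w) (incr t m b) = 0.
  transitivity (dotL2 P (fun w => k w * incr t m b w) (incr m s' a)).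
    by apply: eq_Rintegral => w _; ring.
  by apply: (incr_orth hF hD hW a m0 ms') => //; exact: measurable_wrtM.
have z5 : dotL2 P (fun w => k w * incr m s' a w) (incr m t' b) = 0.
  rewrite /dotL2 -[RHS](mul0r (fine (P setT))) -Rintegral_cst//.
  apply: eq_Rintegral => w _.
  (* m is the smaller of the two right endpoints, so one of the two remaining increments is over a
     degenerate interval. *)
  have [->|->] : m = s' \/ m = t' by rewrite /m; case: leP; [left|right].
    by rewrite /incr subrr !(mulr0, mul0r).
  by rewrite /incr subrr !(mulr0, mul0r).
rewrite z1 z2 z3 z4 z5 (incr_cond_cov hF hD hW a b t0 tm Fk kM).
by rewrite !addr0 add0r; ring.
Qed.

Lemma elem_dot s s' t t' a b c e :
  elementary s s' c -> elementary t t' e ->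
  dotL2 P (fun w => c w * incr s s' a w) (fun w => e w * incr t t' b w) =
  D a b * (overlap s s' t t' * \int[P]_w (c w * e w)).
Proof.
move=> ec ee; have [st|/ltW ts] := leP s t; first exact: elem_dot_le.
rewrite dotC (elem_dot_le b a ee ec ts) posmx_sym overlapC.
by congr (_ * (_ * _)); apply: eq_Rintegral => w _; rewrite mulrC.
Qed.

Definition elem_value s s' c (p : measurableTypeR R * Omega) : R :=
  c p.2 * \1_(`]s, s']) p.1.

Lemma measurable_elem_value s s' c : elementary s s' c ->
  measurable_fun setT (elem_value s s' c).
Proof.
move=> ec; apply: measurable_funM.
  by apply: measurableT_comp; [exact: elem_measurable ec|exact: measurable_snd].
by apply: measurableT_comp => //; exact: measurable_fst.
Qed.

Lemma lebesgue_itv_oc s s' t t' :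
  leb (`]s, s'] `&` `]t, t']) = (overlap s s' t t')%:E.
Proof.
have -> : `]s, s'] `&` `]t, t'] = `]Num.max s t, Num.min s' t']%classic.
  apply/seteqP; split => x /=; rewrite !in_itv/= gt_max le_min.
    by move=> [/andP[-> ->] /andP[-> ->]].
  by move=> /andP[/andP[-> ->] /andP[-> ->]].
rewrite lebesgue_measure_itv/= lte_fin /overlap.
set x := Num.max s t; set y := Num.min s' t'.
case: ifPn => h; first by rewrite max_r// subr_ge0 ltW.
by rewrite max_l// subr_le0 leNgt.
Qed.

Let elem_valueME s s' t t' c e p :
  elem_value s s' c p * elem_value t t' e p =
  c p.2 * e p.2 * \1_(`]s, s'] `&` `]t, t']) p.1.
Proof. by rewrite /elem_value indicI /=; ring. Qed.

Lemma integrable_elem_valueM s s' t t' c e :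
  elementary s s' c -> elementary t t' e ->
  pi.-integrable setT
    (EFin \o (fun p => elem_value s s' c p * elem_value t t' e p)).
Proof.
move=> ec ee; have [_ _ _ [M1 cM1]] := ec; have [_ _ _ [M2 eM2]] := ee.
set I := `]s, s'] `&` `]t, t'].
have mI : measurable (I : set (measurableTypeR R)) by exact: measurableI.
have mIT : measurable (I `*` [set: Omega] : set (measurableTypeR R * Omega)).
  exact: measurableX.
have i1 : pi.-integrable setT (EFin \o \1_(I `*` [set: Omega])).
  apply/integrableP; split; first exact/measurable_EFinP.
  under eq_integral do rewrite /= ger0_norm//.
  rewrite integral_indic// setIT.
  have pI : ((leb \x P) (I `*` [set: Omega]) = (overlap s s' t t')%:E)%E.
    by rewrite product_measure1E// [X in (_ * X)%E]probability_setT mule1; exact: lebesgue_itv_oc.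
  by apply: le_lt_trans (ltry (overlap s s' t t')); rewrite -pI.
apply: le_integrable (integrableZl measurableT (M1 * M2) i1) => //.
  by apply/measurable_EFinP/measurable_funM; exact: measurable_elem_value.
move=> [x w] _ /=; rewrite lee_fin elem_valueME /= -/I.
rewrite !normrM; apply: ler_pM; rewrite ?mulr_ge0//.
  by apply: ler_pM => //; [apply: le_trans (cM1 _) _|apply: le_trans (eM2 _) _];
    exact: ler_norm.
by rewrite !indicE in_setX in_setT andbT.
Qed.

Lemma elem_value_sqint s s' c : elementary s s' c -> sqint pi (elem_value s s' c).
Proof.
move=> ec; split; first exact: measurable_elem_value.
have := integrable_elem_valueM ec ec.
by apply: eq_integrable => // p _ /=; rewrite expr2.
Qed.

Lemma elem_value_dot s s' t t' c e :
  elementary s s' c -> elementary t t' e ->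
  dotL2 pi (elem_value s s' c) (elem_value t t' e) =
  overlap s s' t t' * \int[P]_w (c w * e w).
Proof.
move=> ec ee; have ice := integrable_elem_valueM ec ee.
have [_ _ _ [M1 cM1]] := ec; have [_ _ _ [M2 eM2]] := ee.
have mc := elem_measurable ec; have me := elem_measurable ee.
have qc := bounded_sqint P mc cM1; have qe := bounded_sqint P me eM2.
rewrite /dotL2 -Rintegral12_prod//.
set I := `]s, s'] `&` `]t, t'].
have mI : measurable (I : set (measurableTypeR R)) by exact: measurableI.
transitivity (\int[leb]_x ((\int[P]_w (c w * e w)) * \1_I x)).
  apply: eq_Rintegral => x _.
  rewrite -RintegralZr//; last exact: sqintM.
  by apply: eq_Rintegral => w _; rewrite elem_valueME.
rewrite RintegralZl//; last first.
  apply/integrableP; split; first exact/measurable_EFinP.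
  under eq_integral do rewrite /= ger0_norm//.
  rewrite integral_indic// setIT; apply: le_lt_trans (ltry (overlap s s' t t')).
  by rewrite -lebesgue_itv_oc.
rewrite mulrC; congr (_ * _).
rewrite /Rintegral integral_indic// setIT -[RHS]/(fine (_%:E)) -lebesgue_itv_oc.
by [].
Qed.

End SimpleIsometry.

Section ItoIsometry.
Context {R : realType} d (Omega : measurableType d) (P : probability Omega R)
        (F : R -> set (set Omega)) (n : nat) (D : 'M[R]_n)
        (W : R -> Omega -> 'cV[R]_n).
Hypotheses (hF : filtration F) (hD : posmx D) (hW : brownian_motion P F D W).
Implicit Types (s t : R) (a b : 'I_n).
Local Notation leb := (@lebesgue_measure R).
Local Notation pi := (leb \x P)%E.
Local Notation RO := (measurableTypeR R * Omega)%type.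
Local Notation incr := (incr W).
Local Notation Wc a := (fun s w => W s w a 0).

Definition sp_val t (g : simple_process F t) (p : RO) : R := sp_value g p.1 p.2.

Lemma sp_elem t (g : simple_process F t) i : (i < sp_size g)%N ->
  elementary F (sp_time g i) (sp_time g i.+1) (sp_coef g i).
Proof.
move=> isz; split.
- elim: i isz => [_|i IH isz]; first exact: sp_time_ge0.
  exact: le_trans (IH (ltnW isz)) (sp_time_mono (ltnW isz)).
- exact: sp_time_mono.
- exact: sp_coef_adapted.
- exact: sp_coef_bounded.
Qed.

Lemma sp_time_le_t t (g : simple_process F t) i : (i <= sp_size g)%N ->
  sp_time g i <= t.
Proof.
move=> isz; rewrite -(subKn isz); elim: (_ - i)%N (leq_subr i (sp_size g)) => [_|k IH ksz].
  by rewrite subn0; exact: sp_time_le.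
apply: le_trans (IH (ltnW ksz)); rewrite -[in leRHS](subnSK ksz).
by apply: sp_time_mono; rewrite ltn_subrL (leq_ltn_trans _ ksz).
Qed.

Lemma sp_val_sqint t (g : simple_process F t) : sqint pi (sp_val g).
Proof.
apply: sqint_sum => i _; exact: (elem_value_sqint P hF (sp_elem (ltn_ord i))).
Qed.

Lemma sp_ito_sqint t (g : simple_process F t) a : sqint P (sp_ito g (Wc a)).
Proof.
apply: sqint_sum => i _.
exact: (elem_sqint hF hD hW a (sp_elem (ltn_ord i))).
Qed.

Lemma simple_isometry t t' (g : simple_process F t) (h : simple_process F t') a b :
  dotL2 P (sp_ito g (Wc a)) (sp_ito h (Wc b)) =
  D a b * dotL2 pi (sp_val g) (sp_val h).
Proof.
have qi a' i := elem_sqint hF hD hW a' (sp_elem (g := g) (ltn_ord i)).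
have qj a' i := elem_sqint hF hD hW a' (sp_elem (g := h) (ltn_ord i)).
have vi i := elem_value_sqint P hF (sp_elem (g := g) (ltn_ord i)).
have vj i := elem_value_sqint P hF (sp_elem (g := h) (ltn_ord i)).
have -> : dotL2 pi (sp_val g) (sp_val h) = \sum_(i < sp_size g) \sum_(j < sp_size h)
    dotL2 pi (elem_value (sp_time g i) (sp_time g i.+1) (sp_coef g i))
             (elem_value (sp_time h j) (sp_time h j.+1) (sp_coef h j)).
  transitivity (\sum_(i < sp_size g) dotL2 pi
      (elem_value (sp_time g i) (sp_time g i.+1) (sp_coef g i)) (sp_val h)).
    exact: (dot_suml _ (fun i _ => vi i) (sp_val_sqint h)).
  by apply: eq_bigr => i _; exact: (dot_sumr _ (fun j _ => vj j) (vi i)).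
rewrite /sp_ito (dot_suml _ (fun i _ => qi a i) (sp_ito_sqint h b)).
rewrite mulr_sumr; apply: eq_bigr => i _.
rewrite (dot_sumr _ (fun j _ => qj b j) (qi a i)) mulr_sumr.
apply: eq_bigr => j _.
rewrite (elem_value_dot P hF (sp_elem (ltn_ord i)) (sp_elem (ltn_ord j))).
exact: (elem_dot hF hD hW a b (sp_elem (ltn_ord i)) (sp_elem (ltn_ord j))).
Qed.

Lemma simple_mean0 t (g : simple_process F t) a :
  dotL2 P (sp_ito g (Wc a)) (fun=> 1) = 0.
Proof.
rewrite /sp_ito dot_suml//; last exact: sqint_cst.
  apply: big1 => i _; have ec := sp_elem (ltn_ord i); have [s0 ss' Fc [M cM]] := ec.
  rewrite -(incr_orth hF hD hW a s0 ss' Fc).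
    by apply: eq_Rintegral => w _; rewrite mulr1.
  exact: (bounded_sqint P (elem_measurable hF ec) cM).
by move=> i _; exact: (elem_sqint hF hD hW a (sp_elem (ltn_ord i))).
Qed.

Section Restrict.
Variables (s t : R) (g : simple_process F t).
Hypothesis s0 : 0 <= s.

Let time i : R := Num.min (sp_time g i) s.
(** A node beyond s collapses to s, where its coefficient may fail to be F_s-measurable. Replacing
    it by 0 is harmless, since the interval that follows is degenerate. *)
Let coef i (w : Omega) : R := if sp_time g i <= s then sp_coef g i w else 0.

Let time_ge0 : 0 <= time 0.
Proof. by rewrite le_min sp_time_ge0. Qed.

Let time_le : time (sp_size g) <= s.
Proof. by rewrite ge_min lexx orbT. Qed.

Let time_mono i : (i < sp_size g)%N -> time i <= time i.+1.
Proof.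
by move=> isz; rewrite le_min !ge_min lexx orbT sp_time_mono.
Qed.

Let coef_adapted i : (i < sp_size g)%N -> measurable_wrt (F (time i)) (coef i).
Proof.
move=> isz; rewrite /time /coef; have [tis|tis] := leP (sp_time g i) s.
  exact: sp_coef_adapted.
exact: measurable_wrt_cst (filtration_sigma hF s0).
Qed.

Let coef_bounded i : (i < sp_size g)%N -> exists M, forall w, `|coef i w| <= M.
Proof.
move=> isz; rewrite /coef; have [_|_] := leP (sp_time g i) s.
  exact: sp_coef_bounded.
by exists 0 => w; rewrite normr0.
Qed.

Definition sp_restrict : simple_process F s :=
  SimpleProcess time_ge0 time_le time_mono coef_adapted coef_bounded.

Lemma sp_val_restrict p : sp_val sp_restrict p = sp_val g p * \1_(`[0, s]) p.1.
Proof.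
rewrite /sp_val /sp_value mulr_suml; apply: eq_bigr => i _ /=.
have [ti0 _ _ _] := sp_elem (g := g) (ltn_ord i).
rewrite /coef /time !indicE !mem_setE !in_itv /= -mulrA.
pose x : R := p.1; rewrite -![p.1]/x.
have [tis|sti] := leP (sp_time g i) s.
  rewrite le_min; congr (_ * _); rewrite -natrM mulnb; congr (_%:R); congr nat_of_bool.
  have [tx|//] := ltP (sp_time g i) x.
  by rewrite (le_trans ti0 (ltW tx)) /=.
rewrite mul0r; have [tx|_] := ltP (sp_time g i) x; last by rewrite mul0r mulr0.
by rewrite (leNgt x s) (lt_trans sti tx) /= andbF !mulr0.
Qed.

(* The part of the increments after time s is orthogonal to F_s. *)
Lemma martingale_simple (eta : Omega -> R) a :
  measurable_wrt (F s) eta -> sqint P eta ->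
  dotL2 P eta (sp_ito g (Wc a)) = dotL2 P eta (sp_ito sp_restrict (Wc a)).
Proof.
move=> Feta qeta; have sGs := filtration_sigma hF s0.
have qi i := elem_sqint hF hD hW a (sp_elem (g := g) (ltn_ord i)).
have qj i := elem_sqint hF hD hW a (sp_elem (g := sp_restrict) (ltn_ord i)).
rewrite /sp_ito !dot_sumr//; apply: eq_bigr => i _ /=.
have ec := sp_elem (g := g) (ltn_ord i).
have [ti0 tii Fc [M cM]] := ec; have mc := elem_measurable hF ec.
have {}qi := qi i; have {}qj := qj i; move: qj => /=; rewrite /coef /time.
have qec : sqint P (fun w => sp_coef g i w * eta w).
  exact: (bounded_mul_sqint mc cM qeta).
have move_c r r' : dotL2 P eta (fun w => sp_coef g i w * incr r r' a w) =
    dotL2 P (fun w => sp_coef g i w * eta w) (incr r r' a).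
  by apply: eq_Rintegral => w _; ring.
have [tis|sti] := leP (sp_time g i) s; last first.
  move=> _; transitivity (dotL2 P (fun w => sp_coef g i w * eta w)
                     (incr (sp_time g i) (sp_time g i.+1) a)).
    exact: move_c.
  rewrite (incr_orth hF hD hW a ti0 tii _ qec); last first.
    apply: measurable_wrtM => //; first exact: (filtration_sigma hF).
    exact: (filtration_wrt hF s0 (ltW sti)).
  rewrite /dotL2 -[LHS](mul0r (fine (P setT))) -Rintegral_cst//.
  by apply: eq_Rintegral => w _; rewrite mul0r mulr0.
(* An interval ending before s is untouched by the restriction. One that straddles s is split there,
   and its later half is orthogonal to [eta] times the coefficient. *)
move=> qj; have [tis'|sti'] := leP (sp_time g i.+1) s; first by [].
transitivity (dotL2 P eta (fun w => sp_coef g i w * incr (sp_time g i) s a w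
    + sp_coef g i w * incr s (sp_time g i.+1) a w)).
  by apply: eq_Rintegral => w _; rewrite /incr; ring.
have qs : sqint P (fun w => sp_coef g i w * incr s (sp_time g i.+1) a w).
  exact: (bounded_mul_sqint mc cM (incr_sqint hF hD hW a s0 (ltW sti'))).
have qts : sqint P (fun w => sp_coef g i w * incr (sp_time g i) s a w).
  exact: (bounded_mul_sqint mc cM (incr_sqint hF hD hW a ti0 tis)).
rewrite dotDr// (move_c s) (incr_orth hF hD hW a s0 (ltW sti') _ qec) ?addr0//.
by apply: measurable_wrtM => //; exact: (filtration_wrt hF ti0 tis).
Qed.

End Restrict.

End ItoIsometry.

Section ItoLimits.
Context {R : realType} d (Omega : measurableType d) (P : probability Omega R)
        (F : R -> set (set Omega)) (n : nat) (D : 'M[R]_n)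
        (W : R -> Omega -> 'cV[R]_n).
Hypotheses (hF : filtration F) (hD : posmx D) (hW : brownian_motion P F D W).
Implicit Types (s t : R) (a b : 'I_n) (f : R -> Omega -> R) (I J : Omega -> R).
Local Notation leb := (@lebesgue_measure R).
Local Notation pi := (leb \x P)%E.
Local Notation RO := (measurableTypeR R * Omega)%type.
Local Notation Wc a := (fun s w => W s w a 0).

(** Extension by 0 outside [0, t] puts the integrands of all horizons into the same space L^2(leb x
    P). *)
Definition trunc t f (p : RO) : R := f p.1 p.2 * \1_(`[0, t]) p.1.

Definition meas_process t f : Prop := measurable_fun
  (`[0, t] `*` [set: Omega]) (fun p : R * Omega => f p.1 p.2).

Lemma measurable_trunc t f : meas_process t f -> measurable_fun setT (trunc t f).
Proof.
move=> mf.
have mI : measurable (`[0, t] : set (measurableTypeR R)) by [].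
have mD : measurable (`[0, t] `*` [set: Omega] : set RO) by exact: measurableX.
have /(measurable_restrictT _ mD) : measurable_fun (`[0, t] `*` [set: Omega] : set RO)
    (fun p : RO => f p.1 p.2) by exact: mf.
apply: eq_measurable_fun => -[x w] _; rewrite /trunc patchE indicE in_setX in_setT andbT /=.
by case: ifPn; rewrite (mulr1, mulr0).
Qed.

Lemma sq_mass_trunc t f : meas_process t f ->
  sq_mass P t f = (\int[pi]_p (trunc t f p ^+ 2)%:E)%E.
Proof.
move=> mf; have mt := measurable_trunc mf.
have mt2 : measurable_fun setT (fun p => (trunc t f p ^+ 2)%:E).
  by apply/measurable_EFinP; exact: measurable_funX.
have t20 p : (0 <= (trunc t f p ^+ 2)%:E)%E by rewrite lee_fin sqr_ge0.
apply: etrans (esym (fubini_tonelli2 (m1 := leb) (m2 := P) _ mt2 t20)).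
apply: eq_integral => w _; rewrite integral_mkcond.
apply: eq_integral => x _; rewrite patchE /trunc indicE /=.
by case: ifPn => _; rewrite (mulr1, mulr0)// expr0n.
Qed.

Lemma trunc_sqint t f : meas_process t f -> (sq_mass P t f < +oo)%E ->
  sqint pi (trunc t f).
Proof.
move=> mf foo; apply: fin_sqint; first exact: measurable_trunc.
by rewrite -sq_mass_trunc.
Qed.

Lemma sp_val_trunc t (g : simple_process F t) p :
  sp_val g p * \1_(`[0, t]) p.1 = sp_val g p.
Proof.
rewrite /sp_val /sp_value mulr_suml; apply: eq_bigr => i _.
have [ti0 _ _ _] := sp_elem (g := g) (ltn_ord i).
have tit : sp_time g i.+1 <= t by apply: sp_time_le_t; exact: ltn_ord.
rewrite !indicE !mem_setE !in_itv /= -mulrA; pose x : R := p.1; rewrite -![p.1]/x.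
rewrite -natrM mulnb; congr (_ * _%:R); congr nat_of_bool.
have [tx|//] := ltP (sp_time g i) x; rewrite (le_trans ti0 (ltW tx)) /=.
have [xt|//] := leP x (sp_time g i.+1).
by rewrite (le_trans xt tit).
Qed.

(* I is the Ito integral over the whole half-line of the integrand f, itself an
   element of L^2(leb x P). *)
Definition ito_lim a (f : RO -> R) I : Prop :=
  [/\ sqint pi f, sqint P I &
    exists t (g : nat -> simple_process F t),
      cvgL2 pi (fun k => sp_val (g k)) f /\
      cvgL2 P (fun k => sp_ito (g k) (Wc a)) I].

Lemma ito_lim_simple a t (g : simple_process F t) :
  ito_lim a (sp_val g) (sp_ito g (Wc a)).
Proof.
split; [exact: sp_val_sqint|exact: (sp_ito_sqint hF hD hW)|].
by exists t, (fun=> g); split; exact: cvgL2_cst.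
Qed.

Lemma is_ito_lim a t f I : is_ito_integral P F (Wc a) t f I ->
  ito_lim a (trunc t f) I.
Proof.
move=> [_ mf foo mI [g [cg cI]]].
have qf := trunc_sqint mf foo.
have mito k : measurable_fun setT (sp_ito (g k) (Wc a)).
  by have [] := sp_ito_sqint hF hD hW (g k) a.
have qI : sqint P I.
  (* Convergence to 0 in the extended reals makes the error finite from some index k on. At this k,
     I is a square-integrable error plus a simple integral, hence square integrable. *)
  have /fine_cvgP[[k _ hk] _] := cI; have {}hk := hk k (leqnn k).
  have qd : sqint P (fun w => I w - sp_ito (g k) (Wc a) w).
    apply: fin_sqint; first exact: measurable_funB.
    by move: hk; rewrite unlock => /fineK <-; rewrite ltry.
  have := sqintD qd (sp_ito_sqint hF hD hW (g k) a).
  by congr sqint; apply/funext => w; rewrite subrK.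
split => //; exists t, g; split; rewrite /cvgL2.
- have e k : sq_mass P t (fun s w => f s w - sp_value (g k) s w) =
     (dotL2 pi (fun x => trunc t f x - sp_val (g k) x)
               (fun x => trunc t f x - sp_val (g k) x))%:E.
    rewrite -sqint_fin; last by apply: sqintB => //; exact: sp_val_sqint.
    rewrite sq_mass_trunc; last first.
      apply: measurable_funB => //.
      by apply: measurable_funTS; have [] := sp_val_sqint P hF (g k).
    apply: eq_integral => p _; rewrite /trunc mulrBl.
    by rewrite -[sp_value _ _ _]/(sp_val (g k) p) sp_val_trunc.
  have := fine_cvg cg; under eq_fun do rewrite /= e /=; exact.
- have e k : ('E_P[fun w => ((I w - sp_ito (g k) (Wc a) w) ^+ 2)%R] =
     (dotL2 P (fun w => I w - sp_ito (g k) (Wc a) w)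
              (fun w => I w - sp_ito (g k) (Wc a) w))%:E)%E.
    rewrite -sqint_fin ?unlock//.
    by apply: sqintB => //; exact: (sp_ito_sqint hF hD hW).
  have := fine_cvg cI; under eq_fun do rewrite /= e /=; exact.
Qed.

(** Both sides are limits of the isometry for simple processes, by continuity of the inner product.
    The polarized form in a and b is what produces the cross terms D_ab. *)
Lemma ito_isometry a b (f g : RO -> R) I J : ito_lim a f I -> ito_lim b g J ->
  dotL2 P I J = D a b * dotL2 pi f g.
Proof.
move=> [qf qI [t [gk [cf cI]]]] [qg qJ [t' [hk [cg cJ]]]].
have c1 := cvg_dotL2 (fun k => sp_ito_sqint hF hD hW (gk k) a)
  (fun k => sp_ito_sqint hF hD hW (hk k) b) qI qJ cI cJ.
have c2 := cvg_dotL2 (fun k => sp_val_sqint P hF (gk k))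
  (fun k => sp_val_sqint P hF (hk k)) qf qg cf cg.
apply: (cvg_unique _ c1); first exact: norm_hausdorff.
rewrite (_ : (fun k => _) = (fun k => D a b * dotL2 pi (sp_val (gk k)) (sp_val (hk k)))).
  by apply: cvgMr.
by apply/funext => k; exact: (simple_isometry hF hD hW).
Qed.

Lemma ito_mean0 a (f : RO -> R) I : ito_lim a f I -> \int[P]_w I w = 0.
Proof.
move=> [qf qI [t [gk [cf cI]]]].
have q1 := sqint_cst P (1 : R).
have z : cvgL2 P (fun _ : nat => fun=> 1) (fun=> 1).
  exact: cvgL2_cst.
have c1 := cvg_dotL2 (fun k => sp_ito_sqint hF hD hW (gk k) a)
  (fun k => q1) qI q1 cI z.
transitivity (dotL2 P I (fun=> 1)).
  by apply: eq_Rintegral => w _; rewrite mulr1.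
apply: (cvg_unique _ c1); first exact: norm_hausdorff.
rewrite (_ : (fun k => _) = fun=> 0); first exact: cvg_cst.
by apply/funext => k; exact: (simple_mean0 hF hD hW).
Qed.

Lemma cvgL2_le0 dX (X : measurableType dX) (mu : {measure set X -> \bar R})
    (fk gk : nat -> R) (c : R) : (forall k, 0 <= gk k <= c * fk k) ->
  fk @ \oo --> 0 -> gk @ \oo --> 0.
Proof.
move=> h cf; apply: (@squeeze_cvgr _ _ _ _ (fun=> 0) (fun k => c * fk k)).
- exact: nearW.
- exact: cvg_cst.
- by rewrite -[X in _ --> X](mulr0 c); exact: cvgMr.
Qed.

Lemma ito_martingale a s (f : RO -> R) I J (eta : Omega -> R) : 0 <= s ->
  measurable_wrt (F s) eta -> sqint P eta ->
  ito_lim a f I -> ito_lim a (fun p => f p * \1_(`[0, s]) p.1) J ->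
  dotL2 P eta I = dotL2 P eta J.
Proof.
move=> s0 Feta qeta hI hJ.
have [qf qI [t [g [cf cI]]]] := hI; have [qfs qJ _] := hJ.
pose r k := sp_restrict hF (g k) s0.
(* J comes with an approximating sequence of its own. The isometry shows that the restrictions to
   [0, s] of the approximations of f also converge to it: the squared error is D_aa times that of
   the integrands, and cutting at s can only decrease the latter. *)
have cJ : cvgL2 P (fun k => sp_ito (r k) (Wc a)) J.
  apply: (@cvgL2_le0 _ _ P _ _ (D a a)) cf => k.
  rewrite dot_ge0 /=.
  have qr := sp_ito_sqint hF hD hW (r k) a; have qv := sp_val_sqint P hF (r k).
  have hr := ito_lim_simple a (r k).
  have -> : dotL2 P (fun x => J x - sp_ito (r k) (Wc a) x)
      (fun x => J x - sp_ito (r k) (Wc a) x) =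
      D a a * dotL2 pi (fun p => f p * \1_(`[0, s]) p.1 - sp_val (r k) p)
                       (fun p => f p * \1_(`[0, s]) p.1 - sp_val (r k) p).
    rewrite !(dotBl, dotBr)//; try exact: sqintB.
    rewrite (ito_isometry hJ hJ) (ito_isometry hJ hr) (ito_isometry hr hJ).
    by rewrite (ito_isometry hr hr); ring.
  have Daa : 0 <= D a a.
    by have := hD.2 (delta_mx a 0); rewrite trmx_delta -rowE -colE !mxE.
  apply: ler_wpM2l => //.
  rewrite !dotL2_sqr; apply: le_Rintegral => //.
  - by have [] := sqintB qfs qv.
  - by have [] := sqintB qf (sp_val_sqint P hF (g k)).
  - move=> p _; rewrite sp_val_restrict -mulrBl exprMn ler_piMr ?sqr_ge0//.
have z : cvgL2 P (fun _ : nat => eta) eta.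
  exact: cvgL2_cst.
have c1 := cvg_dotL2 (fun k => qeta)
  (fun k => sp_ito_sqint hF hD hW (g k) a) qeta qI z cI.
have c2 := cvg_dotL2 (fun k => qeta)
  (fun k => sp_ito_sqint hF hD hW (r k) a) qeta qJ z cJ.
apply: (cvg_unique _ c1); first exact: norm_hausdorff.
rewrite (_ : (fun k => _) = (fun k => dotL2 P eta (sp_ito (r k) (Wc a))))//.
apply/funext => k; exact: (martingale_simple hF hD hW).
Qed.

End ItoLimits.

(** * Second moments of Ito processes *)

Section ParametricIntegrals.
Context d1 d2 (T1 : measurableType d1) (T2 : measurableType d2) (R : realType).
Variable m2 : {sigma_finite_measure set T2 -> \bar R}.

(** The positive and negative parts are handled by Tonelli, and [fine] of the difference of their
    integrals is measurable even where that difference is infinite. *)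
Lemma measurable_Rintegral (f : T1 * T2 -> R) : measurable_fun setT f ->
  measurable_fun setT (fun x => \int[m2]_y f (x, y)).
Proof.
move=> mf; apply: measurableT_comp => //.
have mE : measurable_fun setT (EFin \o f) by exact/measurable_EFinP.
pose fp x : \bar R := (\int[m2]_y ((EFin \o f)^\+ (x, y)))%E.
pose fn x : \bar R := (\int[m2]_y ((EFin \o f)^\- (x, y)))%E.
rewrite (_ : (fun x => _) = (fp \- fn)%E); last first.
  apply/funext => x; rewrite [LHS]integralE; congr (_ - _)%E;
    by apply: eq_integral => y _; rewrite ?funeposE ?funenegE.
apply: emeasurable_funB.
  apply: (measurable_fun_fubini_tonelli_F (m2 := m2) (EFin \o f)^\+%E) => //.
  exact: measurable_funepos.
apply: (measurable_fun_fubini_tonelli_F (m2 := m2) (EFin \o f)^\-%E) => //.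
exact: measurable_funeneg.
Qed.

End ParametricIntegrals.

Section ProductRule.
Context {R : realType}.
Local Notation leb := (@lebesgue_measure R).
Local Notation RR := (measurableTypeR R * measurableTypeR R)%type.

Let le_set : set RR := [set p | p.2 <= p.1].

Lemma measurable_le_set : measurable le_set.
Proof.
rewrite -[le_set]setTI.
apply: (@measurable_fun_le _ RR R setT snd fst) => //.
Qed.

(** A variable upper limit becomes a kernel on a fixed domain, which makes the integral accessible
    to Fubini and jointly measurable in its limit. *)
Lemma Rintegral_itv0E (b : R -> R) (s t : R) : 0 <= s <= t ->
  \int[leb]_(r in `[0, s]) b r = \int[leb]_r ((b \_ `[0, t]) r * \1_le_set (s, r)).
Proof.
move=> /andP[s0 st]; rewrite Rintegral_mkcond; apply: eq_Rintegral => r _.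
rewrite !patchE indicE.
have -> : ((s, r) \in le_set) = (r <= s).
  by apply/idP/idP => [/set_mem//|rs]; exact: mem_set.
rewrite !mem_setE /= !in_itv /= -[point]/(0 : R).
have [r0|_] := boolP (0 <= r); last by rewrite /= mul0r.
have [rs|_] /= := leP r s; last by rewrite mulr0.
by rewrite (le_trans rs st) mulr1.
Qed.

(* Fubini on the square [0, t]^2, cut along its diagonal. *)
Lemma Rintegral_product_rule (a b : R -> R) (t : R) :
  leb.-integrable `[0, t] (EFin \o a) -> leb.-integrable `[0, t] (EFin \o b) ->
  (\int[leb]_(s in `[0, t]) a s) * (\int[leb]_(s in `[0, t]) b s) =
  \int[leb]_(s in `[0, t]) (a s * \int[leb]_(r in `[0, s]) b r) +
  \int[leb]_(s in `[0, t]) ((\int[leb]_(r in `[0, s]) a r) * b s).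
Proof.
move=> ia0 ib0.
have mI : measurable (`[0, t] : set (measurableTypeR R)) by [].
pose a' := a \_ `[0, t]; pose b' := b \_ `[0, t].
have ia : leb.-integrable setT (EFin \o a').
  by have /(integrable_mkcond _ mI) := ia0; rewrite restrict_EFin.
have ib : leb.-integrable setT (EFin \o b').
  by have /(integrable_mkcond _ mI) := ib0; rewrite restrict_EFin.
have ma : measurable_fun setT a' by apply/measurable_EFinP; exact: measurable_int ia.
have mb : measurable_fun setT b' by apply/measurable_EFinP; exact: measurable_int ib.
pose h (p : RR) : R := a' p.1 * b' p.2.
have mh : measurable_fun setT h.
  by apply: measurable_funM; apply: measurableT_comp.
have ih : (leb \x leb)%E.-integrable setT (EFin \o h).
  apply/integrable12ltyP; first exact/measurable_EFinP.
  have -> : (\int[leb]_x \int[leb]_y `|(EFin \o h) (x, y)| =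
      (\int[leb]_x `|(a' x)%:E|) * (\int[leb]_y `|(b' y)%:E|))%E.
    have mEa : measurable_fun setT (fun x => `|(a' x)%:E|)%E.
      by apply: measurableT_comp => //; exact/measurable_EFinP.
    have mEb : measurable_fun setT (fun x => `|(b' x)%:E|)%E.
      by apply: measurableT_comp => //; exact/measurable_EFinP.
    rewrite -ge0_integralZr//; last exact: integral_ge0.
    apply: eq_integral => x _; rewrite -ge0_integralZl//.
    by apply: eq_integral => y _; rewrite /= normrM EFinM.
  move/integrableP : ia => [_ ia]; move/integrableP : ib => [_ ib].
  by rewrite lte_mul_pinfty ?integral_ge0// ge0_fin_numE// integral_ge0.
pose h1 p := h p * \1_le_set p; pose h2 p := h p * \1_(~` le_set) p.
have i12 (A : set RR) : measurable A ->
    (leb \x leb)%E.-integrable setT (EFin \o (fun p => h p * \1_A p)).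
  move=> mA; apply: le_integrable ih => //.
    by apply/measurable_EFinP/measurable_funM.
  move=> p _ /=; rewrite lee_fin normrM ler_piMr//.
  by rewrite indicE; case: (_ \in _); rewrite ?normr1 ?normr0.
have i1 := i12 _ measurable_le_set.
have i2 := i12 _ (measurableC measurable_le_set).
have -> : (\int[leb]_(s in `[0, t]) a s) * (\int[leb]_(s in `[0, t]) b s) =
  \int[(leb \x leb)%E]_p h p.
  rewrite -Rintegral12_prod//.
  transitivity (\int[leb]_x (a' x * \int[leb]_y b' y)).
    by rewrite RintegralZr//; congr (_ * _); exact: Rintegral_mkcond.
  by apply: eq_Rintegral => x _; rewrite -RintegralZl.
have -> : \int[(leb \x leb)%E]_p h p =
   \int[(leb \x leb)%E]_p h1 p + \int[(leb \x leb)%E]_p h2 p.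
  rewrite -RintegralD//; apply: eq_Rintegral => p _.
  by rewrite -mulrDr !indicE in_setC; case: (_ \in _); rewrite ?addr0 ?add0r mulr1.
congr (_ + _).
  rewrite -Rintegral12_prod// [RHS]Rintegral_mkcond; apply: eq_Rintegral => s _.
  rewrite [RHS]patchE; case: ifPn => [|sI]; last first.
    rewrite /h1 /h /= /a' patchE (negbTE sI).
    by under eq_Rintegral do rewrite !mul0r; rewrite Rintegral_cst// mul0r.
  rewrite inE /= in_itv /= => s0t; rewrite (Rintegral_itv0E _ s0t) -RintegralZl//.
    apply: eq_Rintegral => r _; rewrite /h1 /h /= mulrA; congr (_ * _ * _).
    by rewrite /a' patchE mem_set//= in_itv.
  apply: le_integrable ib => //.
    apply/measurable_EFinP/measurable_funM => //.
    have mle : measurable_fun setT (\1_le_set : RR -> R).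
      exact: measurable_indic measurable_le_set.
    have mp : measurable_fun setT (fun r : measurableTypeR R => (s, r) : RR).
      by apply: measurable_fun_pair.
    exact: (measurableT_comp mle mp).
  move=> r _ /=; rewrite lee_fin normrM ler_piMr//.
  by rewrite indicE; case: (_ \in _); rewrite ?normr1 ?normr0.
rewrite -Rintegral21_prod// [RHS]Rintegral_mkcond; apply: eq_Rintegral => s _.
rewrite [RHS]patchE; case: ifPn => [|sI]; last first.
  rewrite /h2 /h /= /b' patchE (negbTE sI).
  by under eq_Rintegral do rewrite mulr0 mul0r; rewrite Rintegral_cst// mul0r.
rewrite inE /= in_itv /= => s0t; have [s0 st] := andP s0t.
have ias : leb.-integrable `[0, s] (EFin \o a).
  by apply: integrableS ia0 => //; apply: subset_itvl; rewrite bnd_simp.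
have iao : leb.-integrable `[0, s[ (EFin \o a).
  by apply: integrableS ias => //; apply: subset_itvl; rewrite bnd_simp.
have mIo : measurable (`[0, s[ : set (measurableTypeR R)) by [].
have iao' : leb.-integrable setT (EFin \o (a \_ `[0, s[)).
  by have /(integrable_mkcond _ mIo) := iao; rewrite restrict_EFin.
(* The complement of the closed triangle leaves the half-open interval [0, s[; the missing endpoint
   is a null set. *)
rewrite -Rintegral_itv_bndo_bndc// Rintegral_mkcond -RintegralZr//.
apply: eq_Rintegral => r _; rewrite /h2 /h /= /a' /b' !patchE indicE in_setC.
have -> : ((r, s) \in le_set) = (s <= r).
  by apply/idP/idP => [/set_mem//|rs]; exact: mem_set.
rewrite !mem_setE /= !in_itv /= -[point]/(0 : R) s0t -ltNge.
have [r0|_] := boolP (0 <= r); last by rewrite /= !mul0r.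
have [rs|_] /= := ltP r s; last by rewrite mulr0 mul0r.
by rewrite (le_trans (ltW rs) st) mulr1.
Qed.

End ProductRule.

(** * Time integrals of square-integrable processes *)

Section TimeIntegrals.
Context {R : realType} d (Omega : measurableType d) (P : probability Omega R).
Implicit Types (s t T : R) (f g : R -> Omega -> R) (N : Omega -> R).
Local Notation leb := (@lebesgue_measure R).
Local Notation pi := (leb \x P)%E.
Local Notation RO := (measurableTypeR R * Omega)%type.

Definition drift f t w : R := \int[leb]_(s in `[0, t]) f s w.

Lemma trunc_patch t f w s : trunc t f (s, w) = ((f ^~ w) \_ `[0, t]) s.
Proof.
rewrite /trunc patchE indicE /=.
by case: ifPn => _; rewrite (mulr1, mulr0).
Qed.

Lemma trunc_in t f w s : 0 <= s <= t -> trunc t f (s, w) = f s w.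
Proof. by move=> st; rewrite trunc_patch patchE mem_set//= in_itv. Qed.

Lemma trunc_notin t f w s : ~~ (0 <= s <= t) -> trunc t f (s, w) = 0.
Proof. by move=> st; rewrite trunc_patch patchE memNset//= in_itv; exact/negP. Qed.

Lemma drift_trunc f t w : drift f t w = \int[leb]_s trunc t f (s, w).
Proof.
by rewrite /drift Rintegral_mkcond; apply: eq_Rintegral => s _; rewrite trunc_patch.
Qed.

Lemma trunc_trunc s t f p : s <= t ->
  trunc t f p * \1_(`[0, s]) p.1 = trunc s f p.
Proof.
case: p => r w st; rewrite /trunc !indicE !mem_setE /= !in_itv /= -mulrA -natrM mulnb.
congr (_ * _%:R); congr nat_of_bool.
case: (leP 0 (r : R)) => //= _; case: (leP (r : R) s) => [rs|]; last by rewrite andbF.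
by rewrite (le_trans rs st).
Qed.

Lemma measurable_section dY (Y : measurableType dY) (h : RO -> Y) w : measurable_fun setT h ->
  measurable_fun setT (fun s : measurableTypeR R => h (s, w)).
Proof.
move=> mh; have mp : measurable_fun setT (fun s : measurableTypeR R => (s, w) : RO).
  by apply: measurable_fun_pair.
exact: (measurableT_comp mh mp).
Qed.

Lemma meas_process_le s t f : s <= t -> meas_process t f -> meas_process s f.
Proof.
move=> st; apply: measurable_funS.
  have mI : measurable (`[0, t] : set R) by [].
  exact: measurableX.
by move=> [r w] [/= rs _]; split => //; move: rs; rewrite /= !in_itv /= => /andP[-> /= rs];
  rewrite (le_trans rs).
Qed.

Lemma trunc_sqint_le s t f : s <= t -> meas_process t f ->
  sqint pi (trunc t f) -> sqint pi (trunc s f).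
Proof.
move=> st mf qf; apply: (le_sqint _ qf).
  by apply: measurable_trunc; exact: meas_process_le mf.
move=> p; rewrite -(trunc_trunc f p st) normrM ler_piMr//.
by rewrite indicE; case: (_ \in _); rewrite ?normr1 ?normr0.
Qed.

Lemma lebesgue_itv0 t : 0 <= t -> leb `[0, t] = t%:E.
Proof.
move=> t0; rewrite lebesgue_measure_itv/= lte_fin.
case: ltP => [_|t1]; first by rewrite oppr0 adde0.
by congr (_%:E); apply/eqP; rewrite eq_le t0 t1.
Qed.

Let sqr_indic t : EFin \o (fun s : measurableTypeR R => (\1_(`[0, t]) s : R) ^+ 2) =
  (fun s : measurableTypeR R => (\1_(`[0, t]) s)%:E).
Proof.
apply/funext => s /=; rewrite indicE.
by case: (_ \in _); rewrite ?expr1n ?expr0n.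
Qed.

Let integral_indic_itv0 t : 0 <= t ->
  (\int[leb]_s ((\1_(`[0, t]) : measurableTypeR R -> R) s)%:E = t%:E)%E.
Proof. by move=> t0; rewrite integral_indic// setIT -lebesgue_itv0. Qed.

Lemma indic_itv_sqint t : 0 <= t -> sqint leb (\1_(`[0, t]) : measurableTypeR R -> R).
Proof.
move=> t0; apply: fin_sqint => //.
have := integral_indic_itv0 t0; rewrite -sqr_indic /= => ->; exact: ltry.
Qed.

Lemma indic_itv_norm t : 0 <= t ->
  dotL2 leb (\1_(`[0, t]) : measurableTypeR R -> R) (\1_(`[0, t])) = t.
Proof.
move=> t0; rewrite dotL2_sqr /Rintegral.
by have := integral_indic_itv0 t0; rewrite -sqr_indic /= => ->.
Qed.

Lemma trunc_cst_sqint t N : 0 <= t -> sqint P N -> sqint pi (trunc t (fun=> N)).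
Proof.
move=> t0 qN; have mN : measurable_fun setT N by case: qN.
have mp : meas_process t (fun=> N).
  by apply: measurable_funTS; apply: measurableT_comp => //.
apply: trunc_sqint => //; rewrite /sq_mass.
rewrite (eq_integral (fun w => (N w ^+ 2)%:E * t%:E)%E); last first.
  by move=> w _; rewrite integral_cst//; congr (_ * _)%E; exact: lebesgue_itv0.
have mN2 : measurable_fun setT (fun w => (N w ^+ 2)%:E).
  by apply/measurable_EFinP; exact: measurable_funX.
rewrite ge0_integralZr// ?lee_fin//; last by move=> w _; rewrite lee_fin sqr_ge0.
by rewrite sqint_fin// -EFinM ltry.
Qed.

(** The product measure is finite on [0, t] x Omega, so L^2 is contained in L^1 there: pair with the
    truncated constant 1. *)
Lemma trunc_integrable t f : 0 <= t -> sqint pi (trunc t f) ->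
  pi.-integrable setT (EFin \o trunc t f).
Proof.
move=> t0 qf; have := sqintM qf (trunc_cst_sqint t0 (sqint_cst P 1)).
apply: eq_integrable => // -[s w] _ /=; congr (_%:E).
have [st|st] := boolP (0 <= s <= t); first by rewrite !trunc_in// mulr1.
by rewrite !trunc_notin// mul0r.
Qed.

Lemma dotL2_trunc t f g : sqint pi (trunc t f) -> sqint pi (trunc t g) ->
  dotL2 pi (trunc t f) (trunc t g) = \int[leb]_(s in `[0, t]) dotL2 P (f s) (g s)
  /\ leb.-integrable `[0, t] (EFin \o (fun s => dotL2 P (f s) (g s))).
Proof.
move=> qf qg; have ifg := sqintM qf qg.
have e s : \int[P]_w (trunc t f (s, w) * trunc t g (s, w)) =
    ((fun s => dotL2 P (f s) (g s)) \_ `[0, t]) s.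
  rewrite patchE mem_setE /= in_itv /=; case: ifPn => st.
    by apply: eq_Rintegral => w _; rewrite !trunc_in.
  under eq_Rintegral do rewrite trunc_notin// mul0r.
  by rewrite Rintegral_cst// mul0r.
split.
  rewrite [LHS]/dotL2 -(Rintegral12_prod ifg) [RHS]Rintegral_mkcond.
  by apply: eq_Rintegral => s _; rewrite e.
have := Rintegrable_fubini_F ifg.
have mI : measurable (`[0, t] : set (measurableTypeR R)) by [].
move=> H; apply/(integrable_mkcond _ mI); rewrite restrict_EFin.
by apply: eq_integrable H => // s _ /=; rewrite e.
Qed.

Section Energy.
Variables (T : R) (f : R -> Omega -> R).
Hypotheses (T0 : 0 < T) (mf : meas_process T f) (qf : sqint pi (trunc T f)).

(** The energy of the path w over [0, T]. It may be infinite on a null set, and keeping the value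
    +oo makes the bound of [drift_energy] hold for every w. *)
Let energy w : \bar R := (\int[leb]_s (trunc T f (s, w) ^+ 2)%:E)%E.

Let mt2 : measurable_fun setT (fun p => (trunc T f p ^+ 2)%:E).
Proof. by apply/measurable_EFinP/measurable_funX; exact: measurable_trunc. Qed.

Let t20 p : (0 <= (trunc T f p ^+ 2)%:E)%E.
Proof. by rewrite lee_fin sqr_ge0. Qed.

Let energy_ge0 w : (0 <= energy w)%E.
Proof. by apply: integral_ge0 => s _. Qed.

Let measurable_energy : measurable_fun setT energy.
Proof.
exact: (measurable_fun_fubini_tonelli_G (m1 := leb)
  (fun p : RO => (trunc T f p ^+ 2)%:E)).
Qed.

Let energy_fin : (\int[P]_w energy w < +oo)%E.
Proof.
rewrite -(fubini_tonelli2 (m1 := leb) (m2 := P) _ mt2 t20).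
by rewrite sqint_fin// ltry.
Qed.

(* Cauchy-Schwarz in time *)
Let drift_energy t w : 0 <= t <= T ->
  (((drift f t w) ^+ 2)%:E <= T%:E * energy w)%E.
Proof.
move=> /andP[t0 tT]; have [eoo|eoo] := ltP (energy w) +oo%E; last first.
  have -> : energy w = +oo%E by apply/eqP; rewrite eq_le leey.
  by rewrite gt0_muley ?lte_fin// leey.
have qs : sqint leb (fun s => trunc T f (s, w)).
  by apply: fin_sqint => //; apply: measurable_section; exact: measurable_trunc.
rewrite /energy sqint_fin// -EFinM lee_fin drift_trunc.
have -> : \int[leb]_s trunc t f (s, w) =
    dotL2 leb (fun s => trunc T f (s, w)) (\1_(`[0, t])).
  by apply: eq_Rintegral => s _; rewrite -(trunc_trunc f (s, w) tT).
apply: le_trans (CauchySchwarzL2 qs (indic_itv_sqint t0)) _.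
by rewrite indic_itv_norm// mulrC ler_wpM2r// dot_ge0.
Qed.

Lemma drift_sqint t : 0 <= t <= T -> sqint P (drift f t).
Proof.
move=> tT; have [t0 tT'] := andP tT.
have qt := trunc_sqint_le tT' mf qf.
have md : measurable_fun setT (drift f t).
  have /measurable_int := Rintegrable_fubini_G (trunc_integrable t0 qt).
  move=> /measurable_EFinP; apply: eq_measurable_fun => w _.
  by rewrite -drift_trunc.
apply: fin_sqint => //.
apply: (@le_lt_trans _ _ (\int[P]_w (T%:E * energy w))%E).
  apply: ge0_le_integral => //.
  - by move=> w _; rewrite lee_fin sqr_ge0.
  - by apply/measurable_EFinP; exact: measurable_funX.
  - exact: measurable_funeM.
  - by move=> w _; exact: drift_energy.
rewrite ge0_integralZl// ?lee_fin ?ltW//.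
by rewrite lte_mul_pinfty ?lee_fin ?(ltW T0).
Qed.

Lemma drift_process : meas_process T (drift f) /\ sqint pi (trunc T (drift f)).
Proof.
have md : meas_process T (drift f).
  (* In the variables ((s, w), r) this is f(r, w) for r <= s, cut off to [0, T]; integrating r out
     shows that the drift is jointly measurable in (s, w). *)
  pose h (q : RO * measurableTypeR R) : R :=
    trunc T f (q.2, q.1.2) * \1_[set p : measurableTypeR R * measurableTypeR R | p.2 <= p.1] (q.1.1, q.2).
  have mh : measurable_fun setT h.
    apply: measurable_funM.
      have m1 : measurable_fun setT (fun q : RO * measurableTypeR R => (q.2, q.1.2) : RO).
        apply: measurable_fun_pair => //.
        by apply: measurableT_comp => //.
      exact: (measurableT_comp (measurable_trunc mf) m1).
    have m2 : measurable_fun setT (fun q : RO * measurableTypeR R =>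
        (q.1.1, q.2) : measurableTypeR R * measurableTypeR R).
      apply: measurable_fun_pair => //.
      by apply: measurableT_comp => //.
    exact: (measurableT_comp (measurable_indic measurable_le_set) m2).
  have := measurable_funTS (measurable_Rintegral leb mh) => H.
  apply: (eq_measurable_fun _ _ (H _)) => -[s w].
  rewrite inE /= in_itv /= => -[sT _]; rewrite /drift (Rintegral_itv0E _ sT).
  by apply: eq_Rintegral => r _; rewrite /h /= trunc_patch.
split => //.
have mtd := measurable_trunc md.
apply: fin_sqint => //.
have mtd2 : measurable_fun setT (fun p => (trunc T (drift f) p ^+ 2)%:E).
  by apply/measurable_EFinP/measurable_funX.
have td20 p : (0 <= (trunc T (drift f) p ^+ 2)%:E)%E by rewrite lee_fin sqr_ge0.
rewrite (fubini_tonelli2 (m1 := leb) (m2 := P) _ mtd2 td20).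
apply: (@le_lt_trans _ _ (\int[P]_w (T%:E * (T%:E * energy w)))%E).
  apply: ge0_le_integral => //.
  - by move=> w _; apply: integral_ge0.
  - exact: (measurable_fun_fubini_tonelli_G (m1 := leb)
      (fun p : RO => (trunc T (drift f) p ^+ 2)%:E)).
  - by do 2 apply: measurable_funeM.
  - move=> w _; rewrite /fubini_G.
    have [eoo|eoo] := ltP (energy w) +oo%E; last first.
      have -> : energy w = +oo%E by apply/eqP; rewrite eq_le leey.
      by rewrite !gt0_muley ?lte_fin// leey.
    have /fineK ef : energy w \is a fin_num by rewrite ge0_fin_numE.
    have c0 : 0 <= T * fine (energy w) by rewrite mulr_ge0 ?(ltW T0)// fine_ge0.
    rewrite -ef -!EFinM.
    apply: (@le_trans _ _ (\int[leb]_s ((T * fine (energy w))%:E * (\1_(`[0, T]) s)%:E))%E).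
      apply: ge0_le_integral => //.
      - exact: (measurable_section w mtd2).
      - by apply: measurable_funeM; exact/measurable_EFinP.
      - move=> s _; rewrite -EFinM lee_fin indicE mem_setE /= in_itv /=.
        case: (boolP (0 <= s <= T)) => sT; last first.
          by rewrite trunc_notin// expr0n mulr0.
        rewrite trunc_in// mulr1 -lee_fin [leRHS]EFinM ef; exact: drift_energy.
    rewrite ge0_integralZl// ?lee_fin//; last exact/measurable_EFinP.
    by rewrite (integral_indic_itv0 (ltW T0)) -EFinM lee_fin [leRHS]mulrC.
have Te0 : (0 <= T%:E)%E by rewrite lee_fin ltW.
rewrite ge0_integralZl//; last 2 first.
- exact: measurable_funeM.
- by move=> w _; rewrite mule_ge0.
rewrite ge0_integralZl//.
by rewrite !lte_mul_pinfty ?mule_ge0 ?integral_ge0.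
Qed.

End Energy.

(** Fubini, with N regarded as a process constant in time. The sections in time are integrable only
    for almost every w, which is why the two sides are compared almost everywhere. *)
Lemma dotL2_drift T t f N : 0 <= t <= T -> meas_process T f ->
  sqint pi (trunc T f) -> sqint P (drift f t) -> sqint P N ->
  dotL2 P (drift f t) N = dotL2 pi (trunc t f) (trunc t (fun=> N)).
Proof.
move=> /andP[t0 tT] mf qf qd qN.
have qt := trunc_sqint_le tT mf qf; have qNt := trunc_cst_sqint t0 qN.
have ip := sqintM qt qNt.
rewrite [RHS]/dotL2 -(Rintegral21_prod ip); congr fine; apply: ae_eq_integral => //.
- by apply/measurable_EFinP/measurable_funM; [case: qd|case: qN].
- exact: measurable_int (Rintegrable_fubini_G ip).
- have := ae_integrable2 (trunc_integrable t0 qt).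
  apply: filterS => w iw _ /=; congr (_%:E).
  rewrite drift_trunc -RintegralZr//; apply: eq_Rintegral => s _.
  have [st|st] := boolP (0 <= s <= t); first by rewrite !trunc_in.
  by rewrite !trunc_notin// !mul0r.
Qed.

(** The product rule for two time integrals, applied along almost every path, followed by Fubini. *)
Lemma dotL2_drift2 T t f g : 0 < T -> 0 <= t <= T ->
  meas_process T f -> sqint pi (trunc T f) ->
  meas_process T g -> sqint pi (trunc T g) ->
  dotL2 P (drift f t) (drift g t) =
  dotL2 pi (trunc t f) (trunc t (drift g)) + dotL2 pi (trunc t (drift f)) (trunc t g).
Proof.
move=> T0 tT' mf qf mg qg; have [t0 tT] := andP tT'.
have [mdf qdf] := drift_process T0 mf qf; have [mdg qdg] := drift_process T0 mg qg.
have qft := trunc_sqint_le tT mf qf; have qgt := trunc_sqint_le tT mg qg.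
have qdft := trunc_sqint_le tT mdf qdf; have qdgt := trunc_sqint_le tT mdg qdg.
have i1 := sqintM qft qdgt; have i2 := sqintM qdft qgt.
rewrite [X in _ = X + _]/dotL2 [X in _ = _ + X]/dotL2 -(Rintegral21_prod i1) -(Rintegral21_prod i2).
rewrite -(RintegralD measurableT (Rintegrable_fubini_G i1) (Rintegrable_fubini_G i2)).
congr fine; apply: ae_eq_integral; first exact: measurableT.
- apply/measurable_EFinP/measurable_funM.
    by have [] := drift_sqint T0 mf qf tT'.
  by have [] := drift_sqint T0 mg qg tT'.
- apply/measurable_EFinP/measurable_funD; apply/measurable_EFinP.
    exact: measurable_int (Rintegrable_fubini_G i1).
  exact: measurable_int (Rintegrable_fubini_G i2).
- apply: filterS2 (ae_integrable2 (trunc_integrable t0 qft))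
    (ae_integrable2 (trunc_integrable t0 qgt)) => w iwf iwg _ /=; congr (_%:E).
  have mI : measurable (`[0, t] : set (measurableTypeR R)) by [].
  have sec h : leb.-integrable setT (fun s => (EFin \o trunc t h) (s, w)) ->
      leb.-integrable `[0, t] (EFin \o (fun s => h s w)).
    move=> ih; apply/(integrable_mkcond _ mI); rewrite restrict_EFin.
    by apply: eq_integrable ih => // s _ /=; rewrite trunc_patch.
  rewrite [LHS](Rintegral_product_rule (sec _ iwf) (sec _ iwg)).
  have mk (h1 h2 : R -> Omega -> R) : \int[leb]_(s in `[0, t]) (h1 s w * h2 s w) =
      \int[leb]_s (trunc t h1 (s, w) * trunc t h2 (s, w)).
    rewrite Rintegral_mkcond; apply: eq_Rintegral => s _.
    rewrite patchE mem_setE /= in_itv /=.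
    case: ifPn => st; first by rewrite !trunc_in.
    by rewrite !trunc_notin// mul0r.
  by congr (_ + _); [exact: (mk f (drift g))|exact: (mk (drift f) g)].
Qed.

End TimeIntegrals.

Section SecondMoments.
Context {R : realType} d (Omega : measurableType d) (P : probability Omega R)
        (F : R -> set (set Omega)) (n : nat) (D : 'M[R]_n)
        (W : R -> Omega -> 'cV[R]_n).
Hypotheses (hF : filtration F) (hD : posmx D) (hW : brownian_motion P F D W).
Local Notation leb := (@lebesgue_measure R).
Local Notation pi := (leb \x P)%E.
Local Notation RO := (measurableTypeR R * Omega)%type.
Local Notation Wc a := (fun s w => W s w a 0).
Variable T : R.
Hypothesis T0 : 0 < T.
Implicit Types (s t : R) (al be X Y : R -> Omega -> R).

Record l2_process (f : R -> Omega -> R) : Prop := {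
  l2_adapted : forall s, 0 <= s <= T -> measurable_wrt (F s) (f s) ;
  l2_meas : meas_process T f ;
  l2_mass : (sq_mass P T f < +oo)%E }.

Lemma l2_trunc f : l2_process f -> sqint pi (trunc T f).
Proof. by case=> _ mf foo; exact: trunc_sqint. Qed.

Lemma l2_trunc_le f t : 0 <= t <= T -> l2_process f -> sqint pi (trunc t f).
Proof.
by move=> /andP[t0 tT] lf; apply: (trunc_sqint_le tT); [exact: l2_meas|exact: l2_trunc].
Qed.

Lemma l2_measurable f t : 0 <= t <= T -> l2_process f -> measurable_fun setT (f t).
Proof.
move=> /andP[t0 tT] lf; apply: (adapted_measurable hF t0).
by apply: l2_adapted => //; rewrite t0.
Qed.

Definition noise_part t (f : 'I_n -> R -> Omega -> R) (M : Omega -> R) : Prop :=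
  exists2 J : 'I_n -> Omega -> R,
    (forall a, ito_lim P F W a (trunc t (f a)) (J a)) &
    M = (fun w => \sum_a J a w).

(** The noise term and the exceptional null set may depend on t: only expectations at fixed times
    will be taken. *)
Definition ito_process (x0 : R) al (f : 'I_n -> R -> Omega -> R) X : Prop :=
  forall t, 0 <= t <= T -> exists2 M, noise_part t f M &
    {ae P, forall w, X t w = x0 + drift al t w + M w}.

Lemma noise_sqint t f M : noise_part t f M -> sqint P M.
Proof. by move=> [J hJ ->]; apply: sqint_sum => a _; have [] := hJ a. Qed.

Lemma noise_mean0 t f M c : noise_part t f M -> dotL2 P (fun=> c) M = 0.
Proof.
move=> [J hJ ->]; have qJ a : sqint P (J a) by have [] := hJ a.
rewrite (dot_sumr _ (fun a _ => qJ a) (sqint_cst P c)).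
apply: big1 => a _; rewrite /dotL2 RintegralZl//; last exact: sqint_integrable.
by rewrite (ito_mean0 hF hD hW (hJ a)) mulr0.
Qed.

Lemma noise_cov t f g M N : noise_part t f M -> noise_part t g N ->
  dotL2 P M N = \sum_a \sum_b D a b * dotL2 pi (trunc t (f a)) (trunc t (g b)).
Proof.
move=> hM hN; have qN := noise_sqint hN.
move: hM => [J hJ ->]; move: hN qN => [K hK ->] qN.
have qJ a : sqint P (J a) by have [] := hJ a.
have qK a : sqint P (K a) by have [] := hK a.
rewrite (dot_suml _ (fun a _ => qJ a) qN); apply: eq_bigr => a _.
rewrite (dot_sumr _ (fun b _ => qK b) (qJ a)); apply: eq_bigr => b _.
exact: (ito_isometry hF hD hW (hJ a) (hK b)).
Qed.

Lemma noise_martingale s t f M N eta : 0 <= s -> s <= t ->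
  measurable_wrt (F s) eta -> sqint P eta ->
  noise_part t f M -> noise_part s f N -> dotL2 P eta M = dotL2 P eta N.
Proof.
move=> s0 st Feta qeta [J hJ ->] [K hK ->].
have qJ a : sqint P (J a) by have [] := hJ a.
have qK a : sqint P (K a) by have [] := hK a.
rewrite (dot_sumr _ (fun a _ => qJ a) qeta) (dot_sumr _ (fun a _ => qK a) qeta).
apply: eq_bigr => a _; apply: (ito_martingale hF hD hW s0 Feta qeta (hJ a)).
rewrite (_ : (fun p => _) = trunc s (f a))//.
by apply/funext => p; rewrite trunc_trunc.
Qed.

Lemma ito_process_sqint x0 al f X t : 0 <= t <= T ->
  l2_process al -> l2_process X -> ito_process x0 al f X -> sqint P (X t).
Proof.
move=> tT lal lX hX; have [M hM aeX] := hX t tT.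
apply: (@ae_eq_sqint _ _ _ _ (fun w => x0 + drift al t w + M w)).
- exact: l2_measurable.
- by apply: filterS aeX => w ->.
- apply: sqintD; last exact: noise_sqint hM.
  apply: sqintD; first exact: sqint_cst.
  exact: (drift_sqint T0 (l2_meas lal) (l2_trunc lal)).
Qed.

(* Expectation of the integration by parts formula, without the pathwise Ito
   formula: in <int alpha ds, N_t> the martingale property replaces N_t by N_s
   under the time integral, and N_s is then read off the equation of Y. *)
Lemma drift_noise y0 al be g Y t N : 0 <= t <= T ->
  l2_process al -> (forall s, 0 <= s <= T -> sqint P (al s)) ->
  l2_process be -> l2_process Y -> ito_process y0 be g Y ->
  noise_part t g N ->
  dotL2 P (drift al t) N =
  dotL2 pi (trunc t al) (trunc t Y) - y0 * dotL2 P (drift al t) (fun=> 1)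
    - dotL2 pi (trunc t al) (trunc t (drift be)).
Proof.
move=> tT lal qal lbe lY hY hN; have [t0 tT'] := andP tT.
have qN := noise_sqint hN; have q1 := sqint_cst P (1 : R).
have qd := drift_sqint T0 (l2_meas lal) (l2_trunc lal) tT.
have [mdb qdb] := drift_process T0 (l2_meas lbe) (l2_trunc lbe).
have qdb' := trunc_sqint_le tT' mdb qdb.
have qal' := l2_trunc_le tT lal; have qY' := l2_trunc_le tT lY.
have q1' := trunc_cst_sqint t0 q1; have qN' := trunc_cst_sqint t0 qN.
(* Every term becomes an inner product with [trunc t al], so that the claim reduces to an identity
   at each time s between expectations against [al s]. *)
rewrite !(dotL2_drift tT (l2_meas lal) (l2_trunc lal) qd)//.
rewrite -dotZr// -(dotBr qY' (sqintZ y0 q1') qal') -dotBr//; last first.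
  exact: sqintB (sqintZ y0 q1').
have -> : (fun x => trunc t Y x - y0 * trunc t (fun=> fun=> 1) x - trunc t (drift be) x)
   = trunc t (fun s w => Y s w - y0 - drift be s w).
  by apply/funext => p; rewrite /trunc; ring.
have qr : sqint pi (trunc t (fun s w => Y s w - y0 - drift be s w)).
  have := sqintB (sqintB qY' (sqintZ y0 q1')) qdb'.
  by congr sqint; apply/funext => p; rewrite /trunc; ring.
have [-> _] := dotL2_trunc qal' qN'; have [-> _] := dotL2_trunc qal' qr.
apply: eq_Rintegral => s; rewrite inE /= in_itv /= => /andP[s0 st].
have sT : 0 <= s <= T by rewrite s0 (le_trans st).
have [Ns hNs aeY] := hY s sT.
rewrite (noise_martingale s0 st (l2_adapted lal sT) (qal s sT) hN hNs).
rewrite dotC [RHS]dotC; apply: ae_eq_dotL2.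
- by have [] := noise_sqint hNs.
- apply: measurable_funB; last first.
    by have [] := drift_sqint T0 (l2_meas lbe) (l2_trunc lbe) sT.
  by apply: measurable_funB => //; exact: l2_measurable.
- by have [] := qal s sT.
- by apply: filterS aeY => w ->; ring.
Qed.

(** Expanding both processes, the product rule for the two drifts yields the pairings of [al] with
    [drift be] and of [drift al] with [be]. These cancel against the terms subtracted in the two
    uses of [drift_noise], as do the products of an initial value with a mean drift. *)
Lemma ito_second_moment x0 y0 al be f g X Y t : 0 <= t <= T ->
  l2_process al -> (forall s, 0 <= s <= T -> sqint P (al s)) ->
  l2_process be -> (forall s, 0 <= s <= T -> sqint P (be s)) ->
  l2_process X -> l2_process Y ->
  ito_process x0 al f X -> ito_process y0 be g Y ->
  dotL2 P (X t) (Y t) = x0 * y0 +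
    dotL2 pi (trunc t al) (trunc t Y) + dotL2 pi (trunc t X) (trunc t be) +
    \sum_a \sum_b D a b * dotL2 pi (trunc t (f a)) (trunc t (g b)).
Proof.
move=> tT lal qal lbe qbe lX lY hX hY; have [t0 tT'] := andP tT.
have [M hM aeX] := hX t tT; have [N hN aeY] := hY t tT.
have qM := noise_sqint hM; have qN := noise_sqint hN.
have qV := drift_sqint T0 (l2_meas lal) (l2_trunc lal) tT.
have qU := drift_sqint T0 (l2_meas lbe) (l2_trunc lbe) tT.
have qx := sqint_cst P x0; have qy := sqint_cst P y0; have q1 := sqint_cst P (1 : R).
have qXt := ito_process_sqint tT lal lX hX.
have qYt := ito_process_sqint tT lbe lY hY.
have qX' : sqint P (fun w => x0 + drift al t w + M w).
  exact: (sqintD (sqintD qx qV) qM).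
have qY' : sqint P (fun w => y0 + drift be t w + N w).
  exact: (sqintD (sqintD qy qU) qN).
rewrite (ae_eq_dotL2 _ _ _ aeX); [|by case: qXt|by case: qX'|by case: qYt].
rewrite dotC (ae_eq_dotL2 _ _ _ aeY); [|by case: qYt|by case: qY'|by case: qX'].
rewrite dotC.
have qx' := sqintD qx qV; have qy' := sqintD qy qU.
rewrite (dotDl qx' qM qY') (dotDl qx qV qY').
rewrite (dotDr qy' qN qx) (dotDr qy' qN qV) (dotDr qy' qN qM).
rewrite (dotDr qy qU qx) (dotDr qy qU qV) (dotDr qy qU qM).
have cst1 (c : R) (h : Omega -> R) : sqint P h ->
    dotL2 P (fun=> c) h = c * dotL2 P h (fun=> 1).
  move=> qh; rewrite (dotC P _ h) -(dotZr c q1 qh).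
  by apply: eq_Rintegral => w _; rewrite mulr1.
rewrite (noise_mean0 x0 hN) (dotC P M (fun=> y0)) (noise_mean0 y0 hM).
rewrite (cst1 x0 (drift be t))// (dotC P (drift al t) (fun=> y0)) (cst1 y0 (drift al t))//.
have -> : dotL2 P (fun=> x0) (fun=> y0) = x0 * y0.
  by rewrite /dotL2 Rintegral_cst// [X in fine X]probability_setT /= mulr1.
rewrite (dotL2_drift2 T0 tT (l2_meas lal) (l2_trunc lal) (l2_meas lbe) (l2_trunc lbe)).
rewrite (drift_noise tT lal qal lbe lY hY hN) (dotC P M).
rewrite (drift_noise tT lbe qbe lal lX hX hM) (noise_cov hM hN).
rewrite (dotC pi (trunc t be) (trunc t X)) (dotC pi (trunc t be) (trunc t (drift al))).
ring.
Qed.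

End SecondMoments.

(** * Gronwall's inequality for integrable functions *)

Section Gronwall.
Context {R : realType}.
Local Notation leb := (@lebesgue_measure R).

Lemma Rintegral_expr (k : nat) (t : R) : 0 <= t ->
  \int[leb]_(s in `[0, t]) (s ^+ k) = t ^+ k.+1 / k.+1%:R.
Proof.
rewrite le_eqVlt => /predU1P[<-|t0].
  by rewrite set_itv1 Rintegral_set1 expr0n mul0r.
pose G (s : R) := k.+1%:R^-1 * s ^+ k.+1.
have dG (s : R) : is_derive s (1 : R) (G : R -> R) (s ^+ k).
  have -> : G = k.+1%:R^-1 \*: (@idfun R ^+ k.+1).
    by apply/funext => y; rewrite /G /= fctE.
  apply: is_derive_eq; rewrite /GRing.scale /= mulr1 mulrA mulVf ?mul1r//.
have cG : continuous G.
  move=> s; apply: differentiable_continuous; apply/derivable1_diffP.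
  by have [] := dG s.
rewrite /Rintegral (@continuous_FTC2 _ _ G)//=.
- by rewrite /G expr0n mulr0 subr0 mulrC.
- by apply: continuous_subspaceT => s; exact: exprn_continuous.
- split; first by move=> s _; have [] := dG s.
  + by apply: cvg_at_right_filter; exact: cG.
  + by apply: cvg_at_left_filter; exact: cG.
- by move=> s _; rewrite derive1E; have [_ ->] := dG s.
Qed.

(** Since m is merely integrable, the inequality is iterated. With M = C times the integral of m
    over [0, T], k further iterations give m(t) <= M (C t)^k / k!, and the last factor is a term of
    the exponential series, hence tends to 0. *)
Lemma gronwall0 (m : R -> R) (C T : R) : 0 <= C -> 0 <= T ->
  leb.-integrable `[0, T] (EFin \o m) -> (forall t, 0 <= m t) ->
  (forall t, 0 <= t <= T -> m t <= C * \int[leb]_(s in `[0, t]) m s) ->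
  forall t, 0 <= t <= T -> m t = 0.
Proof.
move=> C0 T0 im m0 mC.
have ims t : t <= T -> leb.-integrable `[0, t] (EFin \o m).
  by move=> tT; apply: integrableS im => //; apply: subset_itvl; rewrite bnd_simp.
have int0 t : 0 <= \int[leb]_(s in `[0, t]) m s by apply: Rintegral_ge0.
pose M := C * \int[leb]_(s in `[0, T]) m s.
have M0 : 0 <= M by rewrite mulr_ge0.
have iexp k c t : leb.-integrable `[0, t] (EFin \o (fun s : R => c * s ^+ k)).
  apply: continuous_compact_integrable; first exact: segment_compact.
  apply: continuous_subspaceT => s; apply: cvgMr; exact: exprn_continuous.
have bound k t : 0 <= t <= T -> m t <= M * ((C * t) ^+ k / k`!%:R).
  elim: k t => [|k IH] t tT; have [t0 tT'] := andP tT; apply: le_trans (mC t tT) _.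
    rewrite expr0 fact0 divr1 mulr1 ler_wpM2l//.
    rewrite fine_le//; [exact: integrable_fin_num (ims _ tT')|
      exact: integrable_fin_num im|].
    apply: ge0_subset_integral => //.
    - exact: measurable_int im.
    - by move=> s _; rewrite lee_fin.
    - by apply: subset_itvl; rewrite bnd_simp.
  apply: (@le_trans _ _ (C * \int[leb]_(s in `[0, t])
      (M * (C ^+ k / k`!%:R) * s ^+ k))).
    rewrite ler_wpM2l//; apply: le_Rintegral => //; first exact: ims.
    move=> s; rewrite /= in_itv /= => /andP[s0 st].
    have := IH s; rewrite s0 (le_trans st tT') => /(_ isT) /le_trans; apply.
    by rewrite exprMn le_eqVlt; apply/orP; left; apply/eqP; ring.
  have -> : \int[leb]_(s in `[0, t]) (M * (C ^+ k / k`!%:R) * s ^+ k) =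
      M * (C ^+ k / k`!%:R) * (t ^+ k.+1 / k.+1%:R).
    have i1 : leb.-integrable `[0, t] (EFin \o (fun s : R => s ^+ k)).
      by apply: eq_integrable (iexp k 1 t) => // s _ /=; rewrite mul1r.
    by rewrite RintegralZl//; congr (_ * _); exact: Rintegral_expr.
  rewrite le_eqVlt; apply/orP; left; apply/eqP.
  rewrite factS natrM exprMn !exprS.
  have : k`!%:R != 0 :> R by rewrite pnatr_eq0 -lt0n fact_gt0.
  have : k.+1%:R != 0 :> R by rewrite pnatr_eq0.
  by move: (k.+1%:R : R) (k`!%:R : R) => q f q0 f0; field; rewrite q0 f0.
move=> t tT; apply/eqP; rewrite eq_le m0 andbT.
have cv : (fun k => M * exp_coeff (C * t) k) @ \oo --> (0 : R).
  rewrite -[X in _ --> X](mulr0 M); apply: cvgMr.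
  by apply: cvg_series_cvg_0; exact: is_cvg_series_exp_coeff.
rewrite -[leRHS](cvg_lim _ cv)//; apply: limr_ge.
  by apply/cvg_ex; exists 0.
by apply: nearW => k; rewrite /exp_coeff; exact: bound.
Qed.

End Gronwall.

(** * The Lindblad equation *)

Section ComplexL1.
Context {R : realType}.
Implicit Types z w : R[i].

Lemma cReD z w : complex.Re (z + w) = complex.Re z + complex.Re w.
Proof. by case: z; case: w. Qed.

Lemma cImD z w : complex.Im (z + w) = complex.Im z + complex.Im w.
Proof. by case: z; case: w. Qed.

Lemma cReN z : complex.Re (- z) = - complex.Re z.
Proof. by case: z. Qed.

Lemma cImN z : complex.Im (- z) = - complex.Im z.
Proof. by case: z. Qed.

Lemma cReM z w : complex.Re (z * w) =
  complex.Re z * complex.Re w - complex.Im z * complex.Im w.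
Proof. by case: z; case: w. Qed.

Lemma cImM z w : complex.Im (z * w) =
  complex.Re z * complex.Im w + complex.Im z * complex.Re w.
Proof. by case: z; case: w. Qed.

Lemma cRe_sum (I : Type) (r : seq I) (p : pred I) (f : I -> R[i]) :
  complex.Re (\sum_(i <- r | p i) f i) = \sum_(i <- r | p i) complex.Re (f i).
Proof. by apply: (big_morph _ cReD). Qed.

Lemma cIm_sum (I : Type) (r : seq I) (p : pred I) (f : I -> R[i]) :
  complex.Im (\sum_(i <- r | p i) f i) = \sum_(i <- r | p i) complex.Im (f i).
Proof. by apply: (big_morph _ cImD). Qed.

Lemma conj_pairE z : (z^*)%R = Complex (complex.Re z) (- complex.Im z).
Proof. by case: z. Qed.

Lemma complex_ext z w : complex.Re z = complex.Re w ->
  complex.Im z = complex.Im w -> z = w.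
Proof. by case: z; case: w => /= ? ? ? ? -> ->. Qed.

(* The l^1 norm on C = R^2 and its entrywise sum on matrices: submultiplicative
   and directly comparable with real and imaginary parts. *)
Definition cabs z : R := `|complex.Re z| + `|complex.Im z|.

Lemma cabs_ge0 z : 0 <= cabs z. Proof. exact: addr_ge0. Qed.

Lemma cabsD z w : cabs (z + w) <= cabs z + cabs w.
Proof.
rewrite /cabs cReD cImD; have := ler_normD (complex.Re z) (complex.Re w).
by have := ler_normD (complex.Im z) (complex.Im w); lra.
Qed.

Lemma cabsN z : cabs (- z) = cabs z.
Proof. by rewrite /cabs cReN cImN !normrN. Qed.

Lemma cabsM z w : cabs (z * w) <= cabs z * cabs w.
Proof.
rewrite /cabs cReM cImM; apply: le_trans (lerD (ler_normB _ _) (ler_normD _ _)) _.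
by rewrite !normrM; lra.
Qed.

Lemma cabs0 : cabs 0 = 0. Proof. by rewrite /cabs /= normr0 addr0. Qed.

Lemma cabs_sum (I : Type) (r : seq I) (f : I -> R[i]) :
  cabs (\sum_(i <- r) f i) <= \sum_(i <- r) cabs (f i).
Proof.
elim: r => [|i r IH]; first by rewrite !big_nil cabs0.
by rewrite !big_cons (le_trans (cabsD _ _))// lerD2l.
Qed.

Definition mabs m n (A : 'M[R[i]]_(m, n)) : R := \sum_i \sum_j cabs (A i j).

Lemma mabs_ge0 m n (A : 'M[R[i]]_(m, n)) : 0 <= mabs A.
Proof. by do 2 (apply: sumr_ge0 => ? _); exact: cabs_ge0. Qed.

Lemma le_cabs_mabs m n (A : 'M[R[i]]_(m, n)) i j : cabs (A i j) <= mabs A.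
Proof.
rewrite /mabs (bigD1 i)//= (bigD1 j)//= -addrA lerDl addr_ge0//.
  by apply: sumr_ge0 => ? _; exact: cabs_ge0.
by do 2 (apply: sumr_ge0 => ? _); exact: cabs_ge0.
Qed.

Lemma mabs_eq0 m n (A : 'M[R[i]]_(m, n)) : mabs A = 0 -> A = 0.
Proof.
move=> A0; apply/matrixP => i j; rewrite mxE; have := le_cabs_mabs A i j.
rewrite A0 /cabs; case: (A i j) => x y /= h.
have := normr_ge0 x; have := normr_ge0 y => y0 x0.
have -> : x = 0 by apply/eqP; rewrite -normr_eq0; apply/eqP; lra.
by have -> : y = 0 by apply/eqP; rewrite -normr_eq0; apply/eqP; lra.
Qed.

Lemma mabsD m n (A B : 'M[R[i]]_(m, n)) : mabs (A + B) <= mabs A + mabs B.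
Proof.
rewrite /mabs -big_split /=; apply: ler_sum => i _.
rewrite -big_split /=; apply: ler_sum => j _.
by rewrite mxE; exact: cabsD.
Qed.

Lemma mabsN m n (A : 'M[R[i]]_(m, n)) : mabs (- A) = mabs A.
Proof. by do 2 (apply: eq_bigr => ? _); rewrite mxE cabsN. Qed.

Lemma mabs0 m n : mabs (0 : 'M[R[i]]_(m, n)) = 0.
Proof. by do 2 (apply: big1 => ? _); rewrite mxE cabs0. Qed.

Lemma mabs_sum (I : Type) (r : seq I) m n (f : I -> 'M[R[i]]_(m, n)) :
  mabs (\sum_(i <- r) f i) <= \sum_(i <- r) mabs (f i).
Proof.
elim: r => [|i r IH]; first by rewrite !big_nil mabs0.
by rewrite !big_cons (le_trans (mabsD _ _))// lerD2l.
Qed.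

Lemma mabsZ m n c (A : 'M[R[i]]_(m, n)) : mabs (c *: A) <= cabs c * mabs A.
Proof.
rewrite /mabs mulr_sumr; apply: ler_sum => i _.
rewrite mulr_sumr; apply: ler_sum => j _.
by rewrite mxE; exact: cabsM.
Qed.

Lemma mabsM m n p (A : 'M[R[i]]_(m, n)) (B : 'M[R[i]]_(n, p)) :
  mabs (A *m B) <= mabs A * mabs B.
Proof.
have rowB k : \sum_j cabs (B k j) <= mabs B.
  rewrite /mabs [leRHS](bigD1 k)//= lerDl; apply: sumr_ge0 => ? _.
  by apply: sumr_ge0 => ? _; exact: cabs_ge0.
rewrite [X in X * _]/mabs mulr_suml; apply: ler_sum => i _.
apply: (@le_trans _ _ (\sum_k \sum_j cabs (A i k) * cabs (B k j))).
  rewrite [leRHS]exchange_big /=; apply: ler_sum => j _.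
  rewrite mxE; apply: le_trans (cabs_sum _ _) _.
  by apply: ler_sum => k _; exact: cabsM.
rewrite mulr_suml; apply: ler_sum => k _; rewrite -mulr_sumr.
by rewrite ler_wpM2l ?cabs_ge0.
Qed.

End ComplexL1.

Section Adjoint.
Context {R : realType}.

Lemma adjmxM m n p (A : 'M[R[i]]_(m, n)) (B : 'M[R[i]]_(n, p)) :
  (A *m B)^t* = B^t* *m A^t*.
Proof. by rewrite trmx_mul map_mxM. Qed.

Lemma adjmxD m n (A B : 'M[R[i]]_(m, n)) : (A + B)^t* = A^t* + B^t*.
Proof. by apply/matrixP => i j; rewrite !mxE rmorphD. Qed.

Lemma adjmxN m n (A : 'M[R[i]]_(m, n)) : (- A)^t* = - A^t*.
Proof. by apply/matrixP => i j; rewrite !mxE rmorphN. Qed.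

Lemma adjmxZ m n c (A : 'M[R[i]]_(m, n)) : (c *: A)^t* = (c^*)%R *: A^t*.
Proof. by apply/matrixP => i j; rewrite !mxE rmorphM. Qed.

Lemma adjmx_sum m n (I : Type) (r : seq I) (f : I -> 'M[R[i]]_(m, n)) :
  (\sum_(i <- r) f i)^t* = \sum_(i <- r) (f i)^t*.
Proof.
elim: r => [|i r IH]; last by rewrite !big_cons adjmxD IH.
by rewrite !big_nil; apply/matrixP => i j; rewrite !mxE rmorph0.
Qed.

Lemma conj_real (r : R) : ((r%:C%C)^*)%R = r%:C%C.
Proof. exact: conjc_real. Qed.

Lemma conj_i : ('i%C^*)%R = - 'i%C :> R[i].
Proof. by apply: complex_ext; rewrite /= ?oppr0. Qed.

Lemma conj_half : ((2^-1)^*)%R = 2^-1 :> R[i].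
Proof. by rewrite fmorphV rmorph_nat. Qed.

Lemma hermsymm_adj n (A : 'M[R[i]]_n) : A \is hermsymmx -> A^t* = A.
Proof. by rewrite is_hermitianmxE expr0 scale1r => /eqP {2}->. Qed.

Lemma mabs_adj m n (A : 'M[R[i]]_(m, n)) : mabs (A^t*) = mabs A.
Proof.
rewrite /mabs exchange_big /=; apply: eq_bigr => i _; apply: eq_bigr => j _.
by rewrite !mxE conj_pairE /cabs /= normrN.
Qed.

End Adjoint.

Lemma addrB3 (V : zmodType) (a1 a2 b1 b2 c1 c2 : V) :
  (a1 - a2) + (b1 - b2) + (c1 - c2) = (a1 + b1 + c1) - (a2 + b2 + c2).
Proof. by rewrite (addrACA a1) -opprD (addrACA (a1 + b1)) -opprD. Qed.

Section LindbladOperator.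
Context {R : realType} (N n : nat).
Variables (D : 'M[R]_n) (A : 'M[R[i]]_N) (C : 'I_n -> 'M[R[i]]_N).

Definition lindblad_op (X : 'M[R[i]]_N) : 'M[R[i]]_N :=
  A *m X + X *m A^t* + \sum_a \sum_b (D a b)%:C%C *: (C a *m X *m (C b)^t*).

Lemma lindblad_opB X Y : lindblad_op (X - Y) = lindblad_op X - lindblad_op Y.
Proof.
have e : \sum_a \sum_b (D a b)%:C%C *: (C a *m (X - Y) *m (C b)^t*) =
  \sum_a \sum_b (D a b)%:C%C *: (C a *m X *m (C b)^t*) -
  \sum_a \sum_b (D a b)%:C%C *: (C a *m Y *m (C b)^t*).
  rewrite -sumrB; apply: eq_bigr => a _; rewrite -sumrB; apply: eq_bigr => b _.
  by rewrite mulmxBr mulmxBl scalerBr.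
by rewrite /lindblad_op e mulmxBr mulmxBl addrB3.
Qed.

(** By linearity this is a Lipschitz bound, and it supplies the constant for Gronwall. *)
Lemma lindblad_op_bound X : mabs (lindblad_op X) <=
  (mabs A + mabs (A^t*) +
   \sum_a \sum_b cabs (D a b)%:C%C * (mabs (C a) * mabs ((C b)^t*))) * mabs X.
Proof.
rewrite !mulrDl; apply: le_trans (mabsD _ _) _; apply: lerD.
  apply: le_trans (mabsD _ _) _; apply: lerD; first exact: mabsM.
  by rewrite mulrC; exact: mabsM.
rewrite mulr_suml; apply: le_trans (mabs_sum _ _) _; apply: ler_sum => a _.
rewrite mulr_suml; apply: le_trans (mabs_sum _ _) _; apply: ler_sum => b _.
apply: le_trans (mabsZ _ _) _; rewrite -mulrA ler_wpM2l ?cabs_ge0//.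
apply: le_trans (mabsM _ _) _; rewrite mulrAC ler_wpM2r ?mabs_ge0//.
exact: mabsM.
Qed.

End LindbladOperator.

Lemma lindblad_rearrange (R : realType) N (KX XK SX XS Z : 'M[R[i]]_N) :
  - 'i%C *: (KX - XK) + (Z - 2^-1 *: (SX + XS)) =
  (- 'i%C *: KX - 2^-1 *: SX) + ('i%C *: XK - 2^-1 *: XS) + Z.
Proof. by apply/matrixP => i j; rewrite !mxE; ring. Qed.

Lemma drift_rearrange (R : realType) N (K0 S K1 : 'M[R[i]]_N) :
  - 'i%C *: K0 - 2^-1 *: S - 'i%C *: K1 = - 'i%C *: (K0 + K1) - 2^-1 *: S.
Proof. by apply/matrixP => i j; rewrite !mxE; ring. Qed.

Lemma mulmxZBl (R : comNzRingType) N (c e : R) (K S X : 'M[R]_N) :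
  (c *: K - e *: S) *m X = c *: (K *m X) - e *: (S *m X).
Proof. by rewrite mulmxBl -!scalemxAl. Qed.

Lemma mulmxZBr (R : comNzRingType) N (c e : R) (K S X : 'M[R]_N) :
  X *m (c *: K - e *: S) = c *: (X *m K) - e *: (X *m S).
Proof. by rewrite mulmxBr -!scalemxAr. Qed.

Section LindbladAlgebra.
Context {R : realType} (N n : nat).
Variables (H0 : 'M[R[i]]_N) (H : 'I_n -> 'M[R[i]]_N) (D : 'M[R]_n).

Definition noise_op a : 'M[R[i]]_N := - 'i%C *: H a.

Definition drift_op (u : 'cV[R]_n) : 'M[R[i]]_N :=
  - 'i%C *: H0 - 2^-1 *: \sum_a \sum_b (D a b)%:C%C *: (H a *m H b)
  - 'i%C *: \sum_a (u a 0)%:C%C *: H a.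

Lemma sse_driftE u (v : 'cV[R[i]]_N) : sse_drift H0 H D u v = drift_op u *m v.
Proof.
have e1 : \sum_a \sum_b (D a b)%:C%C *: (H a *m H b *m v) =
    (\sum_a \sum_b (D a b)%:C%C *: (H a *m H b)) *m v.
  rewrite mulmx_suml; apply: eq_bigr => a _; rewrite mulmx_suml.
  by apply: eq_bigr => b _; exact: scalemxAl.
have e2 : \sum_a (u a 0)%:C%C *: (H a *m v) = (\sum_a (u a 0)%:C%C *: H a) *m v.
  by rewrite mulmx_suml; apply: eq_bigr => a _; exact: scalemxAl.
rewrite /sse_drift /drift_op e1 e2.
move: (\sum_a _) (\sum_a _) => S1 S2.
have mB (A B : 'M[R[i]]_N) : (A - B) *m v = A *m v - B *m v by exact: mulmxBl.
have mZ c (A : 'M[R[i]]_N) : (c *: A) *m v = c *: (A *m v) by rewrite scalemxAl.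
by rewrite !mB !mZ.
Qed.

(** The right-hand side depends on the control only through M; a bounded control thus gives one
    bound for all times. *)
Lemma drift_op_bound (u : 'cV[R]_n) (M : R) : (forall a, `|u a 0| <= M) ->
  mabs (drift_op u) <= cabs (- 'i%C : R[i]) * mabs H0 +
    cabs (2^-1 : R[i]) * mabs (\sum_a \sum_b (D a b)%:C%C *: (H a *m H b)) +
    cabs ('i%C : R[i]) * \sum_a M * mabs (H a).
Proof.
move=> uM; apply: le_trans (mabsD _ _) _; apply: lerD.
  apply: le_trans (mabsD _ _) _; rewrite mabsN; apply: lerD; exact: mabsZ.
rewrite mabsN; apply: le_trans (mabsZ _ _) _; rewrite ler_wpM2l ?cabs_ge0//.
apply: le_trans (mabs_sum _ _) _; apply: ler_sum => a _.
apply: le_trans (mabsZ _ _) _; rewrite ler_wpM2r ?mabs_ge0//.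
by rewrite /cabs /= normr0 addr0.
Qed.

Section ChangeOfFrame.
Variables (C' : 'I_n -> 'M[R[i]]_N) (D' : 'M[R]_n) (G : 'M[R[i]]_n).
Hypothesis hC' : forall b, - 'i%C *: H b = \sum_a G a b *: C' a.
Hypothesis hD' : map_mx (real_complex R) D' =
  G *m map_mx (real_complex R) D *m G^t*.

(** The second argument of f receives the adjoint itself, so f is bilinear and the conjugate entries
    of G arise from [adjC]. Expanding D' = G D G^t* and regrouping the factors of G around C'
    reassembles the operators C. It serves for both f(A, B) = B A and f(A, B) = A X B. *)
Lemma change_of_frame (V : lmodType R[i])
    (f : 'M[R[i]]_N -> 'M[R[i]]_N -> V) :
  (forall B k X Y, f (k *: X + Y) B = k *: f X B + f Y B) ->
  (forall A k X Y, f A (k *: X + Y) = k *: f A X + f A Y) ->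
  \sum_a \sum_b (D' a b)%:C%C *: f (C' a) ((C' b)^t*) =
  \sum_a \sum_b (D a b)%:C%C *: f (noise_op a) ((noise_op b)^t*).
Proof.
move=> fl fr.
(* Linearity at k = -1 and X = Y = 0 reads f(0, B) = - f(0, B) + f(0, B). *)
have fl0 B : f 0 B = 0.
  by have := fl B (-1) 0 0; rewrite scaler0 addr0 scaleN1r addNr.
have fr0 A : f A 0 = 0.
  by have := fr A (-1) 0 0; rewrite scaler0 addr0 scaleN1r addNr.
have fls (I : Type) (r : seq I) (c : I -> R[i]) (A : I -> 'M[R[i]]_N) B :
    f (\sum_(i <- r) c i *: A i) B = \sum_(i <- r) c i *: f (A i) B.
  by elim: r => [|i r IH]; rewrite ?(big_nil, fl0) // !big_cons fl IH.
have frs (I : Type) (r : seq I) (c : I -> R[i]) (B : I -> 'M[R[i]]_N) A :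
    f A (\sum_(i <- r) c i *: B i) = \sum_(i <- r) c i *: f A (B i).
  by elim: r => [|i r IH]; rewrite ?(big_nil, fr0) // !big_cons fr IH.
have adjC b : (noise_op b)^t* = \sum_a ((G a b)^* )%R *: ((C' a)^t*).
  by rewrite /noise_op hC' adjmx_sum; apply: eq_bigr => a _; rewrite adjmxZ.
have D'E a b : (D' a b)%:C%C =
    \sum_c \sum_e G a c * (D c e)%:C%C * ((G b e)^* )%R.
  have /matrixP /(_ a b) := hD'; rewrite !mxE => ->.
  under eq_bigr do rewrite !mxE mulr_suml.
  rewrite exchange_big /=; apply: eq_bigr => c _; apply: eq_bigr => e _.
  by rewrite !mxE.
transitivity (\sum_a \sum_b \sum_c \sum_e
    (G a c * (D c e)%:C%C * ((G b e)^* )%R) *: f (C' a) ((C' b)^t*)).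
  apply: eq_bigr => a _; apply: eq_bigr => b _; rewrite D'E scaler_suml.
  by apply: eq_bigr => c _; rewrite scaler_suml.
transitivity (\sum_c \sum_e \sum_a \sum_b
    (G a c * (D c e)%:C%C * ((G b e)^* )%R) *: f (C' a) ((C' b)^t*)).
  under eq_bigr do rewrite exchange_big /=.
  rewrite exchange_big /=; apply: eq_bigr => c _.
  under eq_bigr do rewrite exchange_big /=.
  by rewrite exchange_big.
apply: eq_bigr => c _; apply: eq_bigr => e _.
rewrite [in RHS]/noise_op hC' fls scaler_sumr; apply: eq_bigr => a _.
rewrite -/(noise_op e) adjC frs !scaler_sumr; apply: eq_bigr => b _.
by rewrite !scalerA; congr (_ *: _); ring.
Qed.

Hypothesis hH0 : H0 \is hermsymmx.
Hypothesis hH : forall a, H a \is hermsymmx.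
Hypothesis hD : D \is symmetricmx.

(** The frame change turns the anticommutator part into S and the jump part into the sum over C.
    Since K and S are Hermitian, the latter by the symmetry of the real matrix D, the adjoint of -iK
    - S/2 is iK - S/2, and the commutator and anticommutator recombine into A X + X A^t*. *)
Lemma lindblad_rhsE u X : lindblad_rhs H0 H D' C' u X =
  lindblad_op D (drift_op u) noise_op X.
Proof.
pose S := \sum_a \sum_b (D a b)%:C%C *: (H a *m H b).
pose K := H0 + \sum_a (u a 0)%:C%C *: H a.
have Dsym a b : D b a = D a b.
  have := hD; rewrite is_hermitianmxE expr0 scale1r => /eqP DT.
  by rewrite [in LHS]DT !mxE.
have adjH a : (H a)^t* = H a by exact: hermsymm_adj.
have adjn a : (noise_op a)^t* = 'i%C *: H a.
  by rewrite /noise_op adjmxZ rmorphN /= conj_i opprK adjH.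
have SE : \sum_a \sum_b (D' a b)%:C%C *: ((C' b)^t* *m C' a) = S.
  rewrite (change_of_frame (f := fun A B => B *m A)); last 2 first.
  - by move=> B k Y Z; rewrite mulmxDr -scalemxAr.
  - by move=> A k Y Z; rewrite mulmxDl -scalemxAl.
  (* The product of iH_b and -iH_a is H_b H_a; exchanging the sums and using the symmetry of D
     restores the order H_a H_b. *)
  rewrite /S exchange_big /=; apply: eq_bigr => a _; apply: eq_bigr => b _.
  rewrite Dsym adjn /noise_op -scalemxAl -scalemxAr !scalerA; congr (_ *: _).
  rewrite -mulrA mulrN -expr2 sqr_i opprK mulr1 //.
have adjS : S^t* = S.
  rewrite /S adjmx_sum [RHS]exchange_big /=; apply: eq_bigr => a _.
  rewrite adjmx_sum; apply: eq_bigr => b _.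
  by rewrite adjmxZ adjmxM !adjH conj_real Dsym.
have adjK : K^t* = K.
  rewrite /K adjmxD adjmx_sum (hermsymm_adj hH0); congr (_ + _).
  by apply: eq_bigr => a _; rewrite adjmxZ conj_real adjH.
have AE : drift_op u = - 'i%C *: K - 2^-1 *: S.
  exact: drift_rearrange.
have adjA : (drift_op u)^t* = 'i%C *: K - 2^-1 *: S.
  by rewrite AE adjmxD adjmxN !adjmxZ rmorphN /= conj_i conj_half adjK adjS opprK.
rewrite /lindblad_rhs /lindblad_op -/K adjA AE.
have -> : \sum_a \sum_b (D' a b)%:C%C *: (C' a *m X *m (C' b)^t* -
     2^-1 *: anticommutator ((C' b)^t* *m C' a) X) =
   \sum_a \sum_b (D' a b)%:C%C *: (C' a *m X *m (C' b)^t*) -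
   2^-1 *: anticommutator S X.
  have aE : anticommutator S X =
      \sum_a \sum_b (D' a b)%:C%C *: anticommutator ((C' b)^t* *m C' a) X.
    rewrite -SE /anticommutator mulmx_suml mulmx_sumr -big_split /=.
    apply: eq_bigr => a _; rewrite mulmx_suml mulmx_sumr -big_split /=.
    by apply: eq_bigr => b _; rewrite scalerDr -scalemxAl -scalemxAr.
  rewrite aE scaler_sumr -sumrB; apply: eq_bigr => a _.
  rewrite scaler_sumr -sumrB; apply: eq_bigr => b _.
  by rewrite scalerBr !scalerA [_ * 2^-1]mulrC.
rewrite (change_of_frame (f := fun A B => A *m X *m B)); last 2 first.
- by move=> B k Y Z; rewrite !mulmxDl -!scalemxAl.
- by move=> A k Y Z; rewrite mulmxDr -scalemxAr.
have e1 : (- 'i%C *: K - 2^-1 *: S) *m X = - 'i%C *: (K *m X) - 2^-1 *: (S *m X).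
  exact: mulmxZBl.
have e2 : X *m ('i%C *: K - 2^-1 *: S) = 'i%C *: (X *m K) - 2^-1 *: (X *m S).
  exact: mulmxZBr.
by rewrite e1 e2; exact: lindblad_rearrange.
Qed.

End ChangeOfFrame.

End LindbladAlgebra.

(** * The covariance of the Schrodinger process *)

Section ComplexL2.
Context d (X : measurableType d) (R : realType).
Variable mu : {measure set X -> \bar R}.
Implicit Types (x y z : X -> R[i]) (c : R[i]).

Definition csqint x : Prop :=
  sqint mu (fun w => complex.Re (x w)) /\ sqint mu (fun w => complex.Im (x w)).

(** The integral of x times the conjugate of y, written out in real inner products: linear in x and
    antilinear in y. *)
Definition cdot x y : R[i] := Complex
  (dotL2 mu (fun w => complex.Re (x w)) (fun w => complex.Re (y w)) +
   dotL2 mu (fun w => complex.Im (x w)) (fun w => complex.Im (y w)))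
  (dotL2 mu (fun w => complex.Im (x w)) (fun w => complex.Re (y w)) -
   dotL2 mu (fun w => complex.Re (x w)) (fun w => complex.Im (y w))).

Let ReMf c x : (fun w => complex.Re (c * x w)) =
  (fun w => complex.Re c * complex.Re (x w) - complex.Im c * complex.Im (x w)).
Proof. by apply/funext => w; exact: cReM. Qed.

Let ImMf c x : (fun w => complex.Im (c * x w)) =
  (fun w => complex.Re c * complex.Im (x w) + complex.Im c * complex.Re (x w)).
Proof. by apply/funext => w; exact: cImM. Qed.

Let ReDf x y : (fun w => complex.Re (x w + y w)) =
  (fun w => complex.Re (x w) + complex.Re (y w)).
Proof. by apply/funext => w; rewrite cReD. Qed.

Let ImDf x y : (fun w => complex.Im (x w + y w)) =
  (fun w => complex.Im (x w) + complex.Im (y w)).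
Proof. by apply/funext => w; rewrite cImD. Qed.

Lemma csqintZ c x : csqint x -> csqint (fun w => c * x w).
Proof.
move=> [qr qi]; split; rewrite ?ReMf ?ImMf.
  by apply: sqintB; exact: sqintZ.
by apply: sqintD; exact: sqintZ.
Qed.

Lemma csqintD x y : csqint x -> csqint y -> csqint (fun w => x w + y w).
Proof.
move=> [qr qi] [qr' qi']; split; first by rewrite ReDf; exact: sqintD.
by rewrite ImDf; exact: sqintD.
Qed.

Lemma csqint0 : csqint (fun=> 0).
Proof. by split; exact: sqint0. Qed.

Lemma csqint_sum (I : Type) (r : seq I) (f : I -> X -> R[i]) :
  (forall i, csqint (f i)) -> csqint (fun w => \sum_(i <- r) f i w).
Proof.
move=> qf; elim: r => [|i r IH].
  by under eq_fun do rewrite big_nil; exact: csqint0.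
by under eq_fun do rewrite big_cons; exact: csqintD.
Qed.

Lemma cdotZl c x y : csqint x -> csqint y ->
  cdot (fun w => c * x w) y = c * cdot x y.
Proof.
move=> [qr qi] [qr' qi']; rewrite /cdot ReMf ImMf.
have q a := sqintZ a qr; have q' a := sqintZ a qi.
rewrite (dotBl (q _) (q' _) qr') (dotBl (q _) (q' _) qi').
rewrite (dotDl (q' _) (q _) qi') (dotDl (q' _) (q _) qr').
rewrite (dotZl _ qr qr') (dotZl _ qr qi') (dotZl _ qi qr') (dotZl _ qi qi').
rewrite (dotZl _ qr qr') (dotZl _ qr qi') (dotZl _ qi qr') (dotZl _ qi qi').
by apply: complex_ext; rewrite ?cReM ?cImM /=; ring.
Qed.

Lemma cdotDl x y z : csqint x -> csqint y -> csqint z ->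
  cdot (fun w => x w + y w) z = cdot x z + cdot y z.
Proof.
move=> [qr qi] [qr' qi'] [qr'' qi'']; rewrite /cdot ReDf ImDf.
rewrite (dotDl qr qr' qr'') (dotDl qi qi' qi'') (dotDl qi qi' qr'') (dotDl qr qr' qi'').
by apply: complex_ext; rewrite ?cReD ?cImD /=; ring.
Qed.

Lemma cdot_suml (I : Type) (r : seq I) (f : I -> X -> R[i]) z :
  (forall i, csqint (f i)) -> csqint z ->
  cdot (fun w => \sum_(i <- r) f i w) z = \sum_(i <- r) cdot (f i) z.
Proof.
move=> qf qz; elim: r => [|i r IH].
  rewrite big_nil -[RHS](mul0r (cdot (fun=> 0) z)) -cdotZl//; last exact: csqint0.
  by congr cdot; apply/funext => w; rewrite big_nil mul0r.
rewrite big_cons -IH -cdotDl//; last exact: csqint_sum.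
by congr cdot; apply/funext => w; rewrite big_cons.
Qed.

Lemma cdot_conj x y : cdot y x = ((cdot x y)^* )%R.
Proof.
rewrite conj_pairE; apply: complex_ext; rewrite /= ?opprB.
  by congr (_ + _); exact: dotC.
by congr (_ - _); exact: dotC.
Qed.

(** Under a probability this is E[x y^t*], so that x = y = psi_t gives the covariance. *)
Definition gram m n (x : X -> 'cV[R[i]]_m) (y : X -> 'cV[R[i]]_n) : 'M[R[i]]_(m, n) :=
  \matrix_(i, j) cdot (fun w => x w i 0) (fun w => y w j 0).

Lemma gramMl p m n (A : 'M[R[i]]_(p, m)) (x : X -> 'cV[R[i]]_m)
    (y : X -> 'cV[R[i]]_n) :
  (forall i, csqint (fun w => x w i 0)) -> (forall j, csqint (fun w => y w j 0)) ->
  gram (fun w => A *m x w) y = A *m gram x y.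
Proof.
move=> qx qy; apply/matrixP => i j; rewrite !mxE.
have -> : (fun w => (A *m x w) i 0) = (fun w => \sum_k A i k * x w k 0).
  by apply/funext => w; rewrite mxE.
rewrite cdot_suml//; last by move=> k; exact: csqintZ.
by apply: eq_bigr => k _; rewrite cdotZl// mxE.
Qed.

Lemma gram_adj m n (x : X -> 'cV[R[i]]_m) (y : X -> 'cV[R[i]]_n) :
  gram y x = (gram x y)^t*.
Proof. by apply/matrixP => i j; rewrite !mxE cdot_conj. Qed.

Lemma gramMr p m n (A : 'M[R[i]]_(p, n)) (x : X -> 'cV[R[i]]_m)
    (y : X -> 'cV[R[i]]_n) :
  (forall i, csqint (fun w => x w i 0)) -> (forall j, csqint (fun w => y w j 0)) ->
  gram x (fun w => A *m y w) = gram x y *m A^t*.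
Proof. by move=> qx qy; rewrite gram_adj gramMl// adjmxM -gram_adj. Qed.

End ComplexL2.

Section MatrixMeasurability.
Context {R : realType} d (X : measurableType d) (S : set X).

Lemma mx_measurable_cst m n (A : 'M[R[i]]_(m, n)) :
  mx_measurable_fun S (fun=> A).
Proof. by move=> i j; split; exact: measurable_cst. Qed.

Lemma mx_measurableD m n (f g : X -> 'M[R[i]]_(m, n)) :
  mx_measurable_fun S f -> mx_measurable_fun S g ->
  mx_measurable_fun S (fun x => f x + g x).
Proof.
move=> mf mg i j; have [a b] := mf i j; have [a' b'] := mg i j; split.
  by under eq_fun do rewrite mxE cReD; exact: measurable_funD.
by under eq_fun do rewrite mxE cImD; exact: measurable_funD.
Qed.

Lemma mx_measurable_sum (I : Type) (r : seq I) m n (f : I -> X -> 'M[R[i]]_(m, n)) :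
  (forall i, mx_measurable_fun S (f i)) ->
  mx_measurable_fun S (fun x => \sum_(i <- r) f i x).
Proof.
move=> mf; elim: r => [|k r IH].
  by under eq_fun do rewrite big_nil; exact: mx_measurable_cst.
by under eq_fun do rewrite big_cons; exact: mx_measurableD.
Qed.

Lemma mx_measurableM m n p (f : X -> 'M[R[i]]_(m, n)) (g : X -> 'M[R[i]]_(n, p)) :
  mx_measurable_fun S f -> mx_measurable_fun S g ->
  mx_measurable_fun S (fun x => f x *m g x).
Proof.
move=> mf mg i j; split.
  under eq_fun do rewrite mxE cRe_sum; apply: measurable_sum => k.
  under eq_fun do rewrite cReM; have [a b] := mf i k; have [a' b'] := mg k j.
  by apply: measurable_funB; exact: measurable_funM.
under eq_fun do rewrite mxE cIm_sum; apply: measurable_sum => k.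
under eq_fun do rewrite cImM; have [a b] := mf i k; have [a' b'] := mg k j.
by apply: measurable_funD; exact: measurable_funM.
Qed.

Lemma mx_measurable_rZ m n (r : X -> R) (f : X -> 'M[R[i]]_(m, n)) :
  measurable_fun S r -> mx_measurable_fun S f ->
  mx_measurable_fun S (fun x => (r x)%:C%C *: f x).
Proof.
move=> mr mf i j; have [a b] := mf i j; split.
  under eq_fun do rewrite mxE cReM /= mul0r subr0; exact: measurable_funM.
under eq_fun do rewrite mxE cImM /= mul0r addr0; exact: measurable_funM.
Qed.

Lemma mx_measurableZ m n c (f : X -> 'M[R[i]]_(m, n)) :
  mx_measurable_fun S f -> mx_measurable_fun S (fun x => c *: f x).
Proof.
move=> mf i j; have [a b] := mf i j; split.
  under eq_fun do rewrite mxE cReM; by apply: measurable_funB; exact: measurable_funM.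
by under eq_fun do rewrite mxE cImM; apply: measurable_funD; exact: measurable_funM.
Qed.

Lemma mx_measurable_adj m n (f : X -> 'M[R[i]]_(m, n)) :
  mx_measurable_fun S f -> mx_measurable_fun S (fun x => (f x)^t*).
Proof.
move=> mf i j; have [a b] := mf j i; split.
  by under eq_fun do rewrite !mxE conj_pairE.
by under eq_fun do rewrite !mxE conj_pairE /=; exact: measurableT_comp.
Qed.

Lemma mx_measurable_lindblad_op N n (D : 'M[R]_n) (A : X -> 'M[R[i]]_N)
    (C : 'I_n -> 'M[R[i]]_N) (f : X -> 'M[R[i]]_N) :
  mx_measurable_fun S A -> mx_measurable_fun S f ->
  mx_measurable_fun S (fun x => lindblad_op D (A x) C (f x)).
Proof.
move=> mA mf; apply: mx_measurableD; first apply: mx_measurableD.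
- exact: mx_measurableM.
- by apply: mx_measurableM => //; exact: mx_measurable_adj.
- apply: mx_measurable_sum => a; apply: mx_measurable_sum => b.
  apply: mx_measurableZ; apply: mx_measurableM; last exact: mx_measurable_cst.
  by apply: mx_measurableM => //; exact: mx_measurable_cst.
Qed.

End MatrixMeasurability.

(** * Entrywise integrals of matrix-valued functions *)

Section MatrixIntegral.
Context {R : realType}.
Local Notation leb := (@lebesgue_measure R).

Definition mx_integrable m n (t : R) (f : R -> 'M[R[i]]_(m, n)) : Prop :=
  forall i j,
    leb.-integrable `[0, t] (EFin \o (fun s => complex.Re (f s i j))) /\
    leb.-integrable `[0, t] (EFin \o (fun s => complex.Im (f s i j))).

Lemma eq_mx_integral m n (t : R) (f g : R -> 'M[R[i]]_(m, n)) :
  (forall s, 0 <= s <= t -> f s = g s) -> mx_integral f t = mx_integral g t.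
Proof.
move=> fg; apply/matrixP => i j; rewrite !mxE.
by congr Complex; apply: eq_Rintegral => s; rewrite inE /= in_itv /= => /fg ->.
Qed.

Lemma mx_integralD m n (t : R) (f g : R -> 'M[R[i]]_(m, n)) :
  mx_integrable t f -> mx_integrable t g ->
  mx_integral (fun s => f s + g s) t = mx_integral f t + mx_integral g t.
Proof.
move=> hf hg; apply/matrixP => i j; rewrite !mxE.
have [a b] := hf i j; have [a' b'] := hg i j.
apply: complex_ext => /=; rewrite -RintegralD//; apply: eq_Rintegral => s _;
  by rewrite mxE ?cReD ?cImD.
Qed.

Lemma mx_integrableD m n (t : R) (f g : R -> 'M[R[i]]_(m, n)) :
  mx_integrable t f -> mx_integrable t g -> mx_integrable t (fun s => f s + g s).
Proof.
move=> hf hg i j; have [a b] := hf i j; have [a' b'] := hg i j; split.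
  by apply: eq_integrable (integrableD _ a a') => // s _ /=; rewrite mxE cReD.
by apply: eq_integrable (integrableD _ b b') => // s _ /=; rewrite mxE cImD.
Qed.

Lemma mx_integralN m n (t : R) (f : R -> 'M[R[i]]_(m, n)) :
  mx_integrable t f -> mx_integral (fun s => - f s) t = - mx_integral f t.
Proof.
move=> hf; apply/matrixP => i j; rewrite !mxE; have [a b] := hf i j.
apply: complex_ext => /=; rewrite -mulN1r -RintegralZl//; apply: eq_Rintegral => s _;
  by rewrite mxE ?cReN ?cImN mulN1r.
Qed.

Lemma mx_integrableN m n (t : R) (f : R -> 'M[R[i]]_(m, n)) :
  mx_integrable t f -> mx_integrable t (fun s => - f s).
Proof.
move=> hf i j; have [a b] := hf i j; split.
  by apply: eq_integrable (integrableN a) => // s _ /=; rewrite mxE cReN.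
by apply: eq_integrable (integrableN b) => // s _ /=; rewrite mxE cImN.
Qed.

Lemma mx_integral_rZ m n (t : R) (c : R) (f : R -> 'M[R[i]]_(m, n)) :
  mx_integrable t f ->
  mx_integral (fun s => c%:C%C *: f s) t = c%:C%C *: mx_integral f t.
Proof.
move=> hf; apply/matrixP => i j; rewrite !mxE; have [a b] := hf i j.
apply: complex_ext; rewrite ?cReM ?cImM /= mul0r ?subr0 ?addr0 -RintegralZl//;
  by apply: eq_Rintegral => s _; rewrite mxE ?cReM ?cImM /= mul0r ?subr0 ?addr0.
Qed.

Lemma mx_integrable_rZ m n (t : R) (c : R) (f : R -> 'M[R[i]]_(m, n)) :
  mx_integrable t f -> mx_integrable t (fun s => c%:C%C *: f s).
Proof.
move=> hf i j; have [a b] := hf i j; split.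
  apply: eq_integrable (integrableZl _ c a) => // s _ /=.
  by rewrite mxE cReM /= mul0r subr0.
apply: eq_integrable (integrableZl _ c b) => // s _ /=.
by rewrite mxE cImM /= mul0r addr0.
Qed.

Lemma mx_integral_sum (I : Type) (r : seq I) m n (t : R) (f : I -> R -> 'M[R[i]]_(m, n)) :
  (forall i, mx_integrable t (f i)) ->
  mx_integral (fun s => \sum_(i <- r) f i s) t = \sum_(i <- r) mx_integral (f i) t
  /\ mx_integrable t (fun s => \sum_(i <- r) f i s).
Proof.
move=> hf; elim: r => [|k r [IH IH']].
  split.
    rewrite big_nil; apply/matrixP => i j; rewrite !mxE.
    by apply: complex_ext => /=; under eq_Rintegral do rewrite big_nil mxE /=;
      rewrite Rintegral_cst// mul0r.
  move=> i j; split; rewrite (_ : _ \o _ = cst 0%E) ?integrable0//.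
    by apply/funext => s /=; rewrite big_nil mxE.
  by apply/funext => s /=; rewrite big_nil mxE.
split.
  by rewrite big_cons -IH -mx_integralD//; apply: eq_mx_integral => s _; rewrite big_cons.
by under eq_fun do rewrite big_cons; exact: mx_integrableD.
Qed.

Lemma mabs_mx_integrable m n (t : R) (f : R -> 'M[R[i]]_(m, n)) (g : R -> R) :
  mx_measurable_fun (`[0, t] : set (measurableTypeR R)) f -> leb.-integrable `[0, t] (EFin \o g) ->
  (forall s, 0 <= s <= t -> mabs (f s) <= g s) -> mx_integrable t f.
Proof.
move=> mf ig fg i j; have [a b] := mf i j.
have bnd s : `[0, t]%classic s -> cabs (f s i j) <= `|g s|.
  rewrite /= in_itv /= => st; apply: le_trans (le_cabs_mabs _ _ _) _.
  by apply: le_trans (fg _ st) _; exact: ler_norm.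
split; apply: le_integrable ig => //; try exact/measurable_EFinP.
  move=> s st /=; rewrite lee_fin (le_trans _ (bnd s st))//.
  by rewrite /cabs lerDl.
move=> s st /=; rewrite lee_fin (le_trans _ (bnd s st))//.
by rewrite /cabs lerDr.
Qed.

Lemma Rintegral_sum (I : Type) (r : seq I) (A : set (measurableTypeR R))
    (g : I -> R -> R) : measurable A ->
  (forall i, leb.-integrable A (EFin \o g i)) ->
  leb.-integrable A (EFin \o (fun s => \sum_(i <- r) g i s)) /\
  \int[leb]_(s in A) (\sum_(i <- r) g i s) = \sum_(i <- r) \int[leb]_(s in A) (g i s).
Proof.
move=> mA ig; elim: r => [|k r [IH IH']].
  have -> : (fun s => \sum_(i <- [::]) g i s) = cst 0.
    by apply/funext => s; rewrite big_nil.
  split; first exact: integrable0.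
  by rewrite big_nil Rintegral_cst// mul0r.
have -> : (fun s => \sum_(i <- k :: r) g i s) = (fun s => g k s + \sum_(i <- r) g i s).
  by apply/funext => s; rewrite big_cons.
split; last by rewrite big_cons RintegralD// IH'.
exact: (integrableD mA (ig k) IH).
Qed.

Lemma integrable_cabs (t : R) (f : R -> R[i]) :
  leb.-integrable `[0, t] (EFin \o (fun s => complex.Re (f s))) ->
  leb.-integrable `[0, t] (EFin \o (fun s => complex.Im (f s))) ->
  leb.-integrable `[0, t] (EFin \o (fun s => cabs (f s))).
Proof.
move=> a b; have mI : measurable (`[0, t] : set (measurableTypeR R)).
  exact: measurable_itv.
by have := integrableD mI (integrable_norm a) (integrable_norm b).
Qed.

Lemma mx_integrable_mabs m n (t : R) (f : R -> 'M[R[i]]_(m, n)) :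
  mx_integrable t f -> leb.-integrable `[0, t] (EFin \o (fun s => mabs (f s))).
Proof.
move=> hf; apply: (Rintegral_sum _ _ _).1 => // i; apply: (Rintegral_sum _ _ _).1 => // j.
by have [a b] := hf i j; exact: integrable_cabs.
Qed.

(** With the entrywise l^1 norm this is the scalar inequality applied to every real and imaginary
    part and summed. *)
Lemma mabs_mx_integral m n (t : R) (f : R -> 'M[R[i]]_(m, n)) : mx_integrable t f ->
  mabs (mx_integral f t) <= \int[leb]_(s in `[0, t]) mabs (f s).
Proof.
move=> hf.
have ic i j : leb.-integrable `[0, t] (EFin \o (fun s => cabs (f s i j))).
  by have [a b] := hf i j; exact: integrable_cabs.
have mI : measurable (`[0, t] : set (measurableTypeR R)) by exact: measurable_itv.
have ir i := (Rintegral_sum (index_enum _) mI (ic i)).1.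
rewrite /mabs (Rintegral_sum _ mI ir).2; apply: ler_sum => i _.
rewrite (Rintegral_sum _ mI (ic i)).2; apply: ler_sum => j _.
have [a b] := hf i j.
have -> : \int[leb]_(s in `[0, t]) cabs (f s i j) =
    \int[leb]_(s in `[0, t]) `|complex.Re (f s i j)| +
    \int[leb]_(s in `[0, t]) `|complex.Im (f s i j)|.
  exact: (RintegralD mI (integrable_norm a) (integrable_norm b)).
rewrite mxE /cabs /=.
by apply: lerD; exact: le_normr_Rintegral.
Qed.

End MatrixIntegral.

Section L2ProcessClosure.
Context {R : realType} d (Omega : measurableType d) (P : probability Omega R)
        (F : R -> set (set Omega)) (T : R).
Hypothesis hF : filtration F.
Local Notation leb := (@lebesgue_measure R).
Local Notation pi := (leb \x P)%E.
Local Notation l2 := (l2_process P F T).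
Implicit Types (f g : R -> Omega -> R) (x y : R -> Omega -> R[i]).

Lemma l2_processI f : (forall s, 0 <= s <= T -> measurable_wrt (F s) (f s)) ->
  meas_process T f -> sqint pi (trunc T f) -> l2 f.
Proof.
by move=> af mf qf; split => //; rewrite sq_mass_trunc// (sqint_fin qf) ltry.
Qed.

Lemma l2_processD f g : l2 f -> l2 g -> l2 (fun s w => f s w + g s w).
Proof.
move=> lf lg; apply: l2_processI.
- move=> s sT; have [s0 _] := andP sT.
  exact: (measurable_wrtD (filtration_sigma hF s0) (l2_adapted lf sT) (l2_adapted lg sT)).
- exact: measurable_funD (l2_meas lf) (l2_meas lg).
- have := sqintD (l2_trunc lf) (l2_trunc lg); congr sqint.
  by apply/funext => p; rewrite /trunc mulrDl.
Qed.

Lemma l2_process0 : l2 (fun _ _ => 0).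
Proof.
apply: l2_processI.
- move=> s /andP[s0 _]; exact: measurable_wrt_cst (filtration_sigma hF s0).
- exact: measurable_cst.
- have := sqint0 pi; congr sqint.
  by apply/funext => p; rewrite /trunc mul0r.
Qed.

(** The coefficient c will be the real or imaginary part of an entry of the drift operator; here the
    measurability and boundedness of the control enter. *)
Lemma l2_processMl (c : R -> R) K f :
  measurable_fun (`[0, T] : set (measurableTypeR R)) c ->
  (forall s, 0 <= s <= T -> `|c s| <= K) -> l2 f -> l2 (fun s w => c s * f s w).
Proof.
move=> mc cK lf.
have mcf : meas_process T (fun s w => c s * f s w).
  apply: measurable_funM; last exact: l2_meas lf.
  apply: (@measurable_comp _ _ _ (measurableTypeR R * Omega)%type
    (measurableTypeR R) R `[0, T]) => //.
    by move=> _ [[s w] [/= ? _] <-].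
  exact: measurable_funS (@measurable_fst _ _ (measurableTypeR R) Omega).
apply: l2_processI => //.
  move=> s sT; have [s0 _] := andP sT; have sF := filtration_sigma hF s0.
  exact: (measurable_wrtM sF (measurable_wrt_cst sF) (l2_adapted lf sT)).
apply: (le_sqint (measurable_trunc mcf) (sqintZ K (l2_trunc lf))) => -[s w].
rewrite /trunc /= indicE mem_setE in_itv /=; have [sT|_] := boolP (0 <= s <= T).
  rewrite !mulr1 !normrM ler_wpM2r//.
  by apply: le_trans (cK s sT) _; exact: ler_norm.
by rewrite !mulr0n !mulr0 normr0.
Qed.

Definition cl2 x : Prop :=
  l2 (fun s w => complex.Re (x s w)) /\ l2 (fun s w => complex.Im (x s w)).

Lemma eq_l2 f g : (forall s w, f s w = g s w) -> l2 f -> l2 g.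
Proof.
move=> fg; suff -> : f = g by [].
by apply/funext => s; apply/funext => w.
Qed.

Lemma cl2D x y : cl2 x -> cl2 y -> cl2 (fun s w => x s w + y s w).
Proof.
move=> [a b] [a' b']; split.
  by apply: eq_l2 (l2_processD a a') => s w; rewrite cReD.
by apply: eq_l2 (l2_processD b b') => s w; rewrite cImD.
Qed.

Lemma cl2_sum (I : Type) (r : seq I) (x : I -> R -> Omega -> R[i]) :
  (forall i, cl2 (x i)) -> cl2 (fun s w => \sum_(i <- r) x i s w).
Proof.
move=> lx; elim: r => [|i r [ihr ihi]].
  by split; apply: eq_l2 l2_process0 => s w; rewrite big_nil.
have [a b] := cl2D (lx i) (conj ihr ihi).
by split; [apply: eq_l2 a|apply: eq_l2 b] => s w; rewrite big_cons.
Qed.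

Lemma cl2Ml (c : R -> R[i]) K x :
  measurable_fun (`[0, T] : set (measurableTypeR R)) (fun s => complex.Re (c s)) ->
  measurable_fun (`[0, T] : set (measurableTypeR R)) (fun s => complex.Im (c s)) ->
  (forall s, 0 <= s <= T -> cabs (c s) <= K) -> cl2 x ->
  cl2 (fun s w => c s * x s w).
Proof.
move=> mr mi cK [a b].
have rK s : 0 <= s <= T -> `|complex.Re (c s)| <= K.
  by move=> sT; rewrite (le_trans _ (cK s sT))// /cabs lerDl.
have iK s : 0 <= s <= T -> `|- complex.Im (c s)| <= K.
  by move=> sT; rewrite normrN (le_trans _ (cK s sT))// /cabs lerDr.
have iK' s : 0 <= s <= T -> `|complex.Im (c s)| <= K.
  by move=> /iK; rewrite normrN.
have mi' : measurable_fun (`[0, T] : set (measurableTypeR R)) (fun s => - complex.Im (c s)).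
  exact: measurableT_comp.
split.
  apply: eq_l2 (l2_processD (l2_processMl mr rK a) (l2_processMl mi' iK b)) => s w.
  by rewrite cReM mulNr.
apply: eq_l2 (l2_processD (l2_processMl mr rK b) (l2_processMl mi iK' a)) => s w.
by rewrite cImM.
Qed.

Definition mx_l2 m (x : R -> Omega -> 'cV[R[i]]_m) : Prop :=
  forall i, cl2 (fun s w => x s w i 0).

Lemma mx_l2Ml m n (A : R -> 'M[R[i]]_(m, n)) K (x : R -> Omega -> 'cV[R[i]]_n) :
  mx_measurable_fun (`[0, T] : set (measurableTypeR R)) A ->
  (forall s, 0 <= s <= T -> mabs (A s) <= K) -> mx_l2 x ->
  mx_l2 (fun s w => A s *m x s w).
Proof.
move=> mA AK lx i; have AxE s w : (A s *m x s w) i 0 = \sum_j A s i j * x s w j 0.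
  by rewrite mxE.
have [a b] : cl2 (fun s w => \sum_j A s i j * x s w j 0).
  apply: cl2_sum => j; have [mr mi] := mA i j; apply: (cl2Ml mr mi _ (lx j)).
  move=> s /AK; exact: le_trans (le_cabs_mabs _ _ _).
by split; [apply: eq_l2 a|apply: eq_l2 b] => s w; rewrite AxE.
Qed.

Definition ctrunc t x (p : measurableTypeR R * Omega) : R[i] :=
  Complex (trunc t (fun s w => complex.Re (x s w)) p)
          (trunc t (fun s w => complex.Im (x s w)) p).

Lemma cl2_trunc t x : 0 <= t <= T -> cl2 x -> csqint pi (ctrunc t x).
Proof. by move=> tT [a b]; split; [exact: (l2_trunc_le tT a)|exact: (l2_trunc_le tT b)]. Qed.

End L2ProcessClosure.

Section ComplexSecondMoments.
Context {R : realType} d (Omega : measurableType d) (P : probability Omega R)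
        (F : R -> set (set Omega)) (n : nat) (D : 'M[R]_n)
        (W : R -> Omega -> 'cV[R]_n).
Hypotheses (hF : filtration F) (hD : posmx D) (hW : brownian_motion P F D W).
Local Notation leb := (@lebesgue_measure R).
Local Notation pi := (leb \x P)%E.
Variable T : R.
Hypothesis T0 : 0 < T.
Implicit Types (x y al be X Y : R -> Omega -> R[i]) (t : R).

Definition cint (z : R -> R[i]) t : R[i] :=
  Complex (\int[leb]_(s in `[0, t]) complex.Re (z s))
          (\int[leb]_(s in `[0, t]) complex.Im (z s)).

Lemma cdot_ctrunc t x y :
  csqint pi (ctrunc t x) -> csqint pi (ctrunc t y) ->
  [/\ cdot pi (ctrunc t x) (ctrunc t y) = cint (fun s => cdot P (x s) (y s)) t,
      leb.-integrable `[0, t] (EFin \o (fun s => complex.Re (cdot P (x s) (y s)))) &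
      leb.-integrable `[0, t] (EFin \o (fun s => complex.Im (cdot P (x s) (y s))))].
Proof.
move=> [qr qi] [qr' qi'].
have mI : measurable (`[0, t] : set (measurableTypeR R)) by exact: measurable_itv.
have [err irr] := dotL2_trunc qr qr'; have [eii iii] := dotL2_trunc qi qi'.
have [eri iri] := dotL2_trunc qr qi'; have [eir iir] := dotL2_trunc qi qr'.
split.
- apply: complex_ext.
    by apply: etrans (esym (RintegralD mI irr iii)); rewrite -err -eii.
  by apply: etrans (esym (RintegralB mI iir iri)); rewrite -eri -eir.
- exact: (integrableD mI irr iii).
- exact: (integrableB mI iir iri).
Qed.

Definition cito_process (x0 : R[i]) al (f : 'I_n -> R -> Omega -> R[i]) X : Prop :=
  ito_process P F W T (complex.Re x0) (fun s w => complex.Re (al s w))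
    (fun a s w => complex.Re (f a s w)) (fun s w => complex.Re (X s w)) /\
  ito_process P F W T (complex.Im x0) (fun s w => complex.Im (al s w))
    (fun a s w => complex.Im (f a s w)) (fun s w => complex.Im (X s w)).

Lemma cito_process_csqint (x0 : R[i]) al (f : 'I_n -> R -> Omega -> R[i]) X t : 0 <= t <= T ->
  cl2 P F T al -> cl2 P F T X -> cito_process x0 al f X -> csqint P (X t).
Proof.
move=> tT [a b] [a' b'] [hr hi]; split.
  exact: (ito_process_sqint hF T0 tT a a' hr).
exact: (ito_process_sqint hF T0 tT b b' hi).
Qed.

(** The real statement is applied to the four pairs of real and imaginary parts. The matching pairs
    add up to the real part, and the difference of the mixed pairs is the imaginary part; D, being
    real, passes through both. *)
Lemma cito_second_moment (x0 y0 : R[i]) al be (f g : 'I_n -> R -> Omega -> R[i])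
    X Y t : 0 <= t <= T ->
  cl2 P F T al -> (forall s, 0 <= s <= T -> csqint P (al s)) ->
  cl2 P F T be -> (forall s, 0 <= s <= T -> csqint P (be s)) ->
  cl2 P F T X -> cl2 P F T Y ->
  cito_process x0 al f X -> cito_process y0 be g Y ->
  cdot P (X t) (Y t) = x0 * (y0^* )%R +
    cdot pi (ctrunc t al) (ctrunc t Y) + cdot pi (ctrunc t X) (ctrunc t be) +
    \sum_a \sum_b (D a b)%:C%C * cdot pi (ctrunc t (f a)) (ctrunc t (g b)).
Proof.
move=> tT [lar lai] qa [lbr lbi] qb [lXr lXi] [lYr lYi] [hXr hXi] [hYr hYi].
have qar s : 0 <= s <= T -> _ := fun sT => (qa s sT).1.
have qai s : 0 <= s <= T -> _ := fun sT => (qa s sT).2.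
have qbr s : 0 <= s <= T -> _ := fun sT => (qb s sT).1.
have qbi s : 0 <= s <= T -> _ := fun sT => (qb s sT).2.
have err := ito_second_moment hF hD hW T0 tT lar qar lbr qbr lXr lYr hXr hYr.
have eii := ito_second_moment hF hD hW T0 tT lai qai lbi qbi lXi lYi hXi hYi.
have eri := ito_second_moment hF hD hW T0 tT lar qar lbi qbi lXr lYi hXr hYi.
have eir := ito_second_moment hF hD hW T0 tT lai qai lbr qbr lXi lYr hXi hYr.
have sumR (z : 'I_n -> 'I_n -> R[i]) (u v : 'I_n -> 'I_n -> R) :
    (forall a b, complex.Re (z a b) = u a b + v a b) ->
    complex.Re (\sum_a \sum_b (D a b)%:C%C * z a b) =
    \sum_a \sum_b D a b * u a b + \sum_a \sum_b D a b * v a b.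
  move=> h; rewrite cRe_sum -big_split; apply: eq_bigr => a _.
  rewrite cRe_sum -big_split; apply: eq_bigr => b _.
  by rewrite cReM h /= mul0r subr0 mulrDr.
have sumI (z : 'I_n -> 'I_n -> R[i]) (u v : 'I_n -> 'I_n -> R) :
    (forall a b, complex.Im (z a b) = u a b - v a b) ->
    complex.Im (\sum_a \sum_b (D a b)%:C%C * z a b) =
    \sum_a \sum_b D a b * u a b - \sum_a \sum_b D a b * v a b.
  move=> h; rewrite cIm_sum -sumrB; apply: eq_bigr => a _.
  rewrite cIm_sum -sumrB; apply: eq_bigr => b _.
  by rewrite cImM h /= mul0r addr0 mulrBr.
apply: complex_ext.
  rewrite !cReD (sumR _ (fun a b => dotL2 pi (trunc t (fun s w => complex.Re (f a s w)))
      (trunc t (fun s w => complex.Re (g b s w))))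
    (fun a b => dotL2 pi (trunc t (fun s w => complex.Im (f a s w)))
      (trunc t (fun s w => complex.Im (g b s w))))) => //.
  rewrite {1}/cdot [X in X = _]/= err eii cReM conj_pairE.
  have reE x y : complex.Re (cdot pi (ctrunc t x) (ctrunc t y)) =
    dotL2 pi (trunc t (fun s w => complex.Re (x s w))) (trunc t (fun s w => complex.Re (y s w))) +
    dotL2 pi (trunc t (fun s w => complex.Im (x s w))) (trunc t (fun s w => complex.Im (y s w))).
    by [].
  rewrite !reE [complex.Re (Complex _ _)]/= [complex.Im (Complex _ _)]/=.
  ring.
rewrite !cImD (sumI _ (fun a b => dotL2 pi (trunc t (fun s w => complex.Im (f a s w)))
    (trunc t (fun s w => complex.Re (g b s w))))
  (fun a b => dotL2 pi (trunc t (fun s w => complex.Re (f a s w)))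
    (trunc t (fun s w => complex.Im (g b s w))))) => //.
rewrite {1}/cdot [X in X = _]/= eri eir cImM conj_pairE.
have imE x y : complex.Im (cdot pi (ctrunc t x) (ctrunc t y)) =
  dotL2 pi (trunc t (fun s w => complex.Im (x s w))) (trunc t (fun s w => complex.Re (y s w))) -
  dotL2 pi (trunc t (fun s w => complex.Re (x s w))) (trunc t (fun s w => complex.Im (y s w))).
  by [].
rewrite !imE [complex.Re (Complex _ _)]/= [complex.Im (Complex _ _)]/=.
ring.
Qed.

End ComplexSecondMoments.

Section SchrodingerCovariance.
Context {R : realType} (N n : nat) d (Omega : measurableType d)
        (P : probability Omega R) (F : R -> set (set Omega)) (D : 'M[R]_n)
        (W : R -> Omega -> 'cV[R]_n).
Hypotheses (hF : filtration F) (hD : posmx D) (hW : brownian_motion P F D W).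
Local Notation leb := (@lebesgue_measure R).
Local Notation pi := (leb \x P)%E.
Variables (T : R) (H0 : 'M[R[i]]_N) (H : 'I_n -> 'M[R[i]]_N) (u : R -> 'cV[R]_n)
  (psi0 : 'cV[R[i]]_N) (psi : R -> Omega -> 'cV[R[i]]_N).
Hypotheses (T0 : 0 < T) (hu : open_loop_control T u).
Hypothesis hpsi : sse_solution H0 H P F W D T u psi0 psi.
Local Notation A s := (drift_op H0 H D (u s)).
Local Notation C a := (noise_op H a).

Lemma le_Re_sqnorm m (v : 'cV[R[i]]_m) i :
  `|complex.Re (v i 0)| <= Num.sqrt (sqnorm v) /\
  `|complex.Im (v i 0)| <= Num.sqrt (sqnorm v).
Proof.
have le x : x ^+ 2 <= sqnorm v -> `|x| <= Num.sqrt (sqnorm v).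
  by move=> h; rewrite -sqrtr_sqr ler_wsqrtr.
have h : complex.Re (v i 0) ^+ 2 + complex.Im (v i 0) ^+ 2 <= sqnorm v.
  rewrite /sqnorm (bigD1 i)//= big_ord1 lerDl; apply: sumr_ge0 => j _.
  by apply: sumr_ge0 => k _; rewrite addr_ge0// sqr_ge0.
by split; apply: le; apply: le_trans h; rewrite ?lerDl ?lerDr sqr_ge0.
Qed.

(** The hypothesis bounds only the mass of the whole vector; each real and imaginary part is
    dominated by the norm of psi. *)
Lemma psi_l2 : mx_l2 P F T psi.
Proof.
have [ad mp fin _ _] := hpsi.
pose f s w : R := Num.sqrt (sqnorm (psi s w)).
have sq0 s w : 0 <= sqnorm (psi s w).
  by do 2 (apply: sumr_ge0 => ? _); rewrite addr_ge0// sqr_ge0.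
have mf : meas_process T f.
  apply: (measurableT_comp (continuous_measurable_fun (@sqrt_continuous R))).
  apply: measurable_sum => i; apply: measurable_sum => j; have [a b] := mp i j.
  by apply: measurable_funD; exact: measurable_funX.
have qf : sqint pi (trunc T f).
  have fE s w : f s w ^+ 2 = sqnorm (psi s w) by rewrite /f sqr_sqrtr.
  apply: (trunc_sqint mf); rewrite /sq_mass.
  by under eq_integral do under eq_integral do rewrite fE.
have dom (x : R -> Omega -> R) : (forall s w, `|x s w| <= f s w) ->
    (forall s, 0 <= s <= T -> measurable_wrt (F s) (x s)) -> meas_process T x ->
    l2_process P F T x.
  move=> xf ax mx; apply: l2_processI => //.
  apply: (le_sqint (measurable_trunc mx) qf) => -[s w]; rewrite /trunc !normrM ler_wpM2r//.
  by apply: le_trans (xf _ _) _; exact: ler_norm.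
move=> i; have [a b] := mp i 0; split; apply: dom.
- by move=> s w; have [] := le_Re_sqnorm (psi s w) i.
- by move=> s sT; have [] := ad s i 0 sT.
- exact: a.
- by move=> s w; have [] := le_Re_sqnorm (psi s w) i.
- by move=> s sT; have [] := ad s i 0 sT.
- exact: b.
Qed.

Lemma drift_op_measurable :
  mx_measurable_fun (`[0, T] : set (measurableTypeR R)) (fun s => A s).
Proof.
have [mu _] := hu; apply: mx_measurableD; first exact: mx_measurable_cst.
have e s : - ('i%C *: \sum_a (u s a 0)%:C%C *: H a) = - 'i%C *: \sum_a (u s a 0)%:C%C *: H a.
  exact: esym (scaleNr _ _).
rewrite (funext e); apply: mx_measurableZ; apply: mx_measurable_sum => a.
by apply: mx_measurable_rZ; [exact: mu|exact: mx_measurable_cst].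
Qed.

Lemma drift_op_bounded : exists K, forall s, 0 <= s <= T -> mabs (A s) <= K.
Proof.
have [_ [M uM]] := hu; eexists => s sT.
by apply: drift_op_bound => a; exact: uM.
Qed.

Lemma drift_l2 : mx_l2 P F T (fun s w => A s *m psi s w).
Proof.
have [K hK] := drift_op_bounded.
exact: (mx_l2Ml hF drift_op_measurable hK psi_l2).
Qed.

Lemma noise_l2 a : mx_l2 P F T (fun s w => C a *m psi s w).
Proof.
by apply: (mx_l2Ml hF (mx_measurable_cst _ (C a)) (fun _ _ => lexx _)); exact: psi_l2.
Qed.

Lemma psi_cito i : cito_process P F W T (psi0 i 0)
  (fun s w => (A s *m psi s w) i 0) (fun a s w => (C a *m psi s w) i 0)
  (fun s w => psi s w i 0).
Proof.
have CE a : (fun s w => - 'i%C *: (H a *m psi s w)) = (fun s w => C a *m psi s w).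
  by apply/funext => s; apply/funext => w; exact: scalemxAl.
have [_ _ _ _ h] := hpsi; split=> t tT; have [M [hM aeM]] := h t tT.
  exists (fun w => \sum_a complex.Re (M a w i 0)).
    exists (fun a w => complex.Re (M a w i 0)) => // a.
    by have := hM a; rewrite CE => /(_ i 0)[+ _]; exact: (is_ito_lim hF hD hW).
  apply: filterS aeM => w ->; rewrite !mxE !cReD summxE cRe_sum /drift /=.
  by congr (_ + _ + _); apply: eq_Rintegral => s _; rewrite sse_driftE.
exists (fun w => \sum_a complex.Im (M a w i 0)).
  exists (fun a w => complex.Im (M a w i 0)) => // a.
  by have := hM a; rewrite CE => /(_ i 0)[_ +]; exact: (is_ito_lim hF hD hW).
apply: filterS aeM => w ->; rewrite !mxE !cImD summxE cIm_sum /drift /=.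
by congr (_ + _ + _); apply: eq_Rintegral => s _; rewrite sse_driftE.
Qed.

(** Finite mass gives this only for almost every s. The equation gives it for every s, as the
    martingale property at each time and the evaluation at T require. *)
Lemma psi_csqint s i : 0 <= s <= T -> csqint P (fun w => psi s w i 0).
Proof.
move=> sT; exact: (cito_process_csqint hF T0 sT (drift_l2 i) (psi_l2 i) (psi_cito i)).
Qed.

Lemma mulmx_csqint m k (B : 'M[R[i]]_(k, m)) (x : Omega -> 'cV[R[i]]_m) i :
  (forall j, csqint P (fun w => x w j 0)) -> csqint P (fun w => (B *m x w) i 0).
Proof.
move=> qx; have -> : (fun w => (B *m x w) i 0) = (fun w => \sum_j B i j * x w j 0).
  by apply/funext => w; rewrite mxE.
by apply: csqint_sum => j; exact: csqintZ.
Qed.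

Local Notation cov s := (gram P (psi s) (psi s)).

Lemma gram_integral m k t (x : R -> Omega -> 'cV[R[i]]_m) (y : R -> Omega -> 'cV[R[i]]_k) :
  0 <= t <= T -> mx_l2 P F T x -> mx_l2 P F T y ->
  (forall i j, mx_integral (fun s => gram P (x s) (y s)) t i j =
    cdot pi (ctrunc t (fun s w => x s w i 0)) (ctrunc t (fun s w => y s w j 0))) /\
  mx_integrable t (fun s => gram P (x s) (y s)).
Proof.
move=> tT lx ly.
have h i j := cdot_ctrunc (cl2_trunc tT (lx i)) (cl2_trunc tT (ly j)).
split=> i j; have [e ir ii] := h i j.
  rewrite e mxE /cint; congr Complex; apply: eq_Rintegral => s _; by rewrite mxE.
have gE s : gram P (x s) (y s) i j = cdot P (fun w => x s w i 0) (fun w => y s w j 0).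
  by rewrite mxE.
split; first by rewrite (funext (fun s => congr1 (@complex.Re R) (gE s))).
by rewrite (funext (fun s => congr1 (@complex.Im R) (gE s))).
Qed.

(** Entry (i, j) of the moment formula contributes E[(A psi) psi^t*], E[psi (A psi)^t*] and the
    terms D_ab E[(C_a psi)(C_b psi)^t*]; the deterministic operators then come out of the
    expectation. Integrability is recorded alongside because [lindblad_unique] asks for it. *)
Lemma cov_lindblad t : 0 <= t <= T ->
  cov t = psi0 *m psi0^t* +
    mx_integral (fun s => lindblad_op D (A s) (fun a => C a) (cov s)) t /\
  mx_integrable t (fun s => cov s).
Proof.
move=> tT; have [t0 tT'] := andP tT.
have lp := psi_l2; have ld := drift_l2.
have [e1 i1] := gram_integral tT ld lp.
have [e2 i2] := gram_integral tT lp ld.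
have e3 a b := (gram_integral tT (noise_l2 a) (noise_l2 b)).1.
have i3 a b := (gram_integral tT (noise_l2 a) (noise_l2 b)).2.
split; last exact: (gram_integral tT lp lp).2.
pose G1 s := gram P (fun w => A s *m psi s w) (psi s).
pose G2 s := gram P (psi s) (fun w => A s *m psi s w).
pose G3 a b s := gram P (fun w => C a *m psi s w) (fun w => C b *m psi s w).
have i3' a b := mx_integrable_rZ (D a b) (i3 a b).
have s3 a := mx_integral_sum (index_enum _) (i3' a).
have ss3 := mx_integral_sum (index_enum _) (fun a => (s3 a).2).
transitivity (psi0 *m psi0^t* + (mx_integral G1 t + mx_integral G2 t +
    \sum_a \sum_b (D a b)%:C%C *: mx_integral (G3 a b) t)).
  have qA s : 0 <= s <= T -> forall i, csqint P (fun w => (A s *m psi s w) i 0).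
    by move=> sT i; apply: mulmx_csqint => j; exact: psi_csqint.
  apply/matrixP => i j; rewrite [LHS]mxE.
  rewrite (cito_second_moment hF hD hW T0 tT (ld i) (fun s sT => qA s sT i)
    (ld j) (fun s sT => qA s sT j) (lp i) (lp j) (psi_cito i) (psi_cito j)).
  have ppE : (psi0 *m psi0^t* ) i j = psi0 i 0 * ((psi0 j 0)^* )%R.
    by rewrite mxE big_ord1 !mxE.
  have addE (X1 X2 X3 X4 : 'M[R[i]]_N) :
    (X1 + (X2 + X3 + X4)) i j = X1 i j + X2 i j + X3 i j + X4 i j.
    by rewrite !mxE !addrA.
  rewrite -e1 -e2 addE ppE; congr (_ + _).
  rewrite summxE; apply: eq_bigr => a _; rewrite summxE; apply: eq_bigr => b _.
  by rewrite mxE -e3.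
have -> : \sum_a \sum_b (D a b)%:C%C *: mx_integral (G3 a b) t =
    mx_integral (fun s => \sum_a \sum_b (D a b)%:C%C *: G3 a b s) t.
  rewrite ss3.1; apply: eq_bigr => a _; rewrite (s3 a).1; apply: eq_bigr => b _.
  by rewrite (mx_integral_rZ _ (i3 a b)).
congr (_ + _).
rewrite -(mx_integralD i1 i2) -(mx_integralD (mx_integrableD i1 i2) ss3.2).
apply: eq_mx_integral => s /andP[s0 st].
have sT : 0 <= s <= T by rewrite s0 (le_trans st).
have qp i := psi_csqint i sT; have qC a i := mulmx_csqint (C a) i qp.
rewrite /lindblad_op /G3 (gramMl _ qp qp) (gramMr _ qp qp); congr (_ + _).
apply: eq_bigr => a _; apply: eq_bigr => b _; congr (_ *: _).
by rewrite (gramMr _ (qC a) qp) (gramMl _ qp qp).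
Qed.

End SchrodingerCovariance.

(** * Uniqueness for the integrated Lindblad equation *)

Section LindbladUniqueness.
Context {R : realType} (N n : nat).
Local Notation leb := (@lebesgue_measure R).
Implicit Types (X Y : R -> 'M[R[i]]_N).

Lemma mx_integrable_le k m (s t : R) (f : R -> 'M[R[i]]_(k, m)) : s <= t ->
  mx_integrable t f -> mx_integrable s f.
Proof.
move=> st hf i j; have [a b] := hf i j.
by split; [apply: integrableS a|apply: integrableS b] => //;
  apply: subset_itvl; rewrite bnd_simp.
Qed.

Lemma mx_integrable_measurable k m (t : R) (f : R -> 'M[R[i]]_(k, m)) :
  mx_integrable t f -> mx_measurable_fun (`[0, t] : set (measurableTypeR R)) f.
Proof.
move=> hf i j; have [a b] := hf i j.
by split; apply/measurable_EFinP; [exact: measurable_int a|exact: measurable_int b].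
Qed.

Lemma mx_continuous_integrable k m (t : R) (f : R -> 'M[R[i]]_(k, m)) :
  mx_continuous_on `[0, t] f -> mx_integrable t f.
Proof.
move=> hf i j; have [a b] := hf i j.
by split; apply: continuous_compact_integrable => //; exact: segment_compact.
Qed.

(** By linearity the difference of two solutions solves the equation with initial value 0, so its
    norm satisfies the hypothesis of [gronwall0]. Integrability of the solutions is the common
    ground between the covariance and the continuous rho. *)
Lemma lindblad_unique (D : 'M[R]_n) (A : R -> 'M[R[i]]_N)
    (C : 'I_n -> 'M[R[i]]_N) (T K : R) (X0 : 'M[R[i]]_N) X Y : 0 <= T ->
  mx_measurable_fun (`[0, T] : set (measurableTypeR R)) A ->
  (forall s, 0 <= s <= T -> mabs (A s) <= K) ->
  mx_integrable T X -> mx_integrable T Y ->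
  (forall t, 0 <= t <= T ->
    X t = X0 + mx_integral (fun s => lindblad_op D (A s) C (X s)) t) ->
  (forall t, 0 <= t <= T ->
    Y t = X0 + mx_integral (fun s => lindblad_op D (A s) C (Y s)) t) ->
  forall t, 0 <= t <= T -> X t = Y t.
Proof.
move=> T0 mA AK iX iY eX eY.
pose S := \sum_a \sum_b cabs (D a b)%:C%C * (mabs (C a) * mabs ((C b)^t*)).
(* One K bounds A, the other its adjoint, which has the same [mabs], and S bounds the noise part. *)
pose K' := K + K + S.
have LK (s : R) (B : 'M[R[i]]_N) : 0 <= s <= T -> mabs (lindblad_op D (A s) C B) <= K' * mabs B.
  move=> sT; apply: le_trans (lindblad_op_bound _ _ _ _) _.
  by rewrite ler_wpM2r ?mabs_ge0// lerD2r mabs_adj lerD// AK.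
have S0 : 0 <= S.
  by do 2 (apply: sumr_ge0 => ? _); rewrite !mulr_ge0 ?cabs_ge0 ?mabs_ge0.
have K0 : 0 <= K by apply: le_trans (AK 0 _); rewrite ?mabs_ge0 ?lexx.
have K'0 : 0 <= K' by rewrite !addr_ge0.
have iL X1 (t : R) : 0 <= t <= T -> mx_integrable T X1 ->
    mx_integrable t (fun s => lindblad_op D (A s) C (X1 s)).
  move=> /andP[t0 tT] iX1; apply: (mx_integrable_le tT).
  have mI : measurable (`[0, T] : set (measurableTypeR R)) by exact: measurable_itv.
  apply: (mabs_mx_integrable _ (integrableZl mI K' (mx_integrable_mabs iX1))); last first.
    by move=> s sT; exact: LK.
  exact: mx_measurable_lindblad_op mA (mx_integrable_measurable iX1).
pose Z s := X s - Y s.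
have iZ : mx_integrable T Z by exact: mx_integrableD iX (mx_integrableN iY).
have eZ (r : R) : 0 <= r <= T ->
    Z r = mx_integral (fun s => lindblad_op D (A s) C (Z s)) r.
  move=> rT; rewrite /Z eX// eY// opprD addrACA subrr add0r.
  rewrite -(mx_integralN (iL Y r rT iY)) -(mx_integralD (iL X r rT iX)); last first.
    exact: mx_integrableN (iL Y r rT iY).
  by apply: eq_mx_integral => s _; rewrite lindblad_opB.
move=> t tT; apply/eqP; rewrite -subr_eq0; apply/eqP; apply: mabs_eq0.
suff h (r : R) : 0 <= r <= T -> mabs (Z r) <= K' * \int[leb]_(s in `[0, r]) mabs (Z s).
  exact: (gronwall0 K'0 T0 (mx_integrable_mabs iZ) (fun s => mabs_ge0 (Z s)) h).
move=> rT; rewrite eZ//; apply: le_trans (mabs_mx_integral (iL Z r rT iZ)) _.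
have [r0 rT'] := andP rT.
have iZt := mx_integrable_mabs (mx_integrable_le rT' iZ).
have mI : measurable (`[0, r] : set (measurableTypeR R)) by exact: measurable_itv.
rewrite -RintegralZl//; apply: le_Rintegral => //.
- exact: mx_integrable_mabs (iL Z r rT iZ).
- exact: (integrableZl mI K' iZt).
move=> s; rewrite /= in_itv /= => /andP[s0 sr].
by apply: LK; rewrite s0 (le_trans sr).
Qed.

End LindbladUniqueness.

(** * The fidelity and the equality of the costs *)

Section Fidelity.
Context {R : realType} (N : nat).
Implicit Types (v phi : 'cV[R[i]]_N) (X : 'M[R[i]]_N).

Lemma adjmxK m n (A : 'M[R[i]]_(m, n)) : (A^t*)^t* = A.
Proof. by apply/matrixP => i j; rewrite !mxE conjCK. Qed.

Lemma trace_rank1 phi X : \tr (X *m (phi *m phi^t*)) = (phi^t* *m X *m phi) 0 0.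
Proof. by rewrite mulmxA mxtrace_mulC mulmxA /mxtrace big_ord1. Qed.

(** The fidelity of a pure state is the squared modulus of its overlap with phi, so its expectation
    is a second moment of one complex variable. *)
Lemma Re_trace_rank1 phi v (y := (phi^t* *m v) 0 0) :
  complex.Re (\tr (v *m v^t* *m (phi *m phi^t*))) =
  complex.Re y ^+ 2 + complex.Im y ^+ 2.
Proof.
rewrite trace_rank1 mulmxA -[_ *m phi]mulmxA -[X in _ *m (_ *m X)]adjmxK -adjmxM.
rewrite /y; move: (phi^t* *m v) => z; rewrite mxE big_ord1 !mxE conj_pairE cReM /=.
ring.
Qed.

End Fidelity.

Theorem mainTheorem1 (R : realType) (N nc : nat)
    (H0 : 'M[R[i]]_N) (H : 'I_nc -> 'M[R[i]]_N)
    (D Rm : 'M[R]_nc) (Q T : R) (phi psi0 : 'cV[R[i]]_N)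
    (C' : 'I_nc -> 'M[R[i]]_N) (D' : 'M[R]_nc) (G : 'M[R[i]]_nc)
    (d : measure_display) (Omega : measurableType d) (P : probability Omega R)
    (F : R -> set (set Omega)) (W : R -> Omega -> 'cV[R]_nc)
    (U : set (R -> 'cV[R]_nc))
    (rho : (R -> 'cV[R]_nc) -> R -> 'M[R[i]]_N)
    (psi : (R -> 'cV[R]_nc) -> R -> Omega -> 'cV[R[i]]_N)
    (Z : (R -> 'cV[R]_nc) -> Omega -> R)
    (hH0 : H0 \is hermsymmx) (hH : forall a, H a \is hermsymmx)
    (hD : posmx D) (hRm : posmx Rm) (hQ : 0 < Q) (hT : 0 < T)
    (hphi : phi^t* *m phi = 1%:M) (hpsi0 : psi0^t* *m psi0 = 1%:M)
    (hD'sym : D' \is symmetricmx) (hG : G \in unitmx)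
    (hC' : forall b, - 'i%C *: H b = \sum_a G a b *: C' a)
    (hD' : map_mx (real_complex R) D' =
           G *m map_mx (real_complex R) D *m G^t*)
    (hF : filtration F) (hW : brownian_motion P F D W)
    (hU : forall u, U u -> open_loop_control T u)
    (hrho : forall u, U u ->
      lindblad_solution H0 H D' C' T u (psi0 *m psi0^t*) (rho u))
    (hpsi : forall u, U u -> sse_solution H0 H P F W D T u psi0 (psi u))
    (hZ : forall u, U u ->
      is_ito_integral_dot P F W T (fun t => Rm^T *m u t) (Z u)) :
  let Cdet := fun u => (cost_det Q T Rm phi u (rho u))%:E in
  let Cst := fun u => cost_stoch Q T Rm phi P u (psi u) (Z u) in
  [/\ forall u, U u -> Cdet u = Cst u,
      forall u, minimizer U Cdet u <-> minimizer U Cst u &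
      ereal_inf [set Cdet u | u in U] = ereal_inf [set Cst u | u in U] ].
Proof.
move=> Cdet Cst.
have TT : 0 <= T <= T by rewrite (ltW hT) lexx.
have [Dsym _] := hD.
have E u : U u -> Cdet u = Cst u.
  move=> Uu; have hu := hU u Uu; have hp := hpsi u Uu; have [crho erho] := hrho u Uu.
  have qpsi i := psi_csqint hF hD hW hT hu hp i TT.
  have covE : gram P (psi u T) (psi u T) = rho u T.
    have [K AK] := drift_op_bounded D H0 H hu.
    have mA := drift_op_measurable D H0 H hu.
    have icov := (cov_lindblad hF hD hW hT hu hp TT).2.
    have erho' t : 0 <= t <= T -> rho u t = psi0 *m psi0^t* +
        mx_integral (fun s => lindblad_op D (drift_op H0 H D (u s)) (noise_op H) (rho u s)) t.
      move=> tT; apply: etrans (erho t tT) _; congr (_ + _); apply: eq_mx_integral => s _.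
      exact: (lindblad_rhsE hC' hD' hH0 hH Dsym).
    exact: (lindblad_unique (ltW hT) mA AK icov (mx_continuous_integrable crho)
      (fun t tT => (cov_lindblad hF hD hW hT hu hp tT).1) erho' TT).
  pose y w := (phi^t* *m psi u T w) 0 0.
  have [qyr qyi] : csqint P y by exact: mulmx_csqint.
  have fidE : complex.Re (\tr (rho u T *m (phi *m phi^t*))) =
      dotL2 P (fun w => complex.Re (y w)) (fun w => complex.Re (y w)) +
      dotL2 P (fun w => complex.Im (y w)) (fun w => complex.Im (y w)).
    have qy (i : 'I_1) : csqint P (fun w => (phi^t* *m psi u T w) i 0).
      exact: mulmx_csqint.
    (* Writing the right factor phi as the adjoint of phi^t* lets both factors enter the Gram
       matrix, which becomes the 1 x 1 matrix of [y] against itself. *)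
    rewrite trace_rank1 -covE -gramMl// -[X in _ *m X]adjmxK -gramMr//.
    by rewrite mxE.
  (* The integrand u^T R of Z is stored as the column R^T u. As a noise part, Z is square integrable
     and centered. *)
  have hN : noise_part P F W T (fun a s _ => (Rm^T *m u s) a 0) (Z u).
    have [J [hJ ->]] := hZ u Uu; exists J => // a.
    exact: (is_ito_lim hF hD hW (hJ a)).
  have iZ := sqint_integrable (noise_sqint hN).
  have Z0 : \int[P]_w Z u w = 0.
    rewrite -[RHS](noise_mean0 hF hD hW 1 hN); apply: eq_Rintegral => w _.
    by rewrite mul1r.
  have iyr := sqintM qyr qyr; have iyi := sqintM qyi qyi.
  set e := control_energy T Rm u.
  have ic : P.-integrable setT (EFin \o (cst e)).
    exact: finite_measure_integrable_cst.
  pose f w := complex.Re (y w) * complex.Re (y w) + complex.Im (y w) * complex.Im (y w).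
  have iy : P.-integrable setT (EFin \o f) by exact: (integrableD measurableT iyr iyi).
  have iQ : P.-integrable setT (EFin \o (fun w => - (Q / 2) * f w)).
    exact: (integrableZl measurableT (- (Q / 2)) iy).
  have iQc : P.-integrable setT (EFin \o (fun w => - (Q / 2) * f w + e)).
    exact: (integrableD measurableT iQ ic).
  rewrite /Cdet /Cst /cost_det /cost_stoch -/e unlock.
  transitivity (\int[P]_w (- (Q / 2) * f w + e + Z u w)%:E)%E; last first.
    by apply: eq_integral => w _; rewrite Re_trace_rank1.
  rewrite fidE.
  have iall : P.-integrable setT (EFin \o (fun w => - (Q / 2) * f w + e + Z u w)).
    exact: (integrableD measurableT iQc iZ).
  (* The stochastic cost is an extended real; its integrand being integrable, it is finite, and the
     comparison continues with real integrals. *)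
  rewrite -[RHS]fineK; last exact: (integrable_fin_num measurableT iall).
  congr EFin; apply: esym.
  apply: etrans (RintegralD measurableT iQc iZ) _; rewrite Z0 addr0.
  apply: etrans (RintegralD measurableT iQ ic) _; congr (_ + _).
    rewrite RintegralZl//; congr (_ * _).
    exact: (RintegralD measurableT iyr iyi).
  by rewrite Rintegral_cst// [X in fine X]probability_setT mulr1.
split=> //.
- move=> u; split=> -[Uu h]; split=> // v Uv.
    by rewrite -!E//; exact: h.
  by rewrite !E//; exact: h.
- by congr ereal_inf; apply: eq_imagel => u Uu; exact: E.
Qed.
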